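(* With the notation of the context: the subshifts $\mathcal X_{\mathcal P_{\mathcal U},R_{\mathcal U}}$ and $\Omega_{\mathcal U}$ are topologically conjugate and are equal to the minimal aperiodic substitutive subshift $\mathcal X_{\omega_{\mathcal U}}$. The subshifts $\mathcal X_{\mathcal P_8,R_8}$ and $\Omega_{12}$ are topologically conjugate. The subshifts $\mathcal X_{\mathcal P_0,R_0}$ and $X_0$ are topologically conjugate, and the same holds for intermediate subshifts: $$\mathcal X_{\mathcal P_1,R_1}=\jmath(\Omega_5),\quad \mathcal X_{\mathcal P_3,R_3}=\Omega_7,\quad \mathcal X_{\mathcal P_4,R_4}=\Omega_8,\quad \mathcal X_{\mathcal P_5,R_5}=\Omega_9,\quad \mathcal X_{\mathcal P_6,R_6}=\Omega_{10},\quad \mathcal X_{\mathcal P_7,R_7}=\Omega_{11}.$$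
   Context: **Subshifts.** $\mathcal A^{\mathbb Z^2}$ has the product topology and the shift $(\sigma^{\boldsymbol n}(x))_{\boldsymbol m}=x_{\boldsymbol m+\boldsymbol n}$; a subshift is a closed shift-invariant subset; $\overline X^{\sigma}=\bigcup_{\boldsymbol k\in\mathbb Z^2}\sigma^{\boldsymbol k}(X)$. A topological conjugacy is a homeomorphism commuting with the shifts. A nonempty subshift is aperiodic if the shift acts freely on it, and minimal if it contains no nonempty proper closed shift-invariant subset. **Words and morphisms.** A $2$-dimensional word of shape $(n_1,n_2)$ over $\mathcal A$ is a map $\{0,\dots,n_1-1\}\times\{0,\dots,n_2-1\}\to\mathcal A$. Below, $[a,b]$ is the row read left to right, $\langle a_1,\dots,a_n\rangle$ is the column read from bottom to top, and $\begin{pmatrix}c&d\\ a&b\end{pmatrix}$ is the $2\times2$ word with bottom row $a,b$ and top row $c,d$. A $2$-dimensional morphism is determined by images of letters and satisfies $\omega(u\odot^iv)=\omega(u)\odot^i\omega(v)$ whenever the concatenation $u\odot^iv$ in direction $\boldsymbol e_i$ lies in its domain language; it extends to configurations with the lower-left corner of the image of $x_{\boldsymbol 0}$ at the origin. For $M=\begin{pmatrix}1&1\\0&1\end{pmatrix}$ let $\theta_M(w)(\boldsymbol n)=w(M^{-1}\boldsymbol n)$. For an expansive morphism $\omega$ (the images $\omega^m(a)$ get arbitrarily large in width and height), $\mathcal X_\omega$ is the set of configurations all of whose finite rectangular subwords are subwords of $\omega^n(a)$ for some letter $a$ and $n\in\mathbb N$. **Symbolic systems.** A topological partition of a torus $\mathbf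 T$ is a finite collection $\mathcal P=\{P_a\}_{a\in\mathcal A}$ of disjoint open sets whose closures cover $\mathbf T$. Given a $\mathbb Z^2$-rotation $R$ on $\mathbf T$, a pattern $w\in\mathcal A^S$ ($S\subset\mathbb Z^2$ finite) is allowed if $\bigcap_{\boldsymbol k\in S}R^{-\boldsymbol k}(P_{w_{\boldsymbol k}})\neq\varnothing$, and $\mathcal X_{\mathcal P,R}$ is the set of configurations all of whose finite patterns are allowed. **$\mathcal P_0$ and $\mathcal P_{\mathcal U}$.** Let $\varphi=\frac{1+\sqrt5}2$, $s=\varphi^{-1}$, $t=\varphi^{-2}$, $u=\varphi^{-3}$, $\Gamma_0=\langle(\varphi,0),(1,\varphi+3)\rangle_{\mathbb Z}$, $R_0^{\boldsymbol n}(\boldsymbol x)=\boldsymbol x+\boldsymbol n$ on $\mathbb R^2/\Gamma_0$. $\mathcal P_0$ is indexed by $\{0,\dots,10\}$; each atom is the image in $\mathbb R^2/\Gamma_0$ of the union of interiors of the following polygons (vertices in cyclic order) in the fundamental domain $[0,\varphi)\times[0,\varphi+3)$: - 0: $(0,0),(s,0),(s,1)$; $(s,0),(1,0),(1,1)$; $(1,0),(\varphi,0),(\varphi,1)$. - 1: $(0,0),(s,1),(0,1)$; $(s,0),(1,1),(s,1)$; $(1,0),(\varphi,1),(1,1)$. - 2: $(0,2),(s,\varphi+2),(0,\varphi+1)$. - 3: $(1,1),(\varphi,2),(\varphi,\varphi+2),(1,2)$. - 4: $(0,2),(1,\varphi+2),(1,\varphi+3)$. - 5: $(0,\varphi+1),(s,\varphi+2),(1,\varphi+3),(t,\varphi+2),(t,\varphi+3),(0,\varphi+2)$.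 - 6: $(0,\varphi+2),(t,\varphi+3),(0,\varphi+3)$; $(t,\varphi+2),(1,\varphi+3),(t,\varphi+3)$; $(1,\varphi+2),(\varphi,\varphi+3),(1,\varphi+3)$. - 7: $(0,1),(1,\varphi+2),(0,2)$; $(1,\varphi+1),(\varphi,\varphi+2),(\varphi,\varphi+3),(1,\varphi+2)$. - 8: $(s,1),(\varphi,\varphi+2),(s,2)$. - 9: $(0,1),(s,1),(s,2)$; $(s,1),(1,1),(1,2)$; $(1,1),(\varphi,1),(\varphi,2)$. - 10: $(0,1),(1,\varphi+1),(1,\varphi+2)$. $R_{\mathcal U}^{\boldsymbol n}(\boldsymbol x)=\boldsymbol x+\varphi^{-2}\boldsymbol n$ on $\mathbb R^2/\mathbb Z^2$, and $\mathcal P_{\mathcal U}$ is indexed by $\{0,\dots,18\}$ with atoms the images of the interiors of the polygons with vertices 0: $(s,s),(2t,s),(s,2t)$; 1: $(2t,s),(1,s),(1,1),(s,1),(s,2t)$; 2: $(u,s),(t,s),(0,1)$; 3: $(0,s),(u,s),(0,1)$; 4: $(s,s),(s,2t),(t,1)$; 5: $(s,2t),(s,1),(t,1)$; 6: $(t,s),(t,1),(0,1)$; 7: $(t,s),(s,s),(t,1)$; 8: $(s,0),(1,0),(s,t)$; 9: $(1,0),(1,t),(2t,s),(s,s)$; 10: $(1,t),(1,s),(2t,s)$; 11: $(s,t),(1,0),(s,s)$; 12: $(t,t),(t,s),(u,s)$; 13: $(s,0),(s,t),(t,s),(t,t)$; 14: $(t,0),(t,t),(u,s),(0,s)$; 15: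 $(t,0),(s,0),(t,t)$; 16: $(0,0),(t,0),(0,t)$; 17: $(t,0),(0,s),(0,t)$; 18: $(s,t),(s,s),(t,s)$. **Labelled induction.** Given a $\mathbb Z^2$-rotation $R$ on a torus $\mathbf T$, a topological partition $\mathcal P=\{P_a\}$ of $\mathbf T$ indexed by nonnegative integers, an open $W\subset\mathbf T$ and $i\in\{1,2\}$: for $\boldsymbol x\in W$ let $r(\boldsymbol x)$ be the least $r\ge1$ with $R^{r\boldsymbol e_i}(\boldsymbol x)\in W$, and, if no $R^{k\boldsymbol e_i}(\boldsymbol x)$ with $0\le k<r(\boldsymbol x)$ lies on the boundary of an atom, let $w(\boldsymbol x)$ be the word of length $r(\boldsymbol x)$ whose $k$-th letter is the index of the atom containing $R^{k\boldsymbol e_i}(\boldsymbol x)$. List in radix order (shorter words first, words of the same length lexicographically) the words $w_0,w_1,\dots$ for which $\{\boldsymbol x\in W: w(\boldsymbol x)=w_b\}$ has nonempty interior. $\mathrm{Ind}_i(\mathcal P,R,W)$ is the partition of $W$ whose atom of index $b$ is the interior of $\{\boldsymbol x\in W:w(\boldsymbol x)=w_b\}$. In the steps below $W$ is identified (up to boundary) with the indicated next torus. **The systems $(\mathcal P_i,R_i)$.** - $\mathcal P_1=\mathrm{Ind}_2(\mathcal P_0,R_0,(0,\varphi)\times(0,1))$ on $\mathbb R^2/(\varphi\mathbb Z\times\mathbb Z)$, $R_1^{\boldsymbol n}(\boldsymbol x)=\boldsymbol x+n_1\boldsymbol e_1+n_2(\varphi^{-1},\varphi^{-2})$. - $\mathcal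 P_2=\mathcal P_1$, $R_2^{\boldsymbol n}(\boldsymbol x)=\boldsymbol x+(n_1,\varphi^{-2}n_2)$ on $\mathbb R^2/(\varphi\mathbb Z\times\mathbb Z)$. - $\mathcal P_3=\mathrm{Ind}_1(\mathcal P_2,R_2,(0,1)^2)$ on $\mathbb R^2/\mathbb Z^2$, $R_3^{\boldsymbol n}(\boldsymbol x)=\boldsymbol x+\varphi^{-2}\boldsymbol n$. - $\mathcal P_4=\mathrm{Ind}_1(\mathcal P_3,R_3,(0,s)\times(0,1))$ on $\mathbb R^2/(s\mathbb Z\times\mathbb Z)$, $R_4^{\boldsymbol n}(\boldsymbol x)=\boldsymbol x+(-\varphi^{-3}n_1,\varphi^{-2}n_2)$. - $\mathcal P_5=\mathrm{Ind}_2(\mathcal P_4,R_4,(0,s)^2)$ on $\mathbb R^2/(s\mathbb Z)^2$, $R_5^{\boldsymbol n}(\boldsymbol x)=\boldsymbol x-\varphi^{-3}\boldsymbol n$. - With $h(\boldsymbol x)=-\varphi\boldsymbol x$, $h:\mathbb R^2/(s\mathbb Z)^2\to\mathbb R^2/\mathbb Z^2$: $\mathcal P_6=\mathrm{Ind}_1(h(\mathcal P_5),R_3,(0,s)\times(0,1))$ on $\mathbb R^2/(s\mathbb Z\times\mathbb Z)$, $R_6=R_4$. - $\mathcal P_7=\mathrm{Ind}_2(\mathcal P_6,R_6,(0,s)^2)$ on $\mathbb R^2/(s\mathbb Z)^2$, $R_7=R_5$. - $\mathcal P_8=\mathrm{Ind}_1(h(\mathcal P_7),R_3,(0,s)\times(0,1))$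 on $\mathbb R^2/(s\mathbb Z\times\mathbb Z)$, $R_8=R_4$. **The Wang-shift side.** $\Omega_{\mathcal U}\subset\{0,\dots,18\}^{\mathbb Z^2}$ is the Wang shift of the following 19 tiles, tile number $k$ being given as (right, top, left, bottom) colors, for $k=0,\dots,18$ in order: $FOJO$, $FOHL$, $JMFP$, $DMFK$, $HPJP$, $HPHN$, $HKFP$, $HKDP$, $BOIO$, $GLEO$, $GLCL$, $ALIO$, $EPGP$, $EPIP$, $IPGK$, $IPIK$, $IKBM$, $IKAK$, $CNIP$. That is, $w\in\Omega_{\mathcal U}$ iff for every $\boldsymbol n$, the right color of tile $w_{\boldsymbol n}$ is the left color of $w_{\boldsymbol n+\boldsymbol e_1}$ and the top color of $w_{\boldsymbol n}$ is the bottom color of $w_{\boldsymbol n+\boldsymbol e_2}$. The other Wang-shift-side subshifts are: $\Omega_{12}=\rho(\Omega_{\mathcal U})$, $\Omega_i=\overline{\omega_i(\Omega_{i+1})}^{\sigma}$ for $i=11,10,9,8,7$, $\jmath(\Omega_5)=\theta_M\big(\overline{\kappa(\Omega_7)}^{\sigma}\big)$, and $X_0=\overline{\omega_{0123}(\jmath(\Omega_5))}^{\sigma}$ ($X_0$ is a minimal subshift of the Jeandel-Rao Wang shift $\Omega_0$), where: - $\omega_{0123}$: $0\mapsto\langle0,9,3,7\rangle$, $1\mapsto\langle0,9,7,5\rangle$, $2\mapsto\langle0,9,10,4\rangle$, $3\mapsto\langle1,3,3,7\rangle$, $4\mapsto\langle1,3,7,6\rangle$, $5\mapsto\langle1,3,8,7\rangle$,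 $6\mapsto\langle1,7,2,5\rangle$, $7\mapsto\langle1,7,5,5\rangle$, $8\mapsto\langle1,7,5,6\rangle$, $9\mapsto\langle1,8,7,5\rangle$, $10\mapsto\langle1,8,10,4\rangle$, $11\mapsto\langle1,10,4,5\rangle$, $12\mapsto\langle1,10,4,6\rangle$, $13\mapsto\langle0,9,3,3,7\rangle$, $14\mapsto\langle0,9,3,7,6\rangle$, $15\mapsto\langle0,9,3,8,7\rangle$, $16\mapsto\langle0,9,7,2,5\rangle$, $17\mapsto\langle0,9,7,2,6\rangle$, $18\mapsto\langle0,9,7,5,5\rangle$, $19\mapsto\langle0,9,7,5,6\rangle$, $20\mapsto\langle0,9,8,7,5\rangle$, $21\mapsto\langle0,9,8,10,4\rangle$, $22\mapsto\langle0,9,10,4,6\rangle$, $23\mapsto\langle1,3,3,7,6\rangle$, $24\mapsto\langle1,3,8,7,6\rangle$, $25\mapsto\langle1,7,2,5,6\rangle$, $26\mapsto\langle1,8,10,4,6\rangle$, $27\mapsto\langle1,10,4,5,6\rangle$. - $\kappa$: $0\mapsto2$, $1\mapsto9$, $2\mapsto10$, $3\mapsto20$, $4\mapsto21$, $5\mapsto22$, $6\mapsto26$, $7\mapsto[1,0]$, $8\mapsto[6,5]$, $9\mapsto[7,4]$, $10\mapsto[8,4]$, $11\mapsto[11,3]$, $12\mapsto[12,3]$, $13\mapsto[16,15]$, $14\mapsto[17,15]$, $15\mapsto[18,14]$, $16\mapsto[19,14]$, $17\mapsto[22,13]$, $18\mapsto[25,24]$, $19\mapsto[27,23]$. - $\omega_7$: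 $0\mapsto8$, $1\mapsto9$, $2\mapsto10$, $3\mapsto15$, $4\mapsto16$, $5\mapsto18$, $6\mapsto19$, $7\mapsto[7,0]$, $8\mapsto[7,2]$, $9\mapsto[8,1]$, $10\mapsto[11,2]$, $11\mapsto[12,2]$, $12\mapsto[13,3]$, $13\mapsto[14,3]$, $14\mapsto[15,5]$, $15\mapsto[15,6]$, $16\mapsto[16,5]$, $17\mapsto[16,6]$, $18\mapsto[17,4]$, $19\mapsto[19,6]$. - $\omega_8$: $0\mapsto3$, $1\mapsto4$, $2\mapsto5$, $3\mapsto6$, $4\mapsto12$, $5\mapsto13$, $6\mapsto14$, $7\mapsto15$, $8\mapsto18$, $9\mapsto\langle4,0\rangle$, $10\mapsto\langle5,0\rangle$, $11\mapsto\langle5,1\rangle$, $12\mapsto\langle5,2\rangle$, $13\mapsto\langle6,0\rangle$, $14\mapsto\langle13,8\rangle$, $15\mapsto\langle14,10\rangle$, $16\mapsto\langle15,10\rangle$, $17\mapsto\langle16,11\rangle$, $18\mapsto\langle17,9\rangle$, $19\mapsto\langle17,11\rangle$, $20\mapsto\langle18,7\rangle$, $21\mapsto\langle19,9\rangle$. - $\omega_9$: $0\mapsto8$, $1\mapsto14$, $2\mapsto17$, $3\mapsto20$, $4\mapsto[4,1]$, $5\mapsto[5,1]$, $6\mapsto[6,3]$, $7\mapsto[7,2]$, $8\mapsto[8,0]$, $9\mapsto[14,9]$, $10\mapsto[15,13]$, $11\mapsto[16,10]$, $12\mapsto[16,11]$, $13\mapsto[17,13]$, $14\mapsto[18,12]$,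 $15\mapsto[19,10]$, $16\mapsto[19,11]$, $17\mapsto[21,12]$. - $\omega_{10}$: $0\mapsto1$, $1\mapsto2$, $2\mapsto3$, $3\mapsto12$, $4\mapsto13$, $5\mapsto14$, $6\mapsto15$, $7\mapsto16$, $8\mapsto17$, $9\mapsto\langle1,0\rangle$, $10\mapsto\langle2,0\rangle$, $11\mapsto\langle3,0\rangle$, $12\mapsto\langle9,8\rangle$, $13\mapsto\langle10,4\rangle$, $14\mapsto\langle11,4\rangle$, $15\mapsto\langle12,6\rangle$, $16\mapsto\langle13,5\rangle$, $17\mapsto\langle13,8\rangle$, $18\mapsto\langle14,7\rangle$, $19\mapsto\langle15,5\rangle$, $20\mapsto\langle17,7\rangle$. - $\omega_{11}$: $0\mapsto5$, $1\mapsto8$, $2\mapsto14$, $3\mapsto15$, $4\mapsto18$, $5\mapsto20$, $6\mapsto[3,1]$, $7\mapsto[4,2]$, $8\mapsto[5,1]$, $9\mapsto[6,0]$, $10\mapsto[7,1]$, $11\mapsto[8,1]$, $12\mapsto[12,11]$, $13\mapsto[13,11]$, $14\mapsto[14,9]$, $15\mapsto[15,10]$, $16\mapsto[16,11]$, $17\mapsto[17,11]$, $18\mapsto[19,9]$. - $\rho$ (letterwise): $0\mapsto0$, $1\mapsto1$, $2\mapsto9$, $3\mapsto7$, $4\mapsto8$, $5\mapsto11$, $6\mapsto10$, $7\mapsto6$, $8\mapsto2$, $9\mapsto4$, $10\mapsto5$, $11\mapsto3$, $12\mapsto18$, $13\mapsto14$, $14\mapsto16$, $15\mapsto13$, $16\mapsto12$,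 $17\mapsto17$, $18\mapsto15$. - $\omega_{\mathcal U}$: $0\mapsto17$, $1\mapsto16$, $2\mapsto[15,11]$, $3\mapsto[13,9]$, $4\mapsto[17,8]$, $5\mapsto[16,8]$, $6\mapsto[15,8]$, $7\mapsto[14,8]$, $8\mapsto\langle14,6\rangle$, $9\mapsto\langle17,3\rangle$, $10\mapsto\langle16,3\rangle$, $11\mapsto\langle14,2\rangle$, $12\mapsto\begin{pmatrix}7&1\\15&11\end{pmatrix}$, $13\mapsto\begin{pmatrix}6&1\\14&11\end{pmatrix}$, $14\mapsto\begin{pmatrix}7&1\\13&9\end{pmatrix}$, $15\mapsto\begin{pmatrix}6&1\\12&9\end{pmatrix}$, $16\mapsto\begin{pmatrix}5&1\\18&10\end{pmatrix}$, $17\mapsto\begin{pmatrix}4&1\\13&9\end{pmatrix}$, $18\mapsto\begin{pmatrix}2&0\\14&8\end{pmatrix}$. *)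

(* Defs.v *)
From Stdlib Require Import Ascii String.
From HB Require Import structures.
From mathcomp Require Import all_boot all_order all_algebra.
From mathcomp Require Import all_classical all_reals all_analysis.
Import numFieldNormedType.Exports.

Set Implicit Arguments.
Unset Strict Implicit.
Unset Printing Implicit Defensive.

Import Order.TTheory GRing.Theory Num.Theory.
Local Open Scope classical_set_scope.
Local Open Scope ring_scope.
Local Open Scope quotient_scope.

(* All alphabets are initial segments {0, ..., k-1} of nat, so configurations
   over any of them live in the single space nat^(Z^2); the topology induced
   on {0, ..., k-1}^(Z^2) is the product of the discrete topologies. *)
Definition config := {ptws (int * int) -> nat}.

Definition e1 : int * int := (1, 0).
Definition e2 : int * int := (0, 1).

Definition sigma (n : int * int) (x : config) : config := fun m => x (m + n).

Definition subshift (X : set config) :=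
  closed X /\ forall n, sigma n @` X `<=` X.

Definition orbit_closure (X : set config) : set config :=
  \bigcup_(k in [set: int * int]) (sigma k @` X).

Definition conjugate (X Y : set config) :=
  [/\ subshift X, subshift Y &
    exists f g : config -> config,
      [/\ {within X, continuous f}, {within Y, continuous g},
          forall x, X x -> Y (f x) /\ g (f x) = x,
          forall y, Y y -> X (g y) /\ f (g y) = y &
          forall n x, X x -> f (sigma n x) = sigma n (f x)]].

Definition aperiodic (X : set config) :=
  [/\ subshift X, X !=set0 &
    forall x n, X x -> sigma n x = x -> n = 0].

Definition minimal (X : set config) :=
  [/\ subshift X, X !=set0 &
    forall Y, subshift Y -> Y !=set0 -> Y `<=` X -> Y = X].

(* A word of shape (n1, n2) is the list of its n1 columns, each one read from
   bottom to top; the letter at position (i, j) is [wletter u i j]. *)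
Definition word2 := seq (seq nat).

Definition width (u : word2) : nat := size u.
Definition height (u : word2) : nat := size (head [::] u).
Definition wletter (u : word2) (i j : nat) : nat := nth 0%N (nth [::] u i) j.

Definition letter (a : nat) : word2 := [:: [:: a]].
Definition hword (s : seq nat) : word2 := [seq [:: a] | a <- s].
Definition vword (s : seq nat) : word2 := [:: s].
(* bottom row a, b and top row c, d *)
Definition block (c d a b : nat) : word2 := [:: [:: a; c]; [:: b; d]].

(* concatenation in direction e1 (v to the right of u) and in direction e2
   (v on top of u) *)
Definition hcat (u v : word2) : word2 := u ++ v.
Definition vcat (u v : word2) : word2 := [seq p.1 ++ p.2 | p <- zip u v].

(* A morphism is given by the list of the images of the letters 0, 1, ... *)
Definition morphism2 := seq word2.
Definition image_of_letter (om : morphism2) (a : nat) : word2 := nth [::] om a.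

(* [word_image om u v] : om (u) is defined and is equal to v. *)
Inductive word_image (om : morphism2) : word2 -> word2 -> Prop :=
| WordImageLetter a : (a < size om)%N ->
    word_image om (letter a) (image_of_letter om a)
| WordImageH u v u' v' : height u = height v ->
    word_image om u u' -> word_image om v v' -> height u' = height v' ->
    word_image om (hcat u v) (hcat u' v')
| WordImageV u v u' v' : width u = width v ->
    word_image om u u' -> word_image om v v' -> width u' = width v' ->
    word_image om (vcat u v) (vcat u' v').

(* [iter_image om n a v] : om^n (a) is defined and is equal to v. *)
Fixpoint iter_image (om : morphism2) (n : nat) (a : nat) (v : word2) : Prop :=
  if n is m.+1 then exists2 u, iter_image om m a u & word_image om u v
  else (a < size om)%N /\ v = letter a.

Definition expansive (om : morphism2) := forall a K, (a < size om)%N ->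
  exists m v, [/\ iter_image om m a v, (K < width v)%N & (K < height v)%N].

(* the subword of x of shape m and lower-left corner at position n occurs
   in v *)
Definition subword_in (x : config) (n : int * int) (m : nat * nat)
    (v : word2) :=
  exists p q : nat, [/\ (p + m.1 <= width v)%N, (q + m.2 <= height v)%N &
    forall i j : nat, (i < m.1)%N -> (j < m.2)%N ->
      x (n.1 + i%:Z, n.2 + j%:Z) = wletter v (p + i) (q + j)].

Definition substitutive_shift (om : morphism2) : set config :=
  [set x | forall n m, exists a k v, iter_image om k a v /\ subword_in x n m v].

(* [config_image om x y] : om (x) is defined and is equal to y. The image of
   the letter x_(i, j) has its lower-left corner at (X i, Y j); images of
   letters in a same column have the same width, and images of letters in a
   same row have the same height. *)
Definition config_image (om : morphism2) (x y : config) :=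
  exists X Y : int -> int, [/\ X 0 = 0, Y 0 = 0 &
    forall i j, let u := image_of_letter om (x (i, j)) in
      [/\ (x (i, j) < size om)%N,
          X (i + 1) = X i + (width u)%:Z,
          Y (j + 1) = Y j + (height u)%:Z &
          forall p q : nat, (p < width u)%N -> (q < height u)%N ->
            y (X i + p%:Z, Y j + q%:Z) = wletter u p q]].

Definition morphism_image (om : morphism2) (X : set config) : set config :=
  [set y | exists2 x, X x & config_image om x y].

(* theta_M (w) (n) = w (M^-1 n) for M = (1 1; 0 1) *)
Definition theta (w : config) : config := fun n => w (n.1 - n.2, n.2).

Section Torus.
Variable R : realType.

Definition lattice := ((R * R) * (R * R))%type.

Definition lattice_eq (G : lattice) : rel (R * R) :=
  fun x y => `[< exists m n : int, y - x = G.1 *~ m + G.2 *~ n >].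

Lemma lattice_eq_equiv (G : lattice) : equiv_class_of (lattice_eq G).
Proof.
split=> [x|x y|y x z].
- by apply/asboolP; exists 0, 0; rewrite subrr !mulr0z addr0.
- by apply/asboolP/asboolP=> -[m [n e]]; exists (- m), (- n);
    rewrite !mulrNz -opprD -e opprB.
- move=> /asboolP[m [n e]] /asboolP[p [q e']]; apply/asboolP.
  exists (m + p), (n + q); rewrite !mulrzDr addrACA -e -e'.
  by rewrite addrC addrA subrK.
Qed.

Canonical lattice_equiv (G : lattice) := EquivRelPack (lattice_eq_equiv G).

Definition torus (G : lattice) : topologicalType :=
  quotient_topology {eq_quot lattice_equiv G}.

Definition tproj (G : lattice) : R * R -> torus G :=
  \pi_(quotient_topology {eq_quot lattice_equiv G})%qT.

Definition trepr (G : lattice) (x : torus G) : R * R :=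
  repr (x : quotient_topology {eq_quot lattice_equiv G}).

Definition rectangular (a b : R) : lattice := ((a, 0), (0, b)).

(* R^n (x) = x + n_1 v_1 + n_2 v_2 *)
Definition rotation (G : lattice) (v1 v2 : R * R) (n : int * int)
    (x : torus G) : torus G :=
  tproj G (trepr x + v1 *~ n.1 + v2 *~ n.2).

Definition rectangle (a b : R) : set (R * R) :=
  [set x | 0 < x.1 < a /\ 0 < x.2 < b].

Definition segment (a b : R * R) : set (R * R) :=
  [set (1 - t) *: a + t *: b | t in `[0, 1]].

Definition polygon_boundary (V : seq (R * R)) : set (R * R) :=
  \bigcup_(i in `I_(size V))
    segment (nth 0 V i) (nth 0 V (i.+1 %% size V)).

(* The interior of a simple polygon with list of vertices V, in the sense of
   the Jordan curve theorem: the points whose connected component in the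
   complement of the boundary is bounded. *)
Definition polygon_interior (V : seq (R * R)) : set (R * R) :=
  [set x | ~ polygon_boundary V x /\
    bounded_set (connected_component (~` polygon_boundary V) x)].

(* The atom of index a is the image of the union of the interiors of the
   polygons in the a-th list; it is empty beyond the last index. *)
Definition polygon_partition (G : lattice) (V : seq (seq (seq (R * R))))
    (a : nat) : set (torus G) :=
  tproj G @` \bigcup_(v in [set` nth [::] V a]) polygon_interior v.

End Torus.

Arguments tproj {R} G x.
Arguments rotation {R} G v1 v2 n x.
Arguments polygon_partition {R} G V a.

Definition boundary (T : topologicalType) (A : set T) : set T :=
  closure A `\` A°.

Definition allowed (T : Type) (P : nat -> set T)
    (Rt : int * int -> T -> T) (S : set (int * int)) (w : int * int -> nat) :=
  (\bigcap_(k in S) (Rt k @^-1` P (w k))) !=set0.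

Definition symbolic_shift (T : Type) (P : nat -> set T)
    (Rt : int * int -> T -> T) : set config :=
  [set x | forall n (S : set (int * int)), finite_set S ->
    allowed P Rt S (sigma n x)].

Section Induction.
Variables (T : topologicalType) (P : nat -> set T) (Rt : int * int -> T -> T).
Variables (W : set T) (e : int * int).

(* w (x) is defined and is equal to w; its length is the first return time *)
Definition return_word (x : T) (w : seq nat) :=
  [/\ (0 < size w)%N, W (Rt (e *+ size w) x),
      forall k, (0 < k < size w)%N -> ~ W (Rt (e *+ k) x) &
      forall k, (k < size w)%N ->
        (forall a, ~ boundary (P a) (Rt (e *+ k) x)) /\
        P (nth 0%N w k) (Rt (e *+ k) x)].

Definition cylinder (w : seq nat) : set T :=
  [set x | W x /\ return_word x w].

Definition occurs (w : seq nat) := (cylinder w)° !=set0.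

Definition radix_lt (u v : seq nat) : bool :=
  (size u < size v)%N || (size u == size v) && (u < v :> seqlexi nat)%O.

(* w is w_b exactly when b words precede it in the list *)
Definition is_nth_word (b : nat) (w : seq nat) :=
  occurs w /\ ([set w' | occurs w' /\ radix_lt w' w] #= `I_b)%card.

Definition induced (b : nat) : set T :=
  [set x | exists2 w, is_nth_word b w & (cylinder w)° x].

End Induction.

(* Ind (P, Rt, D) for an open set D of the plane identified both with an open
   set of the torus of G and, up to boundary, with the torus of G' *)
Definition induced_on (R : realType) (G G' : lattice R)
    (P : nat -> set (torus G)) (Rt : int * int -> torus G -> torus G)
    (D : set (R * R)) (e : int * int) (b : nat) : set (torus G') :=
  tproj G' @` (D `&` tproj G @^-1` induced P Rt (tproj G @` D) e b).

Arguments induced_on {R G} G' P Rt D e b.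

Definition golden (R : realType) : R := (1 + Num.sqrt 5) / 2.

Definition polygons0 (R : realType) : seq (seq (seq (R * R))) :=
  let f : R := golden R in
  let s := f^-1 in let t := f ^- 2 in
  [::
    [:: [:: (0, 0); (s, 0); (s, 1)];
        [:: (s, 0); (1, 0); (1, 1)];
        [:: (1, 0); (f, 0); (f, 1)]];
    [:: [:: (0, 0); (s, 1); (0, 1)];
        [:: (s, 0); (1, 1); (s, 1)];
        [:: (1, 0); (f, 1); (1, 1)]];
    [:: [:: (0, 2); (s, f + 2); (0, f + 1)]];
    [:: [:: (1, 1); (f, 2); (f, f + 2); (1, 2)]];
    [:: [:: (0, 2); (1, f + 2); (1, f + 3)]];
    [:: [:: (0, f + 1); (s, f + 2); (1, f + 3); (t, f + 2); (t, f + 3);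
           (0, f + 2)]];
    [:: [:: (0, f + 2); (t, f + 3); (0, f + 3)];
        [:: (t, f + 2); (1, f + 3); (t, f + 3)];
        [:: (1, f + 2); (f, f + 3); (1, f + 3)]];
    [:: [:: (0, 1); (1, f + 2); (0, 2)];
        [:: (1, f + 1); (f, f + 2); (f, f + 3); (1, f + 2)]];
    [:: [:: (s, 1); (f, f + 2); (s, 2)]];
    [:: [:: (0, 1); (s, 1); (s, 2)];
        [:: (s, 1); (1, 1); (1, 2)];
        [:: (1, 1); (f, 1); (f, 2)]];
    [:: [:: (0, 1); (1, f + 1); (1, f + 2)]]].

Definition polygonsU (R : realType) : seq (seq (seq (R * R))) :=
  let f : R := golden R in
  let s := f^-1 in let t := f ^- 2 in let u := f ^- 3 in
  [::
    [:: [:: (s, s); (2 * t, s); (s, 2 * t)]];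
    [:: [:: (2 * t, s); (1, s); (1, 1); (s, 1); (s, 2 * t)]];
    [:: [:: (u, s); (t, s); (0, 1)]];
    [:: [:: (0, s); (u, s); (0, 1)]];
    [:: [:: (s, s); (s, 2 * t); (t, 1)]];
    [:: [:: (s, 2 * t); (s, 1); (t, 1)]];
    [:: [:: (t, s); (t, 1); (0, 1)]];
    [:: [:: (t, s); (s, s); (t, 1)]];
    [:: [:: (s, 0); (1, 0); (s, t)]];
    [:: [:: (1, 0); (1, t); (2 * t, s); (s, s)]];
    [:: [:: (1, t); (1, s); (2 * t, s)]];
    [:: [:: (s, t); (1, 0); (s, s)]];
    [:: [:: (t, t); (t, s); (u, s)]];
    [:: [:: (s, 0); (s, t); (t, s); (t, t)]];
    [:: [:: (t, 0); (t, t); (u, s); (0, s)]];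
    [:: [:: (t, 0); (s, 0); (t, t)]];
    [:: [:: (0, 0); (t, 0); (0, t)]];
    [:: [:: (t, 0); (0, s); (0, t)]];
    [:: [:: (s, t); (s, s); (t, s)]]].

Section Systems.
Variable R : realType.
Local Notation f := (golden R).
Local Notation s := (f^-1).
Local Notation t := (f ^- 2).
Local Notation u := (f ^- 3).

Definition Gamma0 : lattice R := ((f, 0), (1, f + 3)).
Definition GammaU : lattice R := rectangular 1 1.
Definition Gamma1 : lattice R := rectangular f 1.
Definition Gamma4 : lattice R := rectangular s 1.
Definition Gamma5 : lattice R := rectangular s s.

Definition PU := polygon_partition GammaU (polygonsU R).
Definition RU := rotation GammaU (t, 0) (0, t).

Definition P0 := polygon_partition Gamma0 (polygons0 R).
Definition R0 := rotation Gamma0 (1, 0) (0, 1).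

Definition P1 := induced_on Gamma1 P0 R0 (rectangle f 1) e2.
Definition R1 := rotation Gamma1 (1, 0) (s, t).

Definition P2 := P1.
Definition R2 := rotation Gamma1 (1, 0) (0, t).

Definition P3 := induced_on GammaU P2 R2 (rectangle 1 1) e1.
Definition R3 := rotation GammaU (t, 0) (0, t).

Definition P4 := induced_on Gamma4 P3 R3 (rectangle s 1) e1.
Definition R4 := rotation Gamma4 (- u, 0) (0, t).

Definition P5 := induced_on Gamma5 P4 R4 (rectangle s s) e2.
Definition R5 := rotation Gamma5 (- u, 0) (0, - u).

Definition rescale (x : torus Gamma5) : torus GammaU :=
  tproj GammaU (- f *: trepr x).

Definition P6 :=
  induced_on Gamma4 (fun a => rescale @` P5 a) R3 (rectangle s 1) e1.
Definition R6 := R4.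

Definition P7 := induced_on Gamma5 P6 R6 (rectangle s s) e2.
Definition R7 := R5.

Definition P8 :=
  induced_on Gamma4 (fun a => rescale @` P7 a) R3 (rectangle s 1) e1.
Definition R8 := R4.

End Systems.

Arguments PU R a : clear implicits.
Arguments RU R n x : clear implicits.
Arguments P0 R a : clear implicits.
Arguments R0 R n x : clear implicits.
Arguments P1 R b : clear implicits.
Arguments R1 R n x : clear implicits.
Arguments P2 R b : clear implicits.
Arguments R2 R n x : clear implicits.
Arguments P3 R b : clear implicits.
Arguments R3 R n x : clear implicits.
Arguments P4 R b : clear implicits.
Arguments R4 R n x : clear implicits.
Arguments P5 R b : clear implicits.
Arguments R5 R n x : clear implicits.
Arguments P6 R b : clear implicits.
Arguments R6 R n x : clear implicits.
Arguments P7 R b : clear implicits.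
Arguments R7 R n x : clear implicits.
Arguments P8 R b : clear implicits.
Arguments R8 R n x : clear implicits.

(* colors in the order right, top, left, bottom *)
Definition tilesU : seq string := [::
    "FOJO"; "FOHL"; "JMFP"; "DMFK"; "HPJP"; "HPHN"; "HKFP"; "HKDP";
    "BOIO"; "GLEO"; "GLCL"; "ALIO"; "EPGP"; "EPIP"; "IPGK"; "IPIK";
    "IKBM"; "IKAK"; "CNIP"]%string.

Definition color (k a : nat) : option ascii :=
  String.get k (nth EmptyString tilesU a).
Definition right_color := color 0.
Definition top_color := color 1.
Definition left_color := color 2.
Definition bottom_color := color 3.

Definition OmegaU : set config :=
  [set w | forall n, [/\ (w n < 19)%N,
    right_color (w n) = left_color (w (n + e1)) &
    top_color (w n) = bottom_color (w (n + e2))]].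

Definition omega0123 : morphism2 :=
  [::
    vword [:: 0; 9; 3; 7]; vword [:: 0; 9; 7; 5];
    vword [:: 0; 9; 10; 4]; vword [:: 1; 3; 3; 7];
    vword [:: 1; 3; 7; 6]; vword [:: 1; 3; 8; 7];
    vword [:: 1; 7; 2; 5]; vword [:: 1; 7; 5; 5];
    vword [:: 1; 7; 5; 6]; vword [:: 1; 8; 7; 5];
    vword [:: 1; 8; 10; 4]; vword [:: 1; 10; 4; 5];
    vword [:: 1; 10; 4; 6]; vword [:: 0; 9; 3; 3; 7];
    vword [:: 0; 9; 3; 7; 6]; vword [:: 0; 9; 3; 8; 7];
    vword [:: 0; 9; 7; 2; 5]; vword [:: 0; 9; 7; 2; 6];
    vword [:: 0; 9; 7; 5; 5]; vword [:: 0; 9; 7; 5; 6];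
    vword [:: 0; 9; 8; 7; 5]; vword [:: 0; 9; 8; 10; 4];
    vword [:: 0; 9; 10; 4; 6]; vword [:: 1; 3; 3; 7; 6];
    vword [:: 1; 3; 8; 7; 6]; vword [:: 1; 7; 2; 5; 6];
    vword [:: 1; 8; 10; 4; 6]; vword [:: 1; 10; 4; 5; 6]].

Definition kappa : morphism2 :=
  [::
    letter 2; letter 9; letter 10; letter 20; letter 21; letter 22;
    letter 26; hword [:: 1; 0]; hword [:: 6; 5]; hword [:: 7; 4]; hword [:: 8; 4];
    hword [:: 11; 3]; hword [:: 12; 3]; hword [:: 16; 15]; hword [:: 17; 15];
    hword [:: 18; 14]; hword [:: 19; 14]; hword [:: 22; 13]; hword [:: 25; 24];
    hword [:: 27; 23]].

Definition omega7 : morphism2 :=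
  [::
    letter 8; letter 9; letter 10; letter 15; letter 16; letter 18;
    letter 19; hword [:: 7; 0]; hword [:: 7; 2]; hword [:: 8; 1];
    hword [:: 11; 2]; hword [:: 12; 2]; hword [:: 13; 3]; hword [:: 14; 3];
    hword [:: 15; 5]; hword [:: 15; 6]; hword [:: 16; 5]; hword [:: 16; 6];
    hword [:: 17; 4]; hword [:: 19; 6]].

Definition omega8 : morphism2 :=
  [::
    letter 3; letter 4; letter 5; letter 6; letter 12; letter 13;
    letter 14; letter 15; letter 18; vword [:: 4; 0]; vword [:: 5; 0];
    vword [:: 5; 1]; vword [:: 5; 2]; vword [:: 6; 0];
    vword [:: 13; 8]; vword [:: 14; 10]; vword [:: 15; 10];
    vword [:: 16; 11]; vword [:: 17; 9]; vword [:: 17; 11];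
    vword [:: 18; 7]; vword [:: 19; 9]].

Definition omega9 : morphism2 :=
  [::
    letter 8; letter 14; letter 17; letter 20; hword [:: 4; 1];
    hword [:: 5; 1]; hword [:: 6; 3]; hword [:: 7; 2]; hword [:: 8; 0];
    hword [:: 14; 9]; hword [:: 15; 13]; hword [:: 16; 10]; hword [:: 16; 11];
    hword [:: 17; 13]; hword [:: 18; 12]; hword [:: 19; 10]; hword [:: 19; 11];
    hword [:: 21; 12]].

Definition omega10 : morphism2 :=
  [::
    letter 1; letter 2; letter 3; letter 12; letter 13; letter 14;
    letter 15; letter 16; letter 17; vword [:: 1; 0]; vword [:: 2; 0];
    vword [:: 3; 0]; vword [:: 9; 8]; vword [:: 10; 4];
    vword [:: 11; 4]; vword [:: 12; 6]; vword [:: 13; 5];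
    vword [:: 13; 8]; vword [:: 14; 7]; vword [:: 15; 5];
    vword [:: 17; 7]].

Definition omega11 : morphism2 :=
  [::
    letter 5; letter 8; letter 14; letter 15; letter 18; letter 20;
    hword [:: 3; 1]; hword [:: 4; 2]; hword [:: 5; 1]; hword [:: 6; 0];
    hword [:: 7; 1]; hword [:: 8; 1]; hword [:: 12; 11]; hword [:: 13; 11];
    hword [:: 14; 9]; hword [:: 15; 10]; hword [:: 16; 11]; hword [:: 17; 11];
    hword [:: 19; 9]].

Definition rho (a : nat) : nat := nth 0 [::
    0; 1; 9; 7; 8; 11; 10; 6; 2; 4; 5; 3; 18; 14; 16; 13; 12; 17; 15] a.

Definition omegaU : morphism2 :=
  [::
    letter 17; letter 16; hword [:: 15; 11]; hword [:: 13; 9]; hword [:: 17; 8];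
    hword [:: 16; 8]; hword [:: 15; 8]; hword [:: 14; 8]; vword [:: 14; 6];
    vword [:: 17; 3]; vword [:: 16; 3]; vword [:: 14; 2];
    block 7 1 15 11; block 6 1 14 11; block 7 1 13 9; block 6 1 12 9;
    block 5 1 18 10; block 4 1 13 9; block 2 0 14 8].

Definition relabel (h : nat -> nat) (w : config) : config := fun n => h (w n).
Definition Omega12 : set config := relabel rho @` OmegaU.
Definition Omega11 := orbit_closure (morphism_image omega11 Omega12).
Definition Omega10 := orbit_closure (morphism_image omega10 Omega11).
Definition Omega9 := orbit_closure (morphism_image omega9 Omega10).
Definition Omega8 := orbit_closure (morphism_image omega8 Omega9).
Definition Omega7 := orbit_closure (morphism_image omega7 Omega8).
(* the subshift denoted jmath (Omega_5) *)
Definition jOmega5 := theta @` orbit_closure (morphism_image kappa Omega7).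
Definition X0 := orbit_closure (morphism_image omega0123 jOmega5).

(* Main.v *)
(* Call a point of the plane generic when it lies on no line with coefficients in Z[golden].
   A system of polygons codes the orbit of a generic point under a rotation, and its symbolic
   shift is the closure of these codings. If the words read by an induction on a window W are
   the images of the letters under a morphism, and if the first letter of these words occurs
   nowhere else in them, then the passages in W can be read off a coding; hence the shift of
   the initial system is the orbit closure of the image of the shift of the induced one.
   The codes are built upwards, from the tiles of P_U and their mirror image: the code of
   level i is read along the towers prescribed by the morphism over the code of level i + 1.
   Triangulating P_U and following the triangles up to level 0 shows by an exact computation
   in Z[golden] that the code obtained there is the one given by P_0, and then each induced
   partition has to be the prescribed one.
   For the Wang shift, the tiles leave only 50 possible squares of size 2, so that every
   configuration is the image under omega_U of another one. As omega_U^7 (12) contains these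
   50 squares and 12 occurs in all the omega_U^7 (a), every pattern of a configuration occurs
   in all the others. Hence Omega_U is minimal, is the substitutive shift, and is equal to the
   shift of the codings by P_U, which it contains as matching tiles only are adjacent.
   A period would give a period of the passages of an irrational rotation in an interval. *)

From Stdlib Require Import ZArith.
From HB Require Import structures.
From mathcomp Require Import all_boot all_order all_algebra ssrZ zify ring lra.
From mathcomp Require Import all_classical all_reals all_analysis.
Require Import Defs.
Import numFieldNormedType.Exports.

Set Implicit Arguments.
Unset Strict Implicit.
Unset Printing Implicit Defensive.

Import Order.TTheory GRing.Theory Num.Theory.
Local Open Scope classical_set_scope.
Local Open Scope ring_scope.
Local Open Scope quotient_scope.

(** * The ring Z[golden] and generic points *)

(** Generic points are dense and avoid every boundary met here, because vertices, translations and
    windows all have coordinates in Z[golden]; hence open sets can be compared at generic points,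
    and a code need only be right there. Working upwards is what makes the geometry computable:
    inducing a polygon partition means intersecting polygons, whereas going up only translates known
    triangles, and what remains is to check inclusions of triangles in polygons, that is signs of
    orientations. The inductions repeat because [s + t = 1], [t + u = s] and [golden * u = t]: the
    rotation by [t] of a circle of length 1 induces, on an interval of length [s], the rotation by
    [- u] of a circle of length [s], and multiplication by [- golden] turns it back into the
    rotation by [t]. The index of an induced atom is a rank in a list of words; so each word of the
    morphism must occur on an open set, and the morphism must list them in radix order. Interiors of
    polygons are defined topologically, and have to be converted into linear inequalities. *)

Section Golden.
Variable R : realType.
Local Notation f := (golden R).

Lemma golden_sqr : f * f = f + 1.
Proof.
have h : Num.sqrt 5 * Num.sqrt 5 = 5 :> R by rewrite -expr2 sqr_sqrtr.
by rewrite /golden; field: h.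
Qed.

Lemma golden_bounds : 8 / 5 < f < 17 / 10.
Proof.
have h : Num.sqrt 5 * Num.sqrt 5 = 5 :> R by rewrite -expr2 sqr_sqrtr.
have h0 : 0 <= Num.sqrt 5 :> R by apply: sqrtr_ge0.
by rewrite /golden; apply/andP; split; nra.
Qed.

Lemma golden_neq0 : f != 0.
Proof. by have := golden_bounds; lra. Qed.

Lemma golden_inv : f^-1 = f - 1.
Proof.
apply: (mulfI golden_neq0); rewrite mulfV ?golden_neq0 // mulrBr golden_sqr.
by ring.
Qed.

Lemma golden_inv2 : f ^- 2 = 2 - f.
Proof.
by rewrite -exprVn golden_inv expr2; have := golden_sqr; lra.
Qed.

Lemma golden_inv3 : f ^- 3 = 2 * f - 3.
Proof.
rewrite -exprVn exprS exprVn golden_inv golden_inv2.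
by have := golden_sqr; lra.
Qed.

(** Infinite descent: modulo 2 the form m^2 + m n - n^2 vanishes only when both integers are even,
    and then both can be halved. *)
Lemma int_norm_eq0 (m n : int) : m * m + m * n - n * n = 0 -> m = 0 /\ n = 0.
Proof.
have [k] := ubnP (`|m| + `|n|)%N; elim: k m n => // k IH m n hk e.
have [a [b [em en]]] : exists a b, m = 2 * a /\ n = 2 * b.
  exists (m %/ 2)%Z, (n %/ 2)%Z; have := divz_eq m 2; have := divz_eq n 2.
  have := modz_ge0 m (isT : 2 != 0 :> int).
  have := modz_ge0 n (isT : 2 != 0 :> int).
  have := ltz_pmod m (isT : 0 < 2 :> int).
  have := ltz_pmod n (isT : 0 < 2 :> int).
  move: (m %/ 2)%Z (m %% 2)%Z (n %/ 2)%Z (n %% 2)%Z => a r b r' h1 h2 h3 h4 eb ea.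
  have [r0|r1] : r = 0 \/ r = 1 by lia.
  - have [r0'|r1'] : r' = 0 \/ r' = 1 by lia.
    + by split; lia.
    + by move: e; rewrite ea eb r0 r1'; nia.
  - have [r0'|r1'] : r' = 0 \/ r' = 1 by lia.
    + by move: e; rewrite ea eb r1 r0'; nia.
    + by move: e; rewrite ea eb r1 r1'; nia.
have [/andP[/eqP-> /eqP->] //|n0] := boolP ((m == 0) && (n == 0)).
have : a = 0 /\ b = 0 by apply: IH; [lia|nia].
by case=> a0 b0; split; lia.
Qed.

(** Multiplying by the conjugate [m + n (1 - golden)] gives the integer norm, a form without
    nontrivial zero. *)
Lemma golden_free (m n : int) : m%:~R + n%:~R * f = 0 -> m = 0 /\ n = 0.
Proof.
move=> e; apply: int_norm_eq0; apply/eqP; rewrite -(intr_eq0 R); apply/eqP.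
rewrite rmorphB rmorphD !rmorphM /=.
rewrite (_ : _ - _ = (m%:~R + n%:~R * f) * (m%:~R + n%:~R * (1 - f))).
  by rewrite e mul0r.
by have := golden_sqr; move: (m%:~R) (n%:~R : R) => x y h; ring: h.
Qed.

(** The ring Z[golden] is enough: the inverse of [golden] also lies in it. *)
Definition inK (r : R) := exists m n : int, r = m%:~R + n%:~R * f.

Lemma inK_int (m : int) : inK m%:~R.
Proof. by exists m, 0; rewrite mul0r addr0. Qed.

Lemma inK_nat (m : nat) : inK m%:R.
Proof. by exists m%:Z, 0; rewrite mul0r addr0. Qed.

Lemma inKg : inK f.
Proof. by exists 0, 1; rewrite mul1r add0r. Qed.

Lemma inKD x y : inK x -> inK y -> inK (x + y).
Proof.
by case=> m [n ->] [m' [n' ->]]; exists (m + m'), (n + n'); rewrite !rmorphD /=; ring.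
Qed.

Lemma inKN x : inK x -> inK (- x).
Proof. by case=> m [n ->]; exists (- m), (- n); rewrite !rmorphN /=; ring. Qed.

Lemma inKB x y : inK x -> inK y -> inK (x - y).
Proof. by move=> hx hy; apply: inKD => //; apply: inKN. Qed.

Lemma inKM x y : inK x -> inK y -> inK (x * y).
Proof.
case=> m [n ->] [m' [n' ->]].
exists (m * m' + n * n'), (m * n' + n * m' + n * n').
by rewrite !(rmorphD, rmorphM) /=; have h := golden_sqr; ring: h.
Qed.

Lemma inKi x (m : int) : inK x -> inK (x *~ m).
Proof. by move=> h; rewrite -mulrzr; apply: inKM => //; apply: inK_int. Qed.

Lemma inK1 : inK 1. Proof. exact: (inK_nat 1). Qed.
Lemma inK0 : inK 0. Proof. exact: (inK_nat 0). Qed.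

Definition generic (p : R * R) := forall A B C, inK A -> inK B -> inK C ->
  A * p.1 + B * p.2 + C = 0 -> A = 0 /\ B = 0.

Definition inK2 (v : R * R) := inK v.1 /\ inK v.2.

Lemma genericD p v : generic p -> inK2 v -> generic (p + v).
Proof.
move=> gp [v1 v2] A B C kA kB kC e; apply: (gp A B (A * v.1 + B * v.2 + C)) => //.
  by apply: inKD => //; apply: inKD; apply: inKM.
by move: e; rewrite /=; move=> <-; ring.
Qed.

Lemma genericM p a b : generic p -> inK a -> inK b -> a != 0 -> b != 0 ->
  generic (a * p.1, b * p.2).
Proof.
move=> gp ka kb a0 b0 A B C kA kB kC /= e.
have [] := gp (A * a) (B * b) C; rewrite -?mulrA //; try exact: inKM.
by move=> /eqP + /eqP; rewrite !mulf_eq0 (negPf a0) (negPf b0) !orbF => /eqP-> /eqP->.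
Qed.

Lemma inK2D v w : inK2 v -> inK2 w -> inK2 (v + w).
Proof. by move=> [a b] [c d]; split; apply: inKD. Qed.

Lemma mulrz_pair (v : R * R) (m : int) : v *~ m = (v.1 *~ m, v.2 *~ m).
Proof.
by rewrite [LHS]surjective_pairing !raddfMz.
Qed.

Lemma inK2i v (m : int) : inK2 v -> inK2 (v *~ m).
Proof. by move=> [a b]; rewrite mulrz_pair; split; apply: inKi. Qed.

Lemma inK2N v : inK2 v -> inK2 (- v).
Proof. by move=> [a b]; split; apply: inKN. Qed.

Lemma countable_inK : countable [set x | inK x].
Proof.
have -> : [set x | inK x] =
    range (fun mn : int * int => mn.1%:~R + mn.2%:~R * f).
  by apply/seteqP; split=> [x [m [n ->]]|x [[m n] _ <-]]; [exists (m, n)|exists m, n].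
exact: sub_countable (card_image_le _ _) (countableP _).
Qed.

(** A countable set is Lebesgue negligible and an open interval is not. *)
Lemma exists_notin_countable (A : set R) (a e : R) : countable A -> 0 < e ->
  exists2 x, a - e < x < a + e & ~ A x.
Proof.
move=> cA e0; apply/not_exists2P => /= h.
have sub : `]a - e, a + e[%classic `<=` A.
  by move=> x; rewrite /= in_itv /= => hx; case: (h x) => // /contrapT.
have : lebesgue_measure (`]a - e, a + e[%classic : set R) = 0%E.
  by apply: countable_lebesgue_measure0; apply: sub_countable cA; apply: subset_card_le.
rewrite lebesgue_measure_itv /= lte_fin ifT; last by lra.
by rewrite -EFinB => /eqP; rewrite eqe; lra.
Qed.

(** The abscissa is chosen off the countably many quotients -C/A; once it is fixed, the ordinate is
    chosen off the countably many values -(A x + C)/B. *)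
Lemma exists_generic (O : set (R * R)) : open O -> O !=set0 ->
  exists2 p, generic p & O p.
Proof.
move=> oO [[a b] Oab].
have /nbhs_ballP[e /= e0 he] := open_nbhs_nbhs (conj oO Oab).
pose K := [set x : R | inK x].
pose S1 := (fun t : R * R => - t.2 / t.1) @` (K `*` K).
have cK2 : countable (K `*` K) by apply: countableX; apply: countable_inK.
have [x hx nx] : exists2 x, a - e < x < a + e & ~ S1 x.
  apply: exists_notin_countable => //.
  exact: sub_countable (card_image_le _ _) cK2.
pose S2 := (fun t : R * (R * R) => - (t.1 * x + t.2.2) / t.2.1) @` (K `*` (K `*` K)).
have [y hy ny] : exists2 y, b - e < y < b + e & ~ S2 y.
  apply: exists_notin_countable => //.
  apply: sub_countable (card_image_le _ _) _.
  by apply: countableX => //; apply: countable_inK.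
exists (x, y); last first.
  apply: he; split => /=; rewrite /ball /= ltr_norml; lra.
move=> A B C kA kB kC /= E.
have B0 : B = 0.
  apply/eqP; apply: contra_notT ny => B0; exists (A, (B, C)) => //=.
  by apply: (mulIf B0); rewrite mulfVK //; lra.
split=> //; apply/eqP; apply: contra_notT nx => A0; exists (A, C) => //=.
by apply: (mulIf A0); rewrite mulfVK //; move: E; rewrite B0; lra.
Qed.

End Golden.

(** * Codings of generic orbits *)

(** Squares centred at the origin give bases of neighbourhoods; the next lemmas let closed sets of
    configurations be handled without the product topology. *)
Definition agree (N : nat) (x y : config) := forall i j : int,
  (absz i <= N)%N -> (absz j <= N)%N -> x (i, j) = y (i, j).

Lemma closed_agree (X : set config) (x : config) : closed X ->
  (forall N, exists2 y, X y & agree N x y) -> X x.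
Proof.
move=> cX h; pose y N : config := s2val (cid2 (h N)).
have Xy N : X (y N) := s2valP (cid2 (h N)).
have xy N : agree N x (y N) := s2valP' (cid2 (h N)).
have yx : y @ \oo --> x; last first.
  by apply: (@closed_cvg _ _ _ eventually_filter y X cX _ x yx); exact: nearW.
apply/cvg_sup => -[i j] U [V] [[W] oW <-] WxU VU.
apply: (filterS VU); rewrite nbhs_simpl /=; exists (absz i + absz j)%N => // n /= hn.
by rewrite -xy //; lia.
Qed.

Definition int_box (N : nat) : seq (int * int) :=
  let r := [seq (k%:Z - N%:Z) | k <- iota 0 (N + N).+1] in
  [seq (i, j) | i <- r, j <- r].

Lemma mem_int_box (N : nat) (i j : int) :
  ((i, j) \in int_box N) = (absz i <= N)%N && (absz j <= N)%N.
Proof.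
have hr (k : int) :
    (k \in [seq (k%:Z - N%:Z) | k <- iota 0 (N + N).+1]) = (absz k <= N)%N.
  apply/mapP/idP => [[m]|hk]; first by rewrite mem_iota => hm ->; lia.
  by exists (absz (k + N%:Z)); [rewrite mem_iota|]; lia.
apply/allpairsP/andP => [[[a b] /= []]|[hi hj]]; first by rewrite !hr => + + [-> ->].
by exists (i, j); rewrite !hr.
Qed.

Lemma nbhs_agree (N : nat) (x : config) : nbhs x [set y | agree N x y].
Proof.
have H (s : seq (int * int)) : nbhs x [set y : config | forall k, k \in s -> x k = y k].
  elim: s => [|k s IH]; first by apply: filterS filterT => y _ k; rewrite in_nil.
  have hk : nbhs x (proj k @^-1` [set x k]).
    apply: open_nbhs_nbhs; split=> //; apply: open_comp; last exact: discrete_open.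
    by move=> ? _; exact: proj_continuous.
  apply: filterS (filterI hk IH) => y [/= h1 h2] k'.
  by rewrite inE => /predU1P[->|]; [rewrite -h1|exact: h2].
apply: filterS (H (int_box N)) => y h i j hi hj.
by apply: h; rewrite mem_int_box hi.
Qed.

Lemma agree_closed (X : set config) :
  (forall x, (forall N, exists2 y, X y & agree N x y) -> X x) -> closed X.
Proof.
move=> h x cx; apply: h => N.
by have [y [Xy xy]] := cx _ (nbhs_agree N x); exists y.
Qed.

Lemma open_forall_lt (S : topologicalType) (n : nat) (Q : nat -> set S) :
  (forall k, open (Q k)) -> open [set x | forall k, (k < n)%N -> Q k x].
Proof.
move=> oQ; elim: n => [|n IH].
  by rewrite (_ : [set _ | _] = setT); [exact: openT|apply/seteqP; split].
rewrite (_ : [set _ | _] = Q n `&` [set x | forall k, (k < n)%N -> Q k x]).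
  exact: openI.
apply/seteqP; split=> x /=.
  by move=> h; split=> [|k hk]; apply: h => //; apply: ltnW.
by move=> [h1 h2] k; rewrite ltnS leq_eqVlt => /predU1P[->|]; last exact: h2.
Qed.

Section Torus.
Variable R : realType.
Implicit Types (G : lattice R) (p q v : R * R).

Definition congr_mod G p q := exists m n : int, q - p = G.1 *~ m + G.2 *~ n.

Lemma tproj_eq G p q : tproj G p = tproj G q <-> congr_mod G p q.
Proof.
have /= h := @eqquotP _ (lattice_equiv G) (quotient_topology {eq_quot lattice_equiv G}) p q.
by split=> [/h/asboolP|k]; last by apply/h/asboolP.
Qed.

Lemma treprK G (x : torus G) : tproj G (trepr x) = x.
Proof. exact: reprK. Qed.

Lemma congr_mod_refl G p : congr_mod G p p.
Proof. by apply/tproj_eq. Qed.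

Lemma congr_mod_sym G p q : congr_mod G p q -> congr_mod G q p.
Proof. by move=> /tproj_eq h; apply/tproj_eq. Qed.

Lemma congr_mod_trans G q p r : congr_mod G p q -> congr_mod G q r -> congr_mod G p r.
Proof. by move=> /tproj_eq h /tproj_eq h'; apply/tproj_eq; rewrite h. Qed.

Lemma congr_modD G p q v : congr_mod G p q -> congr_mod G (p + v) (q + v).
Proof. by move=> [m [n e]]; exists m, n; rewrite -e opprD addrACA subrr addr0. Qed.

Lemma tproj_continuous G : continuous (tproj G : R * R -> torus G).
Proof. exact: pi_continuous. Qed.

Lemma open_shift (A : set (R * R)) v : open A -> open [set p | A (p + v)].
Proof.
move=> oA; apply: (@open_comp _ _ (fun p => p + v) A) => // p _.
by apply: cvgD; [exact: cvg_id|exact: cvg_cst].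
Qed.

(** The saturation of an open set is the union of its translates by the lattice. *)
Lemma tproj_open G (A : set (R * R)) : open A -> open (tproj G @` A).
Proof.
move=> oA; rewrite /open /= /quotient_open.
have -> : \pi_(quotient_topology {eq_quot lattice_equiv G})%qT @^-1` (tproj G @` A) =
    \bigcup_(mn in [set: int * int]) [set p | A (p + (G.1 *~ mn.1 + G.2 *~ mn.2))].
  apply/seteqP; split=> [p [q Aq /esym/tproj_eq[m [n e]]]|p [[m n] _ /= h]].
    by exists (m, n) => //=; rewrite -e addrC subrK.
  by exists (p + (G.1 *~ m + G.2 *~ n)) => //; apply/esym/tproj_eq; exists m, n; rewrite addrC addKr.
by apply: bigcup_open => i _; apply: open_shift.
Qed.

Lemma open_preimage_tproj G (A : set (torus G)) : open A -> open (tproj G @^-1` A).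
Proof. by move=> oA; apply: open_comp => // p _; apply: tproj_continuous. Qed.

Lemma rotationE G v1 v2 (n : int * int) p :
  rotation G v1 v2 n (tproj G p) = tproj G (p + v1 *~ n.1 + v2 *~ n.2).
Proof.
apply/tproj_eq; apply: congr_modD; apply: congr_modD.
by apply/tproj_eq; rewrite treprK.
Qed.

(** The closure of the codings of generic orbits. Boxes centred at the origin suffice, because a
    translated box is read from a translated point, again generic. *)
Definition coded_shift (c : R * R -> nat) v1 v2 : set config :=
  [set x | forall N : nat, exists2 p, generic p & forall i j : int,
     (absz i <= N)%N -> (absz j <= N)%N -> c (p + v1 *~ i + v2 *~ j) = x (i, j)].

Lemma coded_shift_sigma c v1 v2 x n : inK2 v1 -> inK2 v2 ->
  coded_shift c v1 v2 x -> coded_shift c v1 v2 (sigma n x).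
Proof.
move=> k1 k2 h N; have [p gp hp] := h (N + absz n.1 + absz n.2)%N.
exists (p + v1 *~ n.1 + v2 *~ n.2).
  by apply: genericD; [apply: genericD|]; [|exact: inK2i|exact: inK2i].
move=> i j hi hj; have -> : sigma n x (i, j) = x (i + n.1, j + n.2) by [].
rewrite -hp; [|lia|lia]; congr c; rewrite !mulrzDr -!addrA; congr (_ + _).
by rewrite [RHS]addrCA; congr (_ + _); rewrite [LHS]addrC -addrA.
Qed.

Lemma coded_shift_subshift c v1 v2 : inK2 v1 -> inK2 v2 ->
  subshift (coded_shift c v1 v2).
Proof.
move=> k1 k2; split=> [|n _ [x hx <-]]; last exact: coded_shift_sigma.
apply: agree_closed => x h N; have [y hy xy] := h N.
by have [p gp hp] := hy N; exists p => // i j hi hj; rewrite xy // hp.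
Qed.

(** Only generic points are constrained; the others are reached by density, since atoms that meet do
    so in an open set, hence at a generic point. *)
Definition coded G (P : nat -> set (torus G)) (c : R * R -> nat) :=
  (forall a, open (P a)) /\
  (forall p a, generic p -> P a (tproj G p) <-> c p = a).

Lemma finite_box (S : set (int * int)) : finite_set S ->
  exists N : nat, forall k, S k -> (absz k.1 <= N)%N /\ (absz k.2 <= N)%N.
Proof.
move=> /finite_seqP[s ->]; elim: s => [|k s [N IH]]; first by exists 0%N.
exists (N + absz k.1 + absz k.2)%N => k' /=; rewrite inE => /predU1P[->|/IH]; lia.
Qed.

Lemma coded_open_all G P c (s : seq (int * int)) v1 v2 (w : int * int -> nat) :
  @coded G P c ->
  open [set p | forall k, k \in s -> P (w k) (rotation G v1 v2 k (tproj G p))].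
Proof.
move=> [oP _]; elim: s => [|k s IH].
  by rewrite [X in open X](_ : _ = setT); [exact: openT|apply/seteqP; split].
rewrite [X in open X](_ : _ = [set p | P (w k) (tproj G (p + (v1 *~ k.1 + v2 *~ k.2)))]
  `&` [set p | forall k, k \in s -> P (w k) (rotation G v1 v2 k (tproj G p))]).
  apply: openI => //.
  exact: (@open_shift (tproj G @^-1` P (w k)) _ (open_preimage_tproj (oP (w k)))).
apply/seteqP; split=> p /=.
  move=> h; split; last by move=> k' hk; apply: h; rewrite inE hk orbT.
  by have := h k (mem_head _ _); rewrite rotationE addrA.
move=> [h1 h2] k'; rewrite inE => /predU1P[->|]; last exact: h2.
by rewrite rotationE -addrA.
Qed.

(** An allowed pattern is a nonempty finite intersection of open sets, so it is already seen along
    the orbit of a generic point. *)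
Lemma symbolic_shiftE G (P : nat -> set (torus G)) c v1 v2 : coded P c ->
  inK2 v1 -> inK2 v2 ->
  symbolic_shift P (rotation G v1 v2) = coded_shift c v1 v2.
Proof.
move=> cP k1 k2; have [oP hP] := cP; apply/seteqP; split=> x hx.
  move=> N; pose s := int_box N.
  have [z hz] := hx 0 [set` s] (finite_seq s).
  have [|p gp hp] := exists_generic (@coded_open_all G P c s v1 v2 x cP).
    by exists (trepr z) => k ks /=; rewrite treprK; have := hz k ks; rewrite /sigma addr0.
  exists p => // i j hi hj; apply/hP.
    by apply: genericD; [apply: genericD|]; [|exact: inK2i|exact: inK2i].
  rewrite -(rotationE G v1 v2 (i, j)); apply: hp.
  by rewrite mem_int_box hi.
move=> n S /finite_box[N hN]; have [p gp hp] := coded_shift_sigma n k1 k2 hx N.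
exists (tproj G p) => -[i j] /hN[hi hj] /=; rewrite rotationE; apply/hP.
  by apply: genericD; [apply: genericD|]; [|exact: inK2i|exact: inK2i].
exact: hp.
Qed.

End Torus.

(** * Increasing enumerations of sets of integers *)

Section Enumeration.

(** Numbers the cuts of a row. It serves for the positions of first letters of return words, and
    later for the columns and rows where blocks begin. *)
Lemma enumerate (P : int -> Prop) :
  (forall i : int, exists k : nat, P (i - k%:Z)) ->
  (forall i : int, exists k : nat, P (i + k%:Z)) ->
  exists Z : int -> int, [/\ forall j, P (Z j), forall j, Z j < Z (j + 1) &
    forall j i : int, Z j < i < Z (j + 1) -> ~ P i].
Proof.
move=> hd hu.
have up (i : int) : {m : int | [/\ P m, i < m & forall l : int, i < l < m -> ~ P l]}.
  apply: cid; have [k0 hk0] := hu (i + 1).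
  have ex : exists k : nat, `[< P (i + 1 + k%:Z) >] by exists k0; apply/asboolP.
  case: (ex_minnP ex) => k /asboolP Pk mk; exists (i + 1 + k%:Z); split=> //; first by lia.
  move=> l hl Pl; have : (k <= absz (l - i - 1)%R)%N.
    by apply: mk; apply/asboolP; have -> : i + 1 + (absz (l - i - 1)%R)%:Z = l by lia.
  by lia.
have down (i : int) : {m : int | [/\ P m, m < i & forall l : int, m < l < i -> ~ P l]}.
  apply: cid; have [k0 hk0] := hd (i - 1).
  have ex : exists k : nat, `[< P (i - 1 - k%:Z) >] by exists k0; apply/asboolP.
  case: (ex_minnP ex) => k /asboolP Pk mk; exists (i - 1 - k%:Z); split=> //; first by lia.
  move=> l hl Pl; have : (k <= absz (i - 1 - l)%R)%N.
    by apply: mk; apply/asboolP; have -> : i - 1 - (absz (i - 1 - l)%R)%:Z = l by lia.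
  by lia.
have [z0 Pz0] : exists z, P z by have [k hk] := hu 0; exists (0 + k%:Z).
pose nxt i := sval (up i); pose prv i := sval (down i).
(* The numbering starts at an arbitrary member [z0] and follows successors to the right,
   predecessors to the left. *)
pose Z j := match j with Posz n => iter n nxt z0 | Negz n => iter n.+1 prv z0 end.
have PZ j : P (Z j).
  case: j => -[|n] //=; rewrite /nxt /prv;
  by [case: (svalP (up (iter n nxt z0)))|case: (svalP (down z0))
     |case: (svalP (down (prv (iter n prv z0))))].
have HZ j : Z j < Z (j + 1) /\ forall i : int, Z j < i < Z (j + 1) -> ~ P i.
  case: j => n.
    have -> : Posz n + 1 = n.+1 by lia.
    by case: (svalP (up (Z n))).
  have -> : Z (Negz n + 1) = iter n prv z0.
    by case: n => [|n] //; have -> : Negz n.+1 + 1 = Negz n by lia.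
  by case: (svalP (down (iter n prv z0))).
by exists Z; split=> // j; case: (HZ j).
Qed.

Variables (Z : int -> int) (Z_incr : forall j : int, Z j < Z (j + 1)).

Lemma incr_ge (j : int) (k : nat) : Z j + k%:Z <= Z (j + k%:Z).
Proof.
elim: k => [|k IH]; first by rewrite !addr0.
have := Z_incr (j + k%:Z); have -> : j + k%:Z + 1 = j + k.+1%:Z by lia.
by lia.
Qed.

Lemma incr_lt (i j : int) : i < j -> Z i < Z j.
Proof.
move=> ij; have := incr_ge (i + 1) (absz (j - i - 1)%R); have := Z_incr i.
have -> : i + 1 + (absz (j - i - 1)%R)%:Z = j by lia.
by lia.
Qed.

Lemma incr_le (i j : int) : i <= j -> Z i <= Z j.
Proof. by rewrite le_eqVlt => /predU1P[->//|/incr_lt/ltW]. Qed.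

Lemma incr_locate (i : int) : exists j : int, Z j <= i < Z (j + 1).
Proof.
pose m := absz (Z 0 - i)%R; pose a : int := - m%:Z.
have ha : Z a <= i.
  have hm : Z 0 - i <= m%:Z by rewrite /m; lia.
  by have := incr_ge a m; rewrite addNr; move: (Z a) (Z 0) hm => *; lia.
have ex : exists k : nat, i < Z (a + k%:Z + 1).
  exists (m + absz (i - Z 0)%R)%N.
  have := incr_ge 0 (absz (i - Z 0)%R).+1.
  set b := absz (i - Z 0)%R; have hb : i - Z 0 <= b%:Z by rewrite /b; lia.
  have -> : a + (m + b)%N%:Z + 1 = 0 + b.+1%:Z by rewrite /a; lia.
  by move=> h; apply: lt_le_trans h; move: (Z 0) hb => z; clear; move: b => b; lia.
case: (ex_minnP ex) => -[|k] hk mk; first by exists a; rewrite ha; move: hk; rewrite addr0.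
exists (a + k.+1%:Z); rewrite hk andbT leNgt; apply/negP => h.
have := mk k; rewrite ltnn; have -> : a + k%:Z + 1 = a + k.+1%:Z by lia.
by move/(_ h).
Qed.

(** As [Z] grows at least as fast as its argument, this tells how large a box of the preimage covers
    a given box of the image. *)
Lemma incr_locate_bound (i j : int) (N : nat) : Z j <= i < Z (j + 1) ->
  (absz i <= N)%N -> (absz j <= N + absz (Z 0) + 1)%N.
Proof.
have h1 : 0 <= j -> Z 0 + j <= Z j.
  move=> hj; have := incr_ge 0 (absz j); have -> : (absz j)%:Z = j by lia.
  by rewrite add0r.
have h2 : j + 1 <= 0 -> Z (j + 1) <= Z 0 + (j + 1).
  move=> hj; have := incr_ge (j + 1) (absz (j + 1)).
  have -> : (absz (j + 1))%:Z = - (j + 1) by lia.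
  by rewrite subrr; move: (Z (j + 1)) (Z 0) => *; lia.
by move: (Z 0) (Z j) (Z (j + 1)) h1 h2 => *; lia.
Qed.

End Enumeration.

(** * Inductions read along towers *)

Definition first_letters (om : seq (seq nat)) : seq nat := [seq head 0%N w | w <- om].

(** A first letter marks the start of a word, since it occurs nowhere further inside a word; as the
    words are moreover distinct, a concatenation is decoded in one way only. *)
Definition marked_words (om : seq (seq nat)) : bool :=
  all (fun w => (0 < size w)%N && all (fun a => a \notin first_letters om) (behead w)) om
  && uniq om.

Section Words.
Variable om : seq (seq nat).
Hypothesis mw : marked_words om.
Local Notation word b := (nth [::] om b).

Lemma word_gt0 b : (b < size om)%N -> (0 < size (word b))%N.
Proof. by move=> hb; case/andP: mw => /(all_nthP [::])/(_ b hb)/andP[]. Qed.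

Lemma word_first b k : (b < size om)%N -> (k < size (word b))%N ->
  (nth 0%N (word b) k \in first_letters om) = (k == 0%N).
Proof.
move=> hb hk; case: k hk => [|k] hk.
  by rewrite nth0 map_f // mem_nth.
case/andP: mw => /(all_nthP [::])/(_ b hb)/andP[_ /(all_nthP 0%N)/(_ k)].
rewrite size_behead nth_behead => h _; rewrite (negPf (h _)) //.
by case: (size _) hk.
Qed.

Lemma word_inj b b' : (b < size om)%N -> (b' < size om)%N -> word b = word b' -> b = b'.
Proof. by case/andP: mw => _ u hb hb' /eqP; rewrite nth_uniq // => /eqP. Qed.

End Words.

Section Tower.
Variable R : realType.
Variables (G G' : lattice R) (va vb va' vb' : R * R) (W : set (R * R)).
Variables (c c' : R * R -> nat) (om : seq (seq nat)).
Local Notation word b := (nth [::] om b).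

(* [va] generates the direction of the induction and [om] lists the return words to [W];
   the induced action on [W], seen modulo [G'], is the translation by [va'] and [vb']. *)
Record tower : Prop := Tower {
  tower_K : [/\ inK2 G.1 /\ inK2 G.2, inK2 G'.1 /\ inK2 G'.2, inK2 va /\ inK2 vb &
     inK2 va' /\ inK2 vb'];
  tower_per : forall p q, congr_mod G p q -> c p = c q;
  tower_per' : forall p q, congr_mod G' p q -> c' p = c' q;
  tower_lt : forall q, generic q -> W q -> (c' q < size om)%N;
  tower_word : forall q (k : nat), generic q -> W q -> (k < size (word (c' q)))%N ->
    c (q + va *~ k) = nth 0%N (word (c' q)) k;
  tower_ret : forall q, generic q -> W q -> exists q',
    [/\ W q', congr_mod G (q + va *~ size (word (c' q))) q' & congr_mod G' (q + va') q'];
  tower_side : forall q, generic q -> W q -> exists q',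
    [/\ W q', congr_mod G (q + vb) q' & congr_mod G' (q + vb') q'];
  tower_side_inv : forall q, generic q -> W q -> exists2 q', W q' & congr_mod G (q - vb) q';
  tower_red : forall p, generic p -> exists2 q, W q & congr_mod G' p q;
  tower_cover : forall p, generic p -> exists q (k : nat),
    [/\ generic q, W q, (k < size (word (c' q)))%N & congr_mod G p (q + va *~ k)] }.

Hypotheses (mw : marked_words om) (T : tower).

Lemma generic_congr (H : lattice R) p q : inK2 H.1 -> inK2 H.2 ->
  congr_mod H p q -> generic p -> generic q.
Proof.
move=> k1 k2 [m [n e]] gp; rewrite -(subrK p q) addrC e.
by apply: genericD => //; apply: inK2D; apply: inK2i.
Qed.

Lemma tower_generic p q : congr_mod G p q -> generic p -> generic q.
Proof. by case: (tower_K T) => -[k1 k2] _ _ _; apply: generic_congr. Qed.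

Lemma tower_generic' p q : congr_mod G' p q -> generic p -> generic q.
Proof. by case: (tower_K T) => _ [k1 k2] _ _; apply: generic_congr. Qed.

Lemma tower_genericv p (i j : int) : generic p -> generic (p + va *~ i + vb *~ j).
Proof.
by case: (tower_K T) => _ _ [k1 k2] _ gp; apply: genericD; [apply: genericD|];
  rewrite //; apply: inK2i.
Qed.

Lemma tower_genericv' p (i j : int) : generic p -> generic (p + va' *~ i + vb' *~ j).
Proof.
by case: (tower_K T) => _ _ _ [k1 k2] gp; apply: genericD; [apply: genericD|];
  rewrite //; apply: inK2i.
Qed.

(** The letter alone tells whether the orbit is in the window: this makes the induction visible in a
    coding. *)
Lemma tower_mark p : generic p ->
  (c p \in first_letters om) <-> exists q, [/\ generic q, W q & congr_mod G p q].
Proof.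
move=> gp; split=> [h|[q [gq Wq pq]]].
  have [q [k [gq Wq hk pq]]] := tower_cover T gp.
  move: h; rewrite (tower_per T pq) tower_word // word_first //; last exact: tower_lt.
  by move=> /eqP k0; exists q; split=> //; rewrite k0 mulr0z addr0 in pq.
have hb := tower_lt T gq Wq.
rewrite (tower_per T pq) -[q]addr0 -(mulr0z va) (tower_word T (k := 0)) ?word_gt0 //.
by rewrite word_first ?word_gt0.
Qed.

(** Follows one orbit in both systems at once. The cuts [Z] are given in advance; that they grow by
    the lengths of the words read is asked only at points of this orbit, where the caller knows the
    letter. *)
Lemma tower_orbit (Z : nat -> int) (B : R * R) (J : nat) : generic B -> W B ->
  (forall (j n : nat) q, (j < J)%N -> (n <= J)%N -> generic q -> W q ->
     congr_mod G (B + va *~ (Z j - Z 0%N) + vb *~ n) q ->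
     congr_mod G' (B + va' *~ j + vb' *~ n) q ->
     Z j.+1 = Z j + (size (word (c' q)))%:Z) ->
  forall j n : nat, (j <= J)%N -> (n <= J)%N -> exists q, [/\ generic q, W q,
    congr_mod G (B + va *~ (Z j - Z 0%N) + vb *~ n) q &
    congr_mod G' (B + va' *~ j + vb' *~ n) q].
Proof.
move=> gB WB H; elim=> [|j IHj] n.
  rewrite subrr !mulr0z !addr0 => _; elim: n => [|n IHn] hn.
    by exists B; rewrite !mulr0z !addr0; split=> //; apply: congr_mod_refl.
  have [q [gq Wq e e']] := IHn (ltnW hn).
  have [q' [Wq' f f']] := tower_side T gq Wq.
  exists q'; split=> //.
  - apply: (tower_generic' f'); case: (tower_K T) => _ _ _ [_ k2]; exact: genericD.
  - by apply: congr_mod_trans f; rewrite intS [1 + _]addrC mulrzDr mulr1z addrA; apply: congr_modD.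
  - by apply: congr_mod_trans f'; rewrite intS [1 + _]addrC mulrzDr mulr1z addrA; apply: congr_modD.
move=> hj hn; have [q [gq Wq e e']] := IHj n (ltnW hj) hn.
have [q' [Wq' f f']] := tower_ret T gq Wq.
exists q'; split=> //.
- apply: (tower_generic' f'); case: (tower_K T) => _ _ _ [k1 _]; exact: genericD.
- apply: congr_mod_trans f; rewrite (H j n q) //.
  rewrite [_ + _ - Z 0%N]addrAC mulrzDr addrA [_ + _ + vb *~ _]addrAC.
  exact: congr_modD.
- apply: congr_mod_trans f'; rewrite intS [1 + _]addrC mulrzDr mulr1z addrA [_ + _ + vb' *~ _]addrAC.
  exact: congr_modD.
Qed.

(** The direction of the induction comes first here, so that one argument serves horizontal and
    vertical inductions. *)
Definition orbit_shift (d : R * R -> nat) (v w : R * R) (y : int -> int -> nat) :=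
  forall N : nat, exists2 p, generic p & forall i j : int,
    (absz i <= N)%N -> (absz j <= N)%N -> d (p + v *~ i + w *~ j) = y i j.

(** The cuts [Z] do not depend on the line [n]: neighbouring words have the same length, as
    [config_image] demands. *)
Definition line_image (x y : int -> int -> nat) (Z : int -> int) :=
  forall j n : int, [/\ (x j n < size om)%N, Z (j + 1) = Z j + (size (word (x j n)))%:Z &
    forall k : nat, (k < size (word (x j n)))%N ->
      y (Z j + k%:Z) n = nth 0%N (word (x j n)) k].

Lemma shift_orbit (v w p : R * R) (a b i j : int) :
  p + v *~ a + w *~ b + v *~ i + w *~ j = p + v *~ (a + i) + w *~ (b + j).
Proof.
rewrite !mulrzDr -!addrA; congr (_ + (_ + _)).
by rewrite addrCA.
Qed.

Lemma tower_image x y Z : orbit_shift c' va' vb' x -> line_image x y Z ->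
  orbit_shift c va vb y.
Proof.
(* A position at distance at most [N] belongs to a word of index at most [M] in absolute value. *)
move=> hx li N; pose M := (N + absz (Z 0) + 1)%N.
have Zi (j : int) : Z j < Z (j + 1).
  by case: (li j 0) => hb -> _; have := word_gt0 mw hb; lia.
have [p' gp' hp'] := hx M.
(* The orbit is followed from the lower-left corner of the box of size [M], so that only natural
   indices occur. *)
pose pB := p' + va' *~ (- M%:Z) + vb' *~ (- M%:Z).
have gpB : generic pB by apply: tower_genericv'.
have [B WB eB] := tower_red T gpB.
have gB : generic B := tower_generic' eB gpB.
have letter q (j n : nat) : (j <= M + M)%N -> (n <= M + M)%N ->
    congr_mod G' (B + va' *~ j + vb' *~ n) q -> c' q = x (j%:Z - M%:Z) (n%:Z - M%:Z).
  move=> hj hn e; rewrite -hp'; [|lia|lia].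
  rewrite -(tower_per' T e); apply: (tower_per' T).
  apply: congr_mod_sym; rewrite ![_ - M%:Z]addrC -shift_orbit.
  by apply: congr_modD; apply: congr_modD.
pose Zn (j : nat) := Z (j%:Z - M%:Z).
have orb := @tower_orbit Zn B (M + M)%N gB WB.
have {}orb : forall j n : nat, (j <= M + M)%N -> (n <= M + M)%N -> exists q,
    [/\ generic q, W q, congr_mod G (B + va *~ (Zn j - Zn 0%N) + vb *~ n) q &
    congr_mod G' (B + va' *~ j + vb' *~ n) q].
  apply: orb => j n q hj hn gq Wq _ e; rewrite (letter _ _ _ _ _ e) ?(ltnW hj) //.
  rewrite /Zn; case: (li (j%:Z - M%:Z) (n%:Z - M%:Z)) => _ + _.
  by have -> : j%:Z - M%:Z + 1 = j.+1%:Z - M%:Z by lia.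
(* [B] is read at position [Zn 0] of line [- M]; moving back by this vector gives the point read at
   the origin. *)
exists (B + va *~ (- Zn 0%N) + vb *~ M%:Z); first exact: tower_genericv.
move=> i l hi hl; have [j /andP[hj1 hj2]] := incr_locate Zi i.
have hjM : (absz j <= M)%N.
  by apply: (incr_locate_bound Zi) hi; rewrite hj1.
have [q [gq Wq e e']] := orb (absz (j + M%:Z)) (absz (l + M%:Z)) ltac:(lia) ltac:(lia).
have jE : (absz (j + M%:Z))%:Z = j + M%:Z by lia.
have lE : (absz (l + M%:Z))%:Z = l + M%:Z by lia.
have xE : c' q = x j l.
  by rewrite (letter _ _ _ _ _ e') ?jE ?lE ?addrK //; lia.
have [hb Zj wy] := li j l; pose k := absz (i - Z j).
have kE : i = Z j + k%:Z by rewrite /k; lia.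
have hk : (k < size (word (x j l)))%N by move: Zj; rewrite /k; lia.
rewrite {2}kE wy // -xE -(tower_word T) ?xE // shift_orbit [M%:Z + l]addrC -lE.
apply: (tower_per T).
have -> : - Zn 0%N + i = (Zn (absz (j + M%:Z)%R) - Zn 0%N) + k%:Z.
  by rewrite /Zn jE addrK kE; lia.
by rewrite mulrzDr addrA [_ + _ + vb *~ _]addrAC; apply: congr_modD.
Qed.

Definition max_size := foldr maxn 0%N [seq size w | w <- om].

Lemma word_le b : (size (word b) <= max_size)%N.
Proof.
rewrite /max_size; elim: om b => [|w l IH] [|b] //=; first by rewrite leq_maxl.
by rewrite (leq_trans (IH b)) ?leq_maxr.
Qed.

(** The translation by [vb] and its inverse both preserve the window modulo [G], so marks propagate
    along transverse lines. *)
Lemma mark_side p : generic p ->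
  (c (p + vb) \in first_letters om) = (c p \in first_letters om).
Proof.
have [_ _ [_ kb] _] := tower_K T => gp.
have [h1 h2] := tower_mark gp; have [h3 h4] := tower_mark (genericD gp kb).
apply/idP/idP => [/h3|/h1] [q [gq Wq e]].
  have [q' Wq' e'] := tower_side_inv T gq Wq.
  have pq' : congr_mod G p q'.
    by apply: congr_mod_trans e'; rewrite -{1}(addrK vb p); apply: congr_modD.
  by apply: h2; exists q'; split=> //; apply: (tower_generic pq').
have [q' [Wq' e' _]] := tower_side T gq Wq.
have pq' : congr_mod G (p + vb) q' by apply: congr_mod_trans e'; apply: congr_modD.
by apply: h4; exists q'; split=> //; apply: (tower_generic pq'); apply: genericD.
Qed.

(** Recognizability: the marks cut all lines at the same places, and between two consecutive marks
    stands one complete word, which identifies the letter it comes from. *)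
Lemma tower_desub y : orbit_shift c va vb y ->
  exists x Z, orbit_shift c' va' vb' x /\ line_image x y Z.
Proof.
move=> hy; pose F (i n : int) := y i n \in first_letters om.
have FS (i n : int) : F i (n + 1) = F i n.
  have [p gp hp] := hy (absz i + absz n + 1)%N.
  rewrite /F -!hp; [|lia|lia|lia|lia].
  by rewrite mulrzDr mulr1z addrA mark_side //; apply: tower_genericv.
have F0 (i n : int) : F i n = F i 0.
  have h (k : nat) (m : int) : F i (m + k%:Z) = F i m.
    elim: k => [|k IH]; first by rewrite addr0.
    by rewrite -IH -(FS i (m + k%:Z)) -addrA intS [1 + _]addrC.
  have [n0|n0] := leP 0 n.
    by rewrite -(h (absz n) 0); have -> : 0 + (absz n)%:Z = n by lia.
  by rewrite -(h (absz n) n); have -> : n + (absz n)%:Z = 0 by lia.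
(* Each position lies at height [k] of some word, so a mark stands [k] steps before it and another
   one where this word ends. *)
have cover (i : int) : exists k l : nat, F (i - k%:Z) 0 /\ F (i + l%:Z) 0.
  have [p gp hp] := hy (absz i + max_size)%N.
  have [q [k [gq Wq hk e]]] := tower_cover T (tower_genericv (i := i) (j := 0) gp).
  have := word_le (c' q) => hL.
  exists k, (size (word (c' q)) - k)%N; split; rewrite /F -hp; try lia;
    apply/tower_mark; try exact: tower_genericv.
    exists q; split=> //.
    have -> : p + va *~ (i - k%:Z) + vb *~ 0 = p + va *~ i + vb *~ 0 - va *~ k.
      by rewrite mulrzBr !mulr0z !addr0 addrA.
    by rewrite -[X in congr_mod G _ X](addrK (va *~ k%:Z)); apply: congr_modD.
  have [q' [Wq' e' e'']] := tower_ret T gq Wq.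
  exists q'; split=> //.
    by apply: (tower_generic' e''); apply: genericD => //; case: (tower_K T) => _ _ _ [].
  apply: congr_mod_trans e'.
  have -> : p + va *~ (i + (size (word (c' q)) - k)%N%:Z) + vb *~ 0 =
      p + va *~ i + vb *~ 0 + va *~ (size (word (c' q)) - k)%N.
    by rewrite mulrzDr !mulr0z !addr0 addrA.
  have -> : q + va *~ size (word (c' q)) =
      q + va *~ k + va *~ (size (word (c' q)) - k)%N.
    by rewrite -addrA -mulrzDr; congr (_ + _ *~ _); lia.
  exact: congr_modD.
have [Z [PZ Zi gap]] : exists Z : int -> int, [/\ forall j, F (Z j) 0,
    forall j, Z j < Z (j + 1) & forall j i : int, Z j < i < Z (j + 1) -> ~ F i 0].
  by apply: enumerate => i; have [k [l [h h']]] := cover i; [exists k|exists l].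
(* A letter of the preimage is the rank in [om] of the word read between two consecutive marks. *)
pose x (j n : int) := index
  [seq y (Z j + k%:Z) n | k <- iota 0 (absz (Z (j + 1) - Z j)%R)] om.
(* A generic point whose coding agrees with [y] on a large enough box decodes the [j]-th word of
   line [n]. *)
have loc M p (j n : int) q : generic p ->
    (forall i m : int, (absz i <= M)%N -> (absz m <= M)%N ->
       c (p + va *~ i + vb *~ m) = y i m) ->
    (absz (Z j)%R + max_size <= M)%N -> (absz n <= M)%N -> generic q -> W q ->
    congr_mod G (p + va *~ Z j + vb *~ n) q ->
    [/\ c' q = x j n, Z (j + 1) = Z j + (size (word (c' q)))%:Z &
    forall k : nat, (k < size (word (c' q)))%N ->
      y (Z j + k%:Z) n = nth 0%N (word (c' q)) k].
  move=> gp hp hM hn gq Wq e; have hL := word_le (c' q); have hb := tower_lt T gq Wq.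
  have hw : forall k : nat, (k < size (word (c' q)))%N ->
      y (Z j + k%:Z) n = nth 0%N (word (c' q)) k.
    move=> k hk; rewrite -hp //; last by move: (Z j) hM => *; lia.
    rewrite -(tower_word T) //; apply: (tower_per T).
    by rewrite mulrzDr addrA [_ + _ + vb *~ _]addrAC; apply: congr_modD.
  have hs : F (Z j + (size (word (c' q)))%:Z) 0.
    rewrite -(F0 _ n) /F -hp //; last by move: (Z j) hM => *; lia.
    have [q' [Wq' e' e'']] := tower_ret T gq Wq.
    apply/tower_mark; first exact: tower_genericv.
    exists q'; split=> //.
      by apply: (tower_generic' e''); apply: genericD => //; case: (tower_K T) => _ _ _ [].
    apply: congr_mod_trans e'.
    by rewrite mulrzDr addrA [_ + _ + vb *~ _]addrAC; apply: congr_modD.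
  (* The next mark is not later, as the return to the window is itself marked, and not earlier, as
     only the first letter of a word is a mark. *)
  have ZE : Z (j + 1) = Z j + (size (word (c' q)))%:Z.
    have w0 := word_gt0 mw hb.
    case: (ltgtP (Z (j + 1)) (Z j + (size (word (c' q)))%:Z)) => // h; last first.
      by case: (gap j _ _ hs); rewrite h andbT; move: (Z j) => *; lia.
    have := PZ (j + 1); pose k := absz (Z (j + 1) - Z j)%R.
    have kE : Z (j + 1) = Z j + k%:Z.
      by rewrite /k; have := Zi j; move: (Z j) (Z (j + 1)) => *; lia.
    have hk : (k < size (word (c' q)))%N.
      by move: h; rewrite kE ltrD2l ltz_nat.
    rewrite -(F0 _ n) kE /F hw // word_first // => /eqP k0.
    by have := Zi j; rewrite kE k0 addr0 ltxx.
  split=> //; rewrite /x ZE; have -> : absz (Z j + (size (word (c' q)))%:Z - Z j)%R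
    = size (word (c' q)) by move: (Z j) => *; lia.
  have -> : [seq y (Z j + k%:Z) n | k <- iota 0 (size (word (c' q)))] = word (c' q).
    apply: (@eq_from_nth _ 0%N); rewrite size_map size_iota // => k hk.
    by rewrite (nth_map 0%N) ?size_iota // nth_iota // add0n hw.
  by rewrite index_uniq //; case/andP: mw.
exists x, Z; split; last first.
  move=> j n; pose M := (absz (Z j)%R + max_size + absz n)%N.
  have [p gp hp] := hy M.
  have : c (p + va *~ Z j + vb *~ n) \in first_letters om.
    rewrite hp; [|rewrite /M; lia|rewrite /M; lia].
    by have := PZ j; rewrite -(F0 _ n).
  move/tower_mark => /(_ (tower_genericv gp))[q [gq Wq e]].
  have [<- ? ?] := loc M p j n q gp hp ltac:(rewrite /M; lia) ltac:(rewrite /M; lia) gq Wq e.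
  by split=> //; apply: tower_lt.
(* The cuts with index between [- N] and [N] lie between the two extreme ones; [max_size] leaves
   room for the last word. *)
move=> N; pose M := (absz (Z (- N%:Z))%R + absz (Z N%:Z)%R + max_size + N)%N.
have [p gp hp] := hy M.
have ZM (j : int) : (absz j <= N)%N -> (absz (Z j)%R + max_size <= M)%N.
  move=> hj; have := @incr_le Z Zi (- N%:Z) j ltac:(lia).
  have := @incr_le Z Zi j N%:Z ltac:(lia).
  by rewrite /M; move: (Z j) (Z N%:Z) (Z (- N%:Z)) => *; lia.
pose Zn (j : nat) := Z (j%:Z - N%:Z).
pose pB := p + va *~ Zn 0%N + vb *~ (- N%:Z).
have gpB : generic pB by apply: tower_genericv.
have [B [gB WB eB]] : exists q, [/\ generic q, W q & congr_mod G pB q].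
  apply/tower_mark => //; rewrite hp; [|by have := ZM (0%:Z - N%:Z) ltac:(lia); rewrite -/(Zn 0%N); lia|rewrite /M; lia].
  by have := PZ (0%:Z - N%:Z); rewrite -(F0 _ (- N%:Z)).
have eq1 (j n : nat) q : congr_mod G (B + va *~ (Zn j - Zn 0%N) + vb *~ n) q ->
    congr_mod G (p + va *~ Z (j%:Z - N%:Z) + vb *~ (n%:Z - N%:Z)) q.
  apply: congr_mod_trans; rewrite [n%:Z - _]addrC.
  have -> : Z (j%:Z - N%:Z) = Zn 0%N + (Zn j - Zn 0%N) by rewrite [RHS]addrC subrK.
  by rewrite -shift_orbit; apply: congr_modD; apply: congr_modD.
have orb := @tower_orbit Zn B (N + N)%N gB WB.
have {}orb : forall j n : nat, (j <= N + N)%N -> (n <= N + N)%N -> exists q,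
    [/\ generic q, W q, congr_mod G (B + va *~ (Zn j - Zn 0%N) + vb *~ n) q &
    congr_mod G' (B + va' *~ j + vb' *~ n) q].
  apply: orb => j n q hj hn gq Wq e _.
  have [_ + _] := loc M p (j%:Z - N%:Z) (n%:Z - N%:Z) q gp hp
    (ZM (j%:Z - N%:Z) ltac:(lia)) ltac:(rewrite /M; lia) gq Wq (eq1 _ _ _ e).
  by rewrite /Zn => <-; have -> : j.+1%:Z - N%:Z = j%:Z - N%:Z + 1 by lia.
exists (B + va' *~ N%:Z + vb' *~ N%:Z); first exact: tower_genericv'.
move=> j n hj hn.
have [q [gq Wq e e']] := orb (absz (j + N%:Z)%R) (absz (n + N%:Z)%R) ltac:(lia) ltac:(lia).
have jE : (absz (j + N%:Z)%R)%:Z = N%:Z + j by lia.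
have nE : (absz (n + N%:Z)%R)%:Z = N%:Z + n by lia.
rewrite shift_orbit -jE -nE (tower_per' T e').
have [<- _ _] := loc M p j n q gp hp (ZM _ hj) ltac:(rewrite /M; lia) gq Wq
  ltac:(have := eq1 _ _ _ e; rewrite jE nE ![N%:Z + _]addrC !addrK; exact).
by [].
Qed.

End Tower.

(** * Coded shifts as orbit closures of images under morphisms *)

Section Morphisms.
Variable R : realType.
Implicit Types (c : R * R -> nat) (v w : R * R).

Lemma orbit_shift_v c v w (x : config) :
  coded_shift c w v x <-> orbit_shift c v w (fun i j => x (j, i)).
Proof.
by split=> h N; have [p gp hp] := h N; exists p => // i j hi hj;
  rewrite addrAC hp.
Qed.

Lemma int_step (Y : int -> int) : Y 0 = 0 -> (forall j : int, Y (j + 1) = Y j + 1) -> Y =1 id.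
Proof.
move=> Y0 YS; have h (j : int) (k : nat) : Y (j + k%:Z) = Y j + k%:Z.
  elim: k => [|k IH]; first by rewrite !addr0.
  by rewrite intS [1 + _]addrC addrA YS IH addrA.
move=> j; have [j0|j0] := leP 0 j.
  by have := h 0 (absz j); have -> : 0 + (absz j)%:Z = j; [|rewrite Y0]; lia.
have := h j (absz j); have -> : j + (absz j)%:Z = 0 by lia.
by rewrite Y0; move: (Y j) => *; lia.
Qed.

Lemma size_hword (s : seq nat) : width (hword s) = size s.
Proof. by rewrite /width size_map. Qed.

Lemma height_hword (s : seq nat) : (0 < size s)%N -> height (hword s) = 1%N.
Proof. by case: s. Qed.

Lemma wletter_hword (s : seq nat) i : (i < size s)%N -> wletter (hword s) i 0 = nth 0%N s i.
Proof. by move=> hi; rewrite /wletter (nth_map 0%N). Qed.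

(** [tower_desub] and [tower_image] give the two inclusions. Images of configurations have a cut at
    the origin whereas [Z 0] is arbitrary: the orbit closure absorbs this shift. *)
Lemma tower_shift_h G G' v1 v2 v1' v2' W c c' om : marked_words om ->
  @tower R G G' v1 v2 v1' v2' W c c' om ->
  coded_shift c v1 v2 =
  orbit_closure (morphism_image [seq hword s | s <- om] (coded_shift c' v1' v2')).
Proof.
move=> mw T; have [_ _ [k1 k2] _] := tower_K T.
apply/seteqP; split=> [y hy|_ [k _ [y [x hx [X [Y [X0 Y0 hXY]]]] <-]]].
  have [x [Z [hx li]]] := tower_desub mw T hy.
  exists (- Z 0, 0) => //; exists (sigma (Z 0, 0) y); last first.
    apply/funext => -[i j]; rewrite /sigma; congr (y _).
    by congr pair => /=; rewrite ?addr0 // subrK.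
  exists (fun m => x m.1 m.2) => //; exists (fun i => Z i - Z 0), id; rewrite subrr.
  split=> // i j /=; have [hb ZS hw] := li i j.
  rewrite /image_of_letter size_map (nth_map [::]) // size_hword height_hword ?word_gt0 //.
  split=> //; first by rewrite ZS addrAC.
  move=> p [|//] hp _; rewrite wletter_hword // -hw //.
  rewrite /sigma; congr (y _); congr pair => /=; rewrite ?addr0 //.
  by rewrite addrAC subrK.
apply: coded_shift_sigma => //; apply: (tower_image mw T (Z := X) hx).
have YE : Y =1 id.
  apply: int_step => // j; have [h _ -> _] := hXY 0 j; congr (_ + _).
  rewrite size_map in h.
  by rewrite /image_of_letter (nth_map [::]) // height_hword ?word_gt0.
move=> i j; have [h XS _ hw] := hXY i j; rewrite size_map in h.
move: XS hw; rewrite /image_of_letter (nth_map [::]) // size_hword height_hword ?word_gt0 //.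
move=> XS hw; split=> // p hp; have := hw p 0%N hp isT.
by rewrite YE addr0 wletter_hword.
Qed.

Lemma tower_shift_v G G' v1 v2 v1' v2' W c c' om : marked_words om ->
  @tower R G G' v2 v1 v2' v1' W c c' om ->
  coded_shift c v1 v2 =
  orbit_closure (morphism_image [seq vword s | s <- om] (coded_shift c' v1' v2')).
Proof.
move=> mw T; have [_ _ [k1 k2] _] := tower_K T.
apply/seteqP; split=> [y /orbit_shift_v hy|_ [k _ [y [x hx [X [Y [X0 Y0 hXY]]]] <-]]].
  have [x [Z [hx li]]] := tower_desub mw T hy.
  exists (0, - Z 0) => //; exists (sigma (0, Z 0) y); last first.
    apply/funext => -[i j]; rewrite /sigma; congr (y _).
    by congr pair => /=; rewrite ?addr0 // subrK.
  exists (fun m => x m.2 m.1); first exact/orbit_shift_v.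
  exists id, (fun i => Z i - Z 0); rewrite subrr.
  split=> // j i /=; have [hb ZS hw] := li i j.
  rewrite /image_of_letter size_map (nth_map [::]) //.
  split=> //; first by rewrite ZS addrAC.
  move=> [|//] q _ hq; rewrite -[RHS]hw //.
  rewrite /sigma; congr (y _); congr pair => /=; rewrite ?addr0 //.
  by rewrite addrAC subrK.
apply: coded_shift_sigma => //; apply/orbit_shift_v.
apply: (tower_image mw T (Z := Y) (iffLR (orbit_shift_v _ _ _ _) hx)).
have XE : X =1 id.
  apply: int_step => // j; have [h -> _ _] := hXY j 0; congr (_ + _).
  rewrite size_map in h.
  by rewrite /image_of_letter (nth_map [::]).
move=> j i; have [h _ YS hw] := hXY i j; rewrite size_map in h.
move: YS hw; rewrite /image_of_letter (nth_map [::]) //.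
move=> YS hw; split=> // q hq; have := hw 0%N q isT hq.
by rewrite XE addr0.
Qed.

End Morphisms.

(** * Induced partitions *)

Lemma radix_lt_irr u : radix_lt u u = false.
Proof. by rewrite /radix_lt ltnn Order.POrderTheory.ltxx andbF. Qed.

Lemma radix_lt_asym u v : radix_lt u v -> radix_lt v u = false.
Proof.
rewrite /radix_lt; case: (ltngtP (size u) (size v)) => //= _ h.
by apply/negbTE; rewrite -Order.TotalTheory.leNgt Order.POrderTheory.ltW.
Qed.

Section Induced.
Variable R : realType.
Variables (G G' : lattice R) (va vb va' vb' : R * R) (W : set (R * R)).
Variables (c c' : R * R -> nat) (om : seq (seq nat)).
Variables (P : nat -> set (torus G)) (Rt : int * int -> torus G -> torus G) (e : int * int).
Local Notation word b := (nth [::] om b).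
Hypotheses (mw : marked_words om) (T : tower G G' va vb va' vb' W c c' om).
Hypotheses (cP : coded P c) (oW : open W) (rad : pairwise radix_lt om).
Hypothesis RtE : forall (k : nat) p, Rt (e *+ k) (tproj G p) = tproj G (p + va *~ k).
Hypothesis occ : forall b, (b < size om)%N -> exists q, [/\ generic q, W q & c' q = b].

Local Notation W' := (tproj G @` W).

Lemma coded_disjoint a b x : P a x -> P b x -> a = b.
Proof.
case: cP => oP hP Pa Pb.
have [||p gp [h1 h2]] := @exists_generic R (tproj G @^-1` (P a `&` P b)).
- by apply: open_preimage_tproj; apply: openI.
- by exists (trepr x); rewrite /= treprK.
by rewrite -(iffLR (hP p a gp) h1) (iffLR (hP p b gp) h2).
Qed.

(** Atoms are open and pairwise disjoint, so a point of one atom is on the boundary of none: the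
    boundary clause of [return_word] holds by itself. *)
Lemma coded_boundary a b x : P a x -> ~ boundary (P b) x.
Proof.
case: cP => oP hP Pa [clb]; apply.
have [y [Py Pay]] := clb (P a) (open_nbhs_nbhs (conj (oP a) Pa)).
by rewrite (coded_disjoint Py Pay) (iffLR (interior_id _)).
Qed.

(** By density: the atom and the window are open, and share a generic point, where the letter is
    known to be a mark. *)
Lemma coded_W a x : P a x -> W' x -> a \in first_letters om.
Proof.
case: cP => oP hP Pa Wx.
have [||p gp [h1 [q Wq /tproj_eq h2]]] := @exists_generic R (tproj G @^-1` (P a `&` W')).
- by apply: open_preimage_tproj; apply: openI => //; apply: tproj_open.
- by exists (trepr x); rewrite /= treprK.
rewrite -(iffLR (hP p a gp) h1); apply/(tower_mark mw T gp).
by exists q; split=> //; [apply: (tower_generic T (congr_mod_sym h2))|apply: congr_mod_sym].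
Qed.

(** Reading a given word and coming back to the window are open conditions, so they persist around a
    generic point. No earlier return can occur there, because the later letters of the word are not
    marks. *)
Lemma cylinder_word q : generic q -> W q -> (cylinder P Rt W' e (word (c' q)))° (tproj G q).
Proof.
move=> gq Wq; set w := word _; case: cP => oP hP.
have hb := tower_lt T gq Wq.
have w0 : (0 < size w)%N by apply: (word_gt0 mw).
pose U := [set p | W p /\ W' (tproj G (p + va *~ size w))] `&`
  [set p | forall k, (k < size w)%N -> P (nth 0%N w k) (tproj G (p + va *~ k))].
have oU : open U.
  apply: openI.
    apply: openI => //; apply: (@open_shift _ (tproj G @^-1` W')).
    by apply: open_preimage_tproj; apply: tproj_open.
  apply: open_forall_lt => k; apply: (@open_shift _ (tproj G @^-1` P _)).
  exact: open_preimage_tproj.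
have Uq : U q.
  have [q' [Wq' e1 _]] := tower_ret T gq Wq.
  split; first by split=> //; exists q' => //; apply/esym/tproj_eq.
  move=> k hk; apply/hP; last by rewrite (tower_word T).
  by have := tower_genericv T (i := k%:Z) (j := 0) gq; rewrite mulr0z addr0.
have nU : nbhs (tproj G q) (tproj G @` U).
  by apply: open_nbhs_nbhs; split; [apply: tproj_open|exists q].
rewrite /interior; apply: filterS nU => _ [p [[Wp Wr] Pk] <-].
split; first by exists p.
have Pk' k : (k < size w)%N -> P (nth 0%N w k) (Rt (e *+ k) (tproj G p)).
  by move=> hk; rewrite RtE; apply: Pk.
split=> //; first by rewrite RtE.
  move=> k /andP[k0 hk] Wk; have := coded_W (Pk' k hk) Wk.
  by rewrite (word_first mw) // => /eqP k00; rewrite k00 in k0.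
by move=> k hk; split=> [a|]; [apply: coded_boundary (Pk' k hk)|apply: Pk'].
Qed.

Lemma cylinder_uniq q w : generic q -> W q -> cylinder P Rt W' e w (tproj G q) ->
  w = word (c' q).
Proof.
move=> gq Wq [_ [w0 Wr nW Pw]].
have [_ [v0 Wr' nW' Pv]] := @interior_subset _ (cylinder P Rt W' e _) _ (cylinder_word gq Wq).
have sz : size w = size (word (c' q)).
  by apply/eqP; case: ltngtP => // h; [case: (nW' (size w))|case: (nW (size (word (c' q))))];
    rewrite ?w0 ?v0.
apply: (@eq_from_nth _ 0%N) => // k hk.
have [_ h1] := Pw k hk; have [_ h2] := Pv k ltac:(by rewrite -sz).
exact: coded_disjoint h1 h2.
Qed.

Lemma occursE w : occurs P Rt W' e w <-> exists2 b, (b < size om)%N & w = word b.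
Proof.
split=> [[x ix]|[b hb ->]]; last first.
  by have [q [gq Wq <-]] := occ hb; exists (tproj G q); apply: cylinder_word.
have [||p gp ip] := @exists_generic R (tproj G @^-1` (cylinder P Rt W' e w)°).
- by apply: open_preimage_tproj; apply: open_interior.
- by exists (trepr x); rewrite /= treprK.
have [[q Wq eq] _] := @interior_subset _ _ _ ip.
have gq : generic q by apply: (tower_generic T (congr_mod_sym (iffLR (tproj_eq _ _ _) eq))).
exists (c' q); first exact: (tower_lt T).
by apply: cylinder_uniq => //; apply: interior_subset; rewrite eq.
Qed.

Lemma radix_word b b' : (b < size om)%N -> (b' < size om)%N ->
  radix_lt (word b) (word b') = (b < b')%N.
Proof.
move=> hb hb'; have /(pairwiseP [::]) h := rad.
case: (ltngtP b b') => [lt|lt|->]; first exact: h.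
- by apply: radix_lt_asym; apply: h.
- exact: radix_lt_irr.
Qed.

(** [om] is sorted in radix order and exhausts the words that occur, so the words preceding one of
    them are those of smaller index. *)
Lemma is_nth_wordE b w : is_nth_word P Rt W' e b w <-> (b < size om)%N /\ w = word b.
Proof.
have H b0 : (b0 < size om)%N ->
    ([set w' | occurs P Rt W' e w' /\ radix_lt w' (word b0)] #= `I_b0)%card.
  move=> h0; have -> : [set w' | occurs P Rt W' e w' /\ radix_lt w' (word b0)] =
      (fun b => word b) @` `I_b0.
    apply/seteqP; split=> [w' [/occursE[b1 h1 ->]]|_ [b1 /= h1 <-]].
      by rewrite radix_word // => h; exists b1.
    have h2 := ltn_trans h1 h0; split; first by apply/occursE; exists b1.
    by rewrite radix_word.
  apply: inj_card_eq => b1 b2 /set_mem /= h1 /set_mem /= h2.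
  by apply: (word_inj mw); [apply: ltn_trans h0|apply: ltn_trans h0].
split=> [[/occursE[b0 h0 ->] h]|[hb ->]].
  suff -> : b = b0 by [].
  by apply/card_eq_II; apply: card_eq_trans (H b0 h0); rewrite card_eq_sym.
by split; [apply/occursE; exists b|apply: H].
Qed.

Lemma coded_induced : coded (induced_on G' P Rt W e) c'.
Proof.
split=> [b|p b gp].
  apply: tproj_open; apply: openI => //; apply: open_preimage_tproj.
  rewrite (_ : induced _ _ _ _ _ = \bigcup_(w in is_nth_word P Rt W' e b)
    (cylinder P Rt W' e w)°).
    by apply: bigcup_open => w _; apply: open_interior.
  by apply/seteqP; split=> x [w h1 h2]; exists w.
split=> [[q [Wq [w /is_nth_wordE[hb ->] iw]] eq]|<-].
  have pq := iffLR (tproj_eq _ _ _) eq.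
  have gq : generic q := tower_generic' T (congr_mod_sym pq) gp.
  rewrite -(tower_per' T pq); apply: (word_inj mw) => //; first exact: (tower_lt T).
  by apply/esym/cylinder_uniq => //; apply: interior_subset.
have [q Wq e1] := tower_red T gp.
have gq : generic q := tower_generic' T e1 gp.
exists q; last by apply/esym/tproj_eq.
split=> //; exists (word (c' p)); rewrite (tower_per' T e1).
  by apply/is_nth_wordE; split=> //; apply: (tower_lt T).
exact: cylinder_word.
Qed.

End Induced.

(** * Exact geometry over Z[golden] *)

(** Binary integers, so that the geometric checks below can be settled by evaluation. *)
Notation zf := (Z * Z)%type.
Notation zpt := (zf * zf)%type.

Definition zadd (a b : zf) : zf := (Z.add a.1 b.1, Z.add a.2 b.2).
Definition zopp (a : zf) : zf := (Z.opp a.1, Z.opp a.2).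
Definition zsub (a b : zf) : zf := (Z.sub a.1 b.1, Z.sub a.2 b.2).
(* the pair (a, b) stands for a + b * golden *)
Definition zmul (a b : zf) : zf :=
  let c := Z.mul a.2 b.2 in
  (Z.add (Z.mul a.1 b.1) c, Z.add (Z.add (Z.mul a.1 b.2) (Z.mul a.2 b.1)) c).
(* when a and b have opposite signs, the sign of a + b * golden is given by its
   norm a * (a + b) - b * b *)
Definition znneg (x : zf) : bool :=
  let (a, b) := x in
  if Z.leb Z0 a then
    if Z.leb Z0 b then true else Z.leb (Z.mul b b) (Z.mul a (Z.add a b))
  else if Z.leb b Z0 then false else Z.leb (Z.mul a (Z.add a b)) (Z.mul b b).
Definition zpos (x : zf) : bool := znneg x && ~~ (Z.eqb x.1 Z0 && Z.eqb x.2 Z0).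

Arguments zadd : simpl never.
Arguments zopp : simpl never.
Arguments zsub : simpl never.
Arguments zmul : simpl never.
Arguments znneg : simpl never.
Arguments zpos : simpl never.

Definition ptadd (p q : zpt) : zpt := (zadd p.1 q.1, zadd p.2 q.2).
(** Twice the signed area of the triangle: positive when [x] is to the left of the line from [p] to
    [q]. *)
Definition zorient (p q x : zpt) : zf :=
  zsub (zmul (zsub q.1 p.1) (zsub x.2 p.2)) (zmul (zsub q.2 p.2) (zsub x.1 p.1)).

Arguments zorient : simpl never.

Definition edges (T : Type) (V : seq T) : seq (T * T) := zip V (rot 1 V).
Definition tri := (zpt * zpt * zpt)%type.
Definition fan_from (x : zpt) := fix fan (l : seq zpt) : seq tri :=
  if l is a :: l' then (if l' is b :: _ then (x, a, b) :: fan l' else [::]) else [::].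
Definition fan (V : seq zpt) : seq tri := if V is x :: l then fan_from x l else [::].

(** The triangle may touch the line without being flat on it; its interior is then strictly on the
    left. *)
Definition tri_side (P Q : zpt) (T : tri) : bool :=
  let: (A, B, C) := T in
  let a := zorient P Q A in let b := zorient P Q B in let c := zorient P Q C in
  [&& znneg a, znneg b, znneg c & zpos (zadd a (zadd b c))].
Definition cyclic_path (T : Type) (r : rel T) (V : seq T) : bool :=
  if V is x :: l then path r x (rcons l x) else false.
Definition tri_in (V : seq zpt) (T : tri) : bool :=
  cyclic_path (fun P Q => tri_side P Q T) V.
(** For convex polygons with disjoint interiors, it suffices to look for a separating line among the
    edges of the two. *)
Definition separated (V V' : seq zpt) : bool :=
  has (fun e => all (fun X => znneg (zorient e.2 e.1 X)) V') (edges V).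
Definition disjoint_polygons V V' := separated V V' || separated V' V.

Section Polygons.
Variable R : realType.
Local Notation f := (golden R).

Definition zev (x : zf) : R := (int_of_Z x.1)%:~R + (int_of_Z x.2)%:~R * f.
Arguments zev : simpl never.
Definition pev (p : zpt) : R * R := (zev p.1, zev p.2).

Definition orient (p q x : R * R) : R :=
  (q.1 - p.1) * (x.2 - p.2) - (q.2 - p.2) * (x.1 - p.1).

Lemma int_of_ZD a b : int_of_Z (Z.add a b) = int_of_Z a + int_of_Z b.
Proof. by lia. Qed.
Lemma int_of_ZB a b : int_of_Z (Z.sub a b) = int_of_Z a - int_of_Z b.
Proof. by lia. Qed.
Lemma int_of_ZN a : int_of_Z (Z.opp a) = - int_of_Z a.
Proof. by lia. Qed.
Lemma int_of_ZM a b : int_of_Z (Z.mul a b) = int_of_Z a * int_of_Z b.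
Proof. by lia. Qed.

Lemma zevD a b : zev (zadd a b) = zev a + zev b.
Proof. by rewrite /zev !int_of_ZD !rmorphD /=; ring. Qed.
Lemma zevB a b : zev (zsub a b) = zev a - zev b.
Proof. by rewrite /zev !int_of_ZB !rmorphB /=; ring. Qed.
Lemma zevN a : zev (zopp a) = - zev a.
Proof. by rewrite /zev !int_of_ZN !rmorphN /=; ring. Qed.
Lemma zevM a b : zev (zmul a b) = zev a * zev b.
Proof.
rewrite /zev !(int_of_ZD, int_of_ZM) !(rmorphD, rmorphM) /=.
by have h := golden_sqr R; ring: h.
Qed.

Lemma zev_inK a : inK (zev a).
Proof. by exists (int_of_Z a.1), (int_of_Z a.2). Qed.

Lemma pev_inK p : inK2 (pev p).
Proof. by split; apply: zev_inK. Qed.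

Lemma golden_norm (x y : R) : (x + y * f) * (x + y * (1 - f)) = x * (x + y) - y * y.
Proof. by have h := golden_sqr R; ring: h. Qed.

Lemma znneg_ge0 x : znneg x -> 0 <= zev x.
Proof.
case: x => a b; rewrite /znneg /zev /=; have bF := golden_bounds R.
have H1 (x : int) : 0 <= x -> 0 <= (x%:~R : R) by rewrite ler0z.
have H2 (x : int) : x <= 0 -> (x%:~R : R) <= 0 by rewrite lerz0.
have H3 (x y : int) : x <= y -> (x%:~R : R) <= y%:~R by rewrite ler_int.
case: ifP => ha; [case: ifP => hb|case: ifP => hb //] => hN.
- have h1 : 0 <= int_of_Z a by lia.
  have h2 : 0 <= int_of_Z b by lia.
  by have := H1 _ h1; have := H1 _ h2; nra.
- have h1 : 0 <= int_of_Z a by lia.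
  have h2 : int_of_Z b <= 0 by lia.
  have h3 : int_of_Z b * int_of_Z b <= int_of_Z a * (int_of_Z a + int_of_Z b) by nia.
  have := H1 _ h1; have := H2 _ h2; have := H3 _ _ h3.
  rewrite !(rmorphM, rmorphD) /=.
  move: ((int_of_Z a)%:~R : R) ((int_of_Z b)%:~R : R) => x y e1 e2 e3.
  (* [z] is the conjugate, whose sign is known because [1 - golden] is negative; the norm then gives
     the sign of the element itself. *)
  have [z ez] : exists z, z = x + y * (1 - f) by exists (x + y * (1 - f)).
have := golden_norm x y; rewrite -ez => e4.
  have z0 : 0 <= z by nra.
  move: z0; rewrite le_eqVlt => /predU1P[z0|z0]; last by nra.
  have x0 : x = 0 by nra.
  have y0 : y = 0 by nra.
  by rewrite x0 y0 mul0r addr0.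
have h1 : int_of_Z a <= 0 by lia.
have h2 : 0 <= int_of_Z b by lia.
have h3 : int_of_Z a * (int_of_Z a + int_of_Z b) <= int_of_Z b * int_of_Z b by nia.
have := H2 _ h1; have := H1 _ h2; have := H3 _ _ h3.
rewrite !(rmorphM, rmorphD) /=.
move: ((int_of_Z a)%:~R : R) ((int_of_Z b)%:~R : R) => x y e1 e2 e3.
have [z ez] : exists z, z = x + y * (1 - f) by exists (x + y * (1 - f)).
have := golden_norm x y; rewrite -ez => e4.
have z0 : z <= 0 by nra.
move: z0; rewrite le_eqVlt => /predU1P[z0|z0]; last by nra.
have x0 : x = 0 by nra.
have y0 : y = 0 by nra.
by rewrite x0 y0 mul0r addr0.
Qed.

Lemma zpos_gt0 x : zpos x -> 0 < zev x.
Proof.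
case/andP => h n0; rewrite lt_def znneg_ge0 // andbT; apply/eqP => e; case/negP: n0.
by have [h1 h2] := golden_free e; apply/andP; split; lia.
Qed.

Lemma zev_orient p q x : zev (zorient p q x) = orient (pev p) (pev q) (pev x).
Proof. by rewrite /zorient zevB !zevM !zevB. Qed.

Lemma orientC p q x : orient q p x = - orient p q x.
Proof. by rewrite /orient; ring. Qed.

Lemma orient_eq0 p q x : inK2 p -> inK2 q -> generic x -> orient p q x = 0 -> p = q.
Proof.
move=> [p1 p2] [q1 q2] gx e.
have [||||h1 h2] := gx (- (q.2 - p.2)) (q.1 - p.1) ((q.2 - p.2) * p.1 - (q.1 - p.1) * p.2).
- by apply: inKN; apply: inKB.
- by apply: inKB.
- by apply: inKB; apply: inKM => //; apply: inKB.
- by move: e; rewrite /orient => <-; ring.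
by case: p q h1 h2 {e gx p1 p2 q1 q2} => [a b] [c d] /= *; congr pair; lra.
Qed.

(** For a convex polygon listed counterclockwise, the points strictly to the left of every edge form
    the interior. *)
Definition in_poly (V : seq (R * R)) (p : R * R) : bool :=
  cyclic_path (fun u v => 0 < orient u v p) V.

Definition in_tri (T : tri) (p : R * R) : Prop :=
  let: (A, B, C) := T in [/\ 0 < orient (pev A) (pev B) p,
    0 < orient (pev B) (pev C) p & 0 < orient (pev C) (pev A) p].

(** The successive diagonals from [x] sort the point into one triangle; being generic, it lies on
    none of them. *)
Lemma fan_from_cover x a b l p : generic p ->
  0 < orient (pev x) (pev a) p -> 0 < orient (pev (last b l)) (pev x) p ->
  path (fun u v => 0 < orient (pev u) (pev v) p) a (b :: l) ->
  exists2 T, T \in fan_from x (a :: b :: l) & in_tri T p.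
Proof.
move=> gp; elim: l a b => [|c l IH] a b h1 h2.
  by move=> /= /andP[h3 _]; exists (x, a, b); rewrite ?mem_head.
move=> /andP[h3 h4]; case: (ltrgtP 0 (orient (pev b) (pev x) p)) => h5.
- by exists (x, a, b); rewrite ?mem_head.
- have [|T hT pT] := IH b c _ h2 h4; first by rewrite orientC; lra.
  by exists T => //; rewrite inE hT orbT.
- have bx := orient_eq0 (pev_inK _) (pev_inK _) gp (esym h5).
  by move: h3; rewrite bx orientC; lra.
Qed.

Lemma in_poly_path x l p : in_poly (map pev (x :: l)) p =
  path (fun u v => 0 < orient (pev u) (pev v) p) x (rcons l x).
Proof. by rewrite /in_poly /= -map_rcons path_map. Qed.

Lemma fan_cover V p : generic p -> in_poly (map pev V) p ->
  exists2 T, T \in fan V & in_tri T p.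
Proof.
move=> gp; case: V => [|x [|a [|b l]]] //; rewrite ?in_poly_path.
- by rewrite /= /orient !subrr !mul0r subrr ltxx.
- by rewrite /= andbT => /andP[]; rewrite orientC; lra.
rewrite -cats1 cat_path => /andP[/= /andP[h1 h2]]; rewrite andbT => h3.
by apply: fan_from_cover.
Qed.

(** Barycentric coordinates: the orientation with respect to a fixed line is affine, hence averaged
    with the weights of [p] in the triangle. *)
Lemma tri_combination A B C p (P Q : zpt) :
  (orient (pev A) (pev B) p + orient (pev B) (pev C) p + orient (pev C) (pev A) p)
    * orient (pev P) (pev Q) p =
  orient (pev B) (pev C) p * orient (pev P) (pev Q) (pev A) +
  orient (pev C) (pev A) p * orient (pev P) (pev Q) (pev B) +
  orient (pev A) (pev B) p * orient (pev P) (pev Q) (pev C).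
Proof.
move: (pev A) (pev B) (pev C) (pev P) (pev Q) => a b c d e.
by rewrite /orient; ring.
Qed.

Lemma tri_side_gt0 P Q T p : tri_side P Q T -> in_tri T p ->
  0 < orient (pev P) (pev Q) p.
Proof.
case: T => -[A B] C /and4P[/znneg_ge0 + /znneg_ge0 + /znneg_ge0 + /zpos_gt0 +] [].
rewrite !zevD !zev_orient; have := tri_combination A B C p P Q.
move: (orient _ _ (pev A)) (orient _ _ (pev B)) (orient _ _ (pev C)) => x y z.
move: (orient (pev P) _ _) (orient (pev A) _ _) (orient (pev B) _ _) (orient (pev C) _ _).
move=> l a b c e x0 y0 z0 s0 a0 b0 c0.
have h : 0 < (a + b + c) * l.
  rewrite e; have [x1|x1] := ltP 0 x; first by nra.
  have [y1|y1] := ltP 0 y; first by nra.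
  by have z1 : 0 < z; [lra|nra].
by rewrite -(pmulr_rgt0 _ (_ : 0 < a + b + c)) //; lra.
Qed.

Lemma tri_in_poly V T p : tri_in V T -> in_tri T p -> in_poly (map pev V) p.
Proof.
case: V => [|x l] //; rewrite in_poly_path => h pT.
by apply: sub_path h => P Q h; apply: tri_side_gt0 pT.
Qed.

(** A point of the second polygon is in a triangle of its fan, whose three vertices are on the wrong
    side of the separating edge. *)
Lemma separatedP V V' p : generic p -> separated V V' ->
  in_poly (map pev V) p -> in_poly (map pev V') p -> False.
Proof.
move=> gp /hasP[[P Q] /= PQ /allP hV'] pV /(fan_cover gp)[[[A B] C] hT pT].
have hPQ : 0 < orient (pev P) (pev Q) p.
  case: V PQ pV => [|x l] //; rewrite /edges rot1_cons in_poly_path.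
  suff H y : (P, Q) \in zip (y :: l) (rcons l x) ->
      path (fun u v => 0 < orient (pev u) (pev v) p) y (rcons l x) ->
      0 < orient (pev P) (pev Q) p by apply: H.
  elim: l y => [|z l IH] y /=; rewrite inE.
    by rewrite andbT => /eqP[-> ->].
  by move=> /predU1P[[-> ->] /andP[]//|h /andP[_]]; apply: IH.
have mem : [/\ A \in V', B \in V' & C \in V'].
  case: V' hT {hV' } => [|x l] //=.
  suff H m : (A, B, C) \in fan_from x m -> [/\ A = x, B \in m & C \in m].
    by move=> /H[-> h1 h2]; rewrite mem_head !inE h1 h2 !orbT.
  elim: m => [|y [|z m] IH] //=; rewrite inE => /predU1P[[-> -> ->]|].
    by rewrite !inE !eqxx orbT.
  by move=> /IH[-> h1 h2]; split=> //; rewrite inE ?h1 ?h2 orbT.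
have [hA hB hC] := mem; have := znneg_ge0 (hV' _ hC).
have := znneg_ge0 (hV' _ hB); have := znneg_ge0 (hV' _ hA).
case: pT; rewrite !zev_orient ![orient (pev Q) _ _]orientC.
have := tri_combination A B C p P Q; move: hPQ.
move: (orient _ _ (pev A)) (orient _ _ (pev B)) (orient _ _ (pev C)) => x y z.
move: (orient (pev P) _ _) (orient (pev A) _ _) (orient (pev B) _ _) (orient (pev C) _ _).
move=> l a b c l0 e a0 b0 c0; rewrite !oppr_ge0 => x0 y0 z0; have : 0 < (a + b + c) * l by nra.
by rewrite e; nra.
Qed.

Lemma disjoint_polygonsP V V' p : generic p -> disjoint_polygons V V' ->
  in_poly (map pev V) p -> in_poly (map pev V') p -> False.
Proof. by move=> gp /orP[h a b|h a b]; [exact: separatedP h a b|exact: separatedP h b a]. Qed.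

(* climbs from the segment [A, B] by moving one endpoint up at a time; each move
   sweeps a triangle contained in a tile *)
Fixpoint strip (ts : seq (seq zpt)) (A B : zpt) (l : seq (bool * zf * nat))
    (A' B' : zpt) : bool :=
  if l is (side, y, a) :: l' then
    if side then
      [&& zpos (zsub y B.2), tri_in (nth [::] ts a) (A, B, (B.1, y)) &
          strip ts A (B.1, y) l' A' B']
    else
      [&& zpos (zsub y A.2), tri_in (nth [::] ts a) (A, B, (A.1, y)) &
          strip ts (A.1, y) B l' A' B']
  else (A == A') && (B == B').

Lemma strip_cover ts A B l A' B' p : generic p -> strip ts A B l A' B' ->
  zev A.1 < p.1 -> p.1 < zev B.1 ->
  0 < orient (pev A) (pev B) p -> 0 < orient (pev B') (pev A') p ->
  exists2 a, (a < size ts)%N & in_poly (map pev (nth [::] ts a)) p.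
Proof.
move=> gp; elim: l A B => [|[[side y] a] l IH] A B /=.
  by move=> /andP[/eqP-> /eqP->] _ _; rewrite orientC; lra.
have in_tile T : tri_in (nth [::] ts a) T -> in_tri T p ->
    exists2 a, (a < size ts)%N & in_poly (map pev (nth [::] ts a)) p.
  move=> h pT; exists a; last exact: tri_in_poly h pT.
  by rewrite ltnNge; apply/negP => ha; move: h; rewrite nth_default.
case: side => /and3P[/zpos_gt0 y0 hT hs] hA hB h1 h2; rewrite zevB in y0.
(* Either the point is above the raised segment and is left to the remaining moves, or it is in the
   triangle just swept. *)
- case: (ltrgtP 0 (orient (pev A) (pev (B.1, y)) p)) => h3.
  + exact: (IH _ _ hs).
  + apply: (in_tile _ hT); split=> //; last by rewrite orientC; lra.
    by rewrite /orient /=; nra.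
  + have [e _] := orient_eq0 (pev_inK _) (pev_inK _) gp (esym h3).
    by rewrite e in hA; lra.
- case: (ltrgtP 0 (orient (pev (A.1, y)) (pev B) p)) => h3.
  + exact: (IH _ _ hs).
  + apply: (in_tile _ hT); split=> //; first by rewrite orientC; lra.
    by rewrite /orient /=; nra.
  + have [e _] := orient_eq0 (pev_inK _) (pev_inK _) gp (esym h3).
    by rewrite /= in e; rewrite e in hA; lra.
Qed.

Definition slab_ok ts (h x : zf) (b : zf * seq (bool * zf * nat)) : bool :=
  let o := (Z0, Z0) in strip ts (x, o) (b.1, o) b.2 (x, h) (b.1, h).

Fixpoint slabs_ok ts (h x x' : zf) (l : seq (zf * seq (bool * zf * nat))) : bool :=
  if l is b :: l' then slab_ok ts h x b && slabs_ok ts h b.1 x' l' else x == x'.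

Lemma slabs_cover ts h x x' l p : generic p -> slabs_ok ts h x x' l ->
  zev x < p.1 < zev x' -> 0 < p.2 < zev h ->
  exists2 a, (a < size ts)%N & in_poly (map pev (nth [::] ts a)) p.
Proof.
move=> gp; elim: l x => [|[y l] ls IH] x /=; first by move=> /eqP->; lra.
move=> /andP[/= h1 h2] /andP[xp px] /andP[p0 ph].
have z0 : zev (Z0, Z0) = 0 by rewrite /zev mul0r addr0.
case: (ltrgtP p.1 (zev y)) => [lt|gt|eq].
- have e (k : zf) : orient (pev (x, k)) (pev (y, k)) p = (zev y - zev x) * (p.2 - zev k).
    by rewrite /orient /=; ring.
  apply: (strip_cover gp h1) => //; rewrite ?e ?z0.
    by rewrite subr0 mulr_gt0 // subr_gt0 // (lt_trans xp).
  rewrite orientC e -mulrN mulr_gt0 //; last by lra.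
  by rewrite subr_gt0 (lt_trans xp).
- by apply: (IH _ h2) => //; rewrite ?gt ?p0.
- have [] : (1 : R) = 0 /\ (0 : R) = 0; last by move/eqP; rewrite oner_eq0.
  apply: (gp 1 0 (- zev y)); [exact: inK1|exact: inK0|exact/inKN/zev_inK|].
  by rewrite eq; ring.
Qed.

End Polygons.

(** * Interiors of polygons *)

Definition cyc (V : seq zpt) (i : nat) : zpt := nth (Z0, Z0, (Z0, Z0)) V (i %% size V).
(** The strict condition excludes flat corners and makes any three consecutive vertices an affine
    frame. *)
Definition convex_ok (V : seq zpt) : bool :=
  (0 < size V)%N && all (fun i =>
    all (fun X => znneg (zorient (cyc V i) (cyc V i.+1) X)) V &&
    zpos (zorient (cyc V i) (cyc V i.+1) (cyc V i.+2))) (iota 0 (size V)).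

Section PolygonInterior.
Variable R : realType.
Implicit Types (p q d : R * R) (V : seq (R * R)) (A E : set (R * R)).

(** Avoids the Jordan curve theorem: the complement of the boundary is split into two open sets, one
    of them bounded, and from every point of the other a ray goes to infinity without meeting the
    boundary. *)
Lemma polygon_interiorE V A E : open A -> open E ->
  (exists M, forall p, A p -> `|p| <= M) ->
  (forall p, A p -> ~ polygon_boundary V p) ->
  (forall p, [\/ A p, polygon_boundary V p | E p]) ->
  (forall p, A p -> ~ E p) ->
  (forall p, E p -> exists2 d, d != 0 &
     forall r : R, 0 <= r -> ~ polygon_boundary V (p + r *: d)) ->
  polygon_interior V = A.
Proof.
move=> oA oE [M hM] Abd cov AE ray; apply/seteqP; split=> p.
  move=> [nbd bC]; case: (cov p) => // Ep; exfalso.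
  have [d d0 hd] := ray p Ep.
  have inC (r : R) : 0 <= r -> connected_component (~` polygon_boundary V) p (p + r *: d).
    move=> r0; apply: (@connected_component_max _ _ ((fun x : R => p + x *: d) @` `[0, r]%classic)).
    - by exists 0; rewrite /= ?in_itv /= ?lexx // scale0r addr0.
    - by move=> _ [x + <-]; rewrite /= in_itv /= => /andP[x0 _]; apply: hd.
    - apply: connected_continuous_connected; first exact: segment_connected.
      apply: continuous_subspaceT => x; apply: cvgD; first exact: cvg_cst.
      by apply: cvgZr_tmp.
    - by exists r; rewrite //= in_itv /= r0 lexx.
  have [B [_ hB]] := bC.
  have nd : 0 < `|d| by rewrite normr_gt0.
  (* Far enough along the ray to leave the ball of radius [|B| + 1], supposed to contain the
     component. *)
  pose r := (`|p| + `|B| + 2) / `|d|.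
  have r0 : 0 <= r by rewrite divr_ge0 // ?addr_ge0.
  have h1 := hB (`|B| + 1) ltac:(by rewrite ltr_pwDr ?ler_norm) _ (inC r r0).
  have h2 : `|r *: d| <= `|p + r *: d| + `|p|.
    by rewrite -{1}(addKr p (r *: d)) (le_trans (ler_normD _ _)) // normrN addrC.
  have h3 : `|r *: d| = `|p| + `|B| + 2.
    by rewrite normrZ ger0_norm // /r divfK ?gt_eqF.
  by move: h1 h2; rewrite h3 /=; move: `|p + r *: d| => z; lra.
move=> Ap; split; first exact: Abd.
have sub : connected_component (~` polygon_boundary V) p `<=` A.
  set C := connected_component _ _.
  have Cbd : C `<=` ~` polygon_boundary V by apply: connected_component_sub.
  have Cp : C p by apply: connected_component_refl; apply: Abd.
  (* The part of the connected set [C] in [A] is open in [C], and also closed, since the rest of [C]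
     is in [E]. *)
  suff <- : C `&` A = C by apply: subIsetr.
  apply: (@component_connected _ (~` polygon_boundary V) p).
  - by exists p.
  - by exists A.
  - exists (~` E); first exact: open_closedC.
    apply/seteqP; split=> q [Cq h2]; split=> //; first exact: AE.
    by case: (cov q) => // /(Cbd _ Cq).
exists M; split; first exact: num_real.
by move=> x Mx q /sub/hM/le_trans; apply; apply: ltW.
Qed.

Lemma segment_orient a b c d p : segment a b p -> exists2 r : R, 0 <= r <= 1 &
  orient c d p = (1 - r) * orient c d a + r * orient c d b.
Proof.
move=> [r + <-]; rewrite /= in_itv /= => hr; exists r => //.
by rewrite /orient /= /GRing.scale /=; ring.
Qed.

Lemma boundaryP V p : polygon_boundary V p <-> exists2 i, (i < size V)%N &
  segment (nth 0 V i) (nth 0 V (i.+1 %% size V)) p.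
Proof. by split=> [[i /= hi h]|[i hi h]]; exists i. Qed.

Lemma open_affine (a b c : R) : open [set p : R * R | 0 < a * p.1 + b * p.2 + c].
Proof.
apply: (@open_comp _ _ (fun p : R * R => a * p.1 + b * p.2 + c) [set x | 0 < x]); last exact: open_gt.
move=> p _; apply: cvgD; last exact: cvg_cst.
by apply: cvgD; apply: cvgM; try exact: cvg_cst; [exact: cvg_fst|exact: cvg_snd].
Qed.

Lemma open_orient c d : open [set p : R * R | 0 < orient c d p].
Proof.
rewrite (_ : [set p | _] = [set p : R * R | 0 < - (d.2 - c.2) * p.1 + (d.1 - c.1) * p.2 +
  ((d.2 - c.2) * c.1 - (d.1 - c.1) * c.2)]); first exact: open_affine.
by apply/seteqP; split=> p /=; rewrite /orient => h; lra.
Qed.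

Section Convex.
Variable V : seq zpt.
Local Notation P i := (pev R (cyc V i)).
Local Notation n := (size V).

Lemma cyc_mod i : cyc V (i %% n) = cyc V i.
Proof. by rewrite /cyc modn_mod. Qed.

Lemma cyc_modS i : cyc V (i %% n).+1 = cyc V i.+1.
Proof. by rewrite /cyc -addn1 modnDml addn1. Qed.

Lemma in_polyP p : (0 < n)%N -> reflect (forall i, 0 < orient (P i) (P i.+1) p)
  (in_poly (map (pev R) V) p).
Proof.
move=> n0; have nthE i : (i < n)%N -> forall x0, nth x0 V i = cyc V i.
  by move=> hi x0; rewrite /cyc modn_small //; apply: set_nth_default.
have H : reflect (forall i, (i < n)%N -> 0 < orient (P i) (P i.+1) p)
    (in_poly (map (pev R) V) p).
  case E : V n0 nthE => [|x l] // _ nthE; rewrite in_poly_path.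
  have e1 i : (i < size (x :: l))%N -> nth x (x :: rcons l x) i = cyc (x :: l) i.
    by move=> hi; rewrite -(nthE _ hi x) -rcons_cons nth_rcons hi.
  have e2 i : (i < size (x :: l))%N -> nth x (rcons l x) i = cyc (x :: l) i.+1.
    rewrite /= ltnS leq_eqVlt => /predU1P[->|hi].
      by rewrite nth_rcons ltnn eqxx /cyc modnn.
    by rewrite nth_rcons hi -(nthE i.+1 hi x).
  apply: (iffP (pathP x)); rewrite size_rcons => h i hi; have := h i hi;
  by rewrite e1 // e2.
apply: (iffP H) => h i; last by [].
by have := h _ (ltn_pmod i n0); rewrite cyc_mod cyc_modS.
Qed.

Hypothesis cV : convex_ok V.

Lemma convex_size : (0 < n)%N.
Proof. by case/andP: cV. Qed.

Lemma convex_ge i j : 0 <= orient (P i) (P i.+1) (P j).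
Proof.
case/andP: cV => n0 /allP/(_ (i %% n)%N).
rewrite mem_iota ltn_pmod // => /(_ isT)/andP[/allP h _].
have := h (cyc V j); rewrite mem_nth ?ltn_pmod // => /(_ isT)/znneg_ge0-/(_ R).
by rewrite zev_orient cyc_mod cyc_modS.
Qed.

Lemma convex_gt i : 0 < orient (P i) (P i.+1) (P i.+2).
Proof.
case/andP: cV => n0 /allP/(_ (i %% n)%N).
rewrite mem_iota ltn_pmod // => /(_ isT)/andP[_ /zpos_gt0-/(_ R)].
rewrite zev_orient cyc_mod cyc_modS.
suff -> : cyc V (i %% n).+2 = cyc V i.+2 by [].
by rewrite /cyc -[(i %% n).+2%N]addn2 -[i.+2]addn2 modnDml.
Qed.

Lemma convex_boundary p : polygon_boundary (map (pev R) V) p <->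
  exists i, segment (P i) (P i.+1) p.
Proof.
have n0 := convex_size.
have nthE i : nth 0 (map (pev R) V) (i %% n) = P i.
  by rewrite (nth_map (Z0, Z0, (Z0, Z0))) ?ltn_pmod.
split=> [/boundaryP[i]|[i h]].
  rewrite size_map => hi; rewrite nthE -{1}(modn_small hi) nthE => h.
  by exists i.
apply/boundaryP; exists (i %% n)%N; rewrite size_map ?ltn_pmod //.
by rewrite !nthE cyc_modS.
Qed.

(** On the line of an edge, the two neighbouring edges bound the position of the point on either
    side. *)
Lemma convex_face p i : (forall i, 0 <= orient (P i) (P i.+1) p) ->
  orient (P i.+1) (P i.+2) p = 0 -> segment (P i.+1) (P i.+2) p.
Proof.
move=> h e; have h0 := h i; have h2 := h i.+2.
have g0 := convex_gt i; have g1 := convex_gt i.+1.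
move: (P i) (P i.+1) (P i.+2) (P i.+3) h0 h2 g0 g1 e {h} => a b c d h0 h2 g0 g1 e.
(* [r] is the position along the edge, obtained by expanding [p - b] on the edge vectors [c - b] and
   [b - a]. *)
pose D := orient a b c; pose r := orient a b p / D.
have D0 : D != 0 by rewrite gt_eqF.
have rD : r * D = orient a b p by rewrite /r divfK.
have E1 : p.1 = (1 - r) * b.1 + r * c.1.
  apply: (mulIf D0); have : D * (p.1 - b.1) =
    orient a b p * (c.1 - b.1) - orient b c p * (b.1 - a.1) by rewrite /D /orient; ring.
  by rewrite e -rD => h; rewrite -[p.1 * D]mulrC; lra.
have E2 : p.2 = (1 - r) * b.2 + r * c.2.
  apply: (mulIf D0); have : D * (p.2 - b.2) =
    orient a b p * (c.2 - b.2) - orient b c p * (b.2 - a.2) by rewrite /D /orient; ring.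
  by rewrite e -rD => h; rewrite -[p.2 * D]mulrC; lra.
have r0 : 0 <= r by rewrite divr_ge0 // ltW.
have r1 : r <= 1.
  have : orient c d p = (1 - r) * orient b c d by rewrite /orient E1 E2; ring.
  by move=> h; rewrite h in h2; nra.
exists r; first by rewrite /= in_itv /= r0 r1.
by rewrite [p]surjective_pairing E1 E2.
Qed.

Lemma norm_pair p (M : R) : `|p.1| <= M -> `|p.2| <= M -> `|p| <= M.
Proof. by move=> h1 h2; rewrite prod_normE ge_max h1 h2. Qed.

(** The point is a convex combination of the vertices. One inequality is weak because boundedness
    concerns all points, including those on the diagonals of a fan. *)
Lemma weak_tri_norm (a b c p : R * R) (M : R) : `|a| <= M -> `|b| <= M -> `|c| <= M ->
  0 <= orient a b p -> 0 < orient b c p -> 0 < orient c a p -> `|p| <= M.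
Proof.
move=> ha hb hc x0 y0 z0.
have s0 : 0 < orient a b p + orient b c p + orient c a p by lra.
have co (q : R * R) : `|q| <= M -> (`|q.1| <= M) /\ (`|q.2| <= M).
  by rewrite prod_normE ge_max => /andP[].
have bound (u v w l : R) : `|u| <= M -> `|v| <= M -> `|w| <= M ->
    (orient a b p + orient b c p + orient c a p) * l =
    orient b c p * u + orient c a p * v + orient a b p * w -> `|l| <= M.
  rewrite !ler_norml => /andP[u1 u2] /andP[v1 v2] /andP[w1 w2] e.
  move: (orient a b p) (orient b c p) (orient c a p) x0 y0 z0 s0 e => x y z *.
  by apply/andP; split; nra.
have [[a1 a2] [[b1 b2] [c1 c2]]] := (co _ ha, (co _ hb, co _ hc)).
by apply: norm_pair; [apply: (bound a.1 b.1 c.1)|apply: (bound a.2 b.2 c.2)] => //;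
  rewrite /orient; ring.
Qed.

End Convex.

Lemma weak_fan_norm (x a b : R * R) l p (M : R) : `|x| <= M -> `|a| <= M ->
  (forall q, q \in b :: l -> `|q| <= M) ->
  0 <= orient x a p -> 0 < orient (last b l) x p ->
  path (fun u v => 0 < orient u v p) a (b :: l) -> `|p| <= M.
Proof.
move=> hx; elim: l a b => [|c l IH] a b ha hl h1 h2.
  by move=> /= /andP[h3 _]; apply: (weak_tri_norm hx ha (hl b _)); rewrite ?mem_head.
move=> /andP[h3 h4]; have hb := hl b (mem_head _ _).
have [h5|h5] := ltP 0 (orient b x p); first exact: (weak_tri_norm hx ha hb).
apply: (IH b c) => //; first by move=> q hq; apply: hl; rewrite inE hq orbT.
by rewrite orientC; lra.
Qed.

Lemma in_poly_bounded (V : seq (R * R)) : exists M : R, forall p, in_poly V p -> `|p| <= M.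
Proof.
have [M hM] : exists M : R, forall q, q \in V -> `|q| <= M.
  elim: V => [|v V [M IH]]; first by exists 0.
  exists (Num.max `|v| M) => q; rewrite inE le_max => /predU1P[->|/IH->]; rewrite ?lexx //.
  by rewrite orbT.
exists M => p; rewrite /in_poly; case: V hM => [|x [|a [|b l]]] //= hM.
- by rewrite /orient !subrr !mul0r subrr ltxx.
- by rewrite andbT => /andP[]; rewrite orientC; lra.
move=> /and3P[h1 h2]; rewrite rcons_path => /andP[h3 h4].
apply: (@weak_fan_norm x a b l p M) => //=.
- by apply: hM; rewrite mem_head.
- by apply: hM; rewrite !inE eqxx orbT.
- by move=> q hq; apply: hM; rewrite !inE in hq *; rewrite hq !orbT.
- exact: ltW.
by rewrite h2.
Qed.

Lemma open_in_poly (V : seq (R * R)) : open [set p | in_poly V p].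
Proof.
rewrite /in_poly; case: V => [|x l] /=.
  by rewrite (_ : [set _ | _] = set0); [exact: open0|apply/seteqP; split].
move: (rcons l x) => m; elim: m x => [|y s IH] x.
  by rewrite (_ : [set _ | _] = setT); [exact: openT|apply/seteqP; split].
rewrite (_ : [set _ | _] = [set p | 0 < orient x y p] `&`
  [set p | path (fun u v => 0 < orient u v p) y s]); last first.
  by apply/seteqP; split=> p /= => [/andP[]|[h1 h2]] //; apply/andP.
by apply: openI => //; apply: open_orient.
Qed.

(** A point outside the closed polygon is strictly to the right of some edge; moving along the outer
    normal of this edge, it gets ever farther from the side where the polygon lies. *)
Lemma convex_interior (V : seq zpt) : convex_ok V ->
  polygon_interior (map (pev R) V) = [set p | in_poly (map (pev R) V) p].
Proof.
move=> cV; have n0 := convex_size cV.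
apply: (@polygon_interiorE _ _ [set p | exists i, orient (pev R (cyc V i)) (pev R (cyc V i.+1)) p < 0]).
- exact: open_in_poly.
- rewrite (_ : [set _ | _] = \bigcup_(i in [set: nat])
    [set p | 0 < orient (pev R (cyc V i.+1)) (pev R (cyc V i)) p]).
    by apply: bigcup_open => i _; apply: open_orient.
  by apply/seteqP; split=> p [i]; [move=> h|move=> _ h]; exists i => //=; move: h => /=;
    rewrite orientC; lra.
- exact: in_poly_bounded.
- move=> p /in_polyP h /(convex_boundary cV)[i].
  move=> /(segment_orient (pev R (cyc V i)) (pev R (cyc V i.+1)))[r _].
  have := h n0 i; rewrite /orient => h1; rewrite !subrr; lra.
- move=> p; have [h|/(in_polyP _ n0) h] := boolP (in_poly (map (pev R) V) p); first exact: Or31.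
  have [h'|h'] := pselect (exists i, orient (pev R (cyc V i)) (pev R (cyc V i.+1)) p < 0).
    exact: Or33.
  have ge i : 0 <= orient (pev R (cyc V i)) (pev R (cyc V i.+1)) p.
    by rewrite leNgt; apply/negP => lt; apply: h'; exists i.
  apply: Or32; apply/(convex_boundary cV).
  have [i hi] : exists i, orient (pev R (cyc V i)) (pev R (cyc V i.+1)) p = 0.
    apply: contrapT => ne; apply: h => i; rewrite lt_def ge andbT.
    by apply/eqP => e; apply: ne; exists i.
  (* One more turn around the polygon, so that the vertex before [i] has a natural index. *)
  exists (i + size V)%N.
  have e k : cyc V (k + size V) = cyc V k by rewrite /cyc modnDr.
  have := @convex_face V cV p (i + (size V).-1) ge.
  have -> : (i + (size V).-1).+1 = (i + size V)%N by rewrite -addnS prednK.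
  by apply; rewrite -addSn !e.
- by move=> p /in_polyP h [i]; have := h n0 i; lra.
move=> p [i hi].
pose P := pev R (cyc V i); pose Q := pev R (cyc V i.+1).
exists (Q.2 - P.2, - (Q.1 - P.1)).
  apply/eqP => -[e1 e2]; have := convex_gt cV i; rewrite /orient -/P -/Q e1.
  by move/eqP: e2; rewrite oppr_eq0 => /eqP ->; rewrite !mul0r subrr ltxx.
move=> r r0 /(convex_boundary cV)[j] /(segment_orient P Q)[x /andP[x0 x1]].
have := convex_ge cV i j; have := convex_ge cV i j.+1; rewrite -/P -/Q => h1 h2.
have : orient P Q (p + r *: (Q.2 - P.2, - (Q.1 - P.1))) =
    orient P Q p - r * ((Q.2 - P.2) ^+ 2 + (Q.1 - P.1) ^+ 2).
  by rewrite /orient /= /GRing.scale /=; ring.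
move=> -> e; have : 0 <= r * ((Q.2 - P.2) ^+ 2 + (Q.1 - P.1) ^+ 2).
  by rewrite mulr_ge0 // addr_ge0 ?sqr_ge0.
by move: hi; rewrite -/P -/Q => hi; nra.
Qed.

End PolygonInterior.

(** * The only polygon that is not convex: the hexagon of index 5 in the initial partition *)

Section Hexagon.
Variable R : realType.
Local Notation f := (golden R).

Local Arguments in_poly : simpl never.

Definition hexagon : seq (R * R) := [:: (0, f + 1); (f - 1, f + 2); (1, f + 3);
  (2 - f, f + 2); (2 - f, f + 3); (0, f + 2)].
(** The two edges at the reflex vertex [(2 - f, f + 2)] are prolonged until they meet the boundary
    again. The two convex quadrilaterals so obtained overlap, hence their open union is the whole
    interior, without any cut to fill in. *)
Definition hexagon_left : seq (R * R) :=
  [:: (0, f + 1); (2 - f, 2 * f); (2 - f, f + 3); (0, f + 2)].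
Definition hexagon_right : seq (R * R) :=
  [:: (0, f + 1); (f - 1, f + 2); (1, f + 3); (0, 3)].

(** Affine forms vanishing on the edges that are not vertical; the vertices are named a, b, c, d, e,
    g in order, [f] being the golden ratio. *)
Definition ab (p : R * R) : R := (f - 1) * (p.2 - f - 1) - p.1.
Definition bc (p : R * R) : R := (2 - f) * (p.2 - f - 2) - (p.1 - f + 1).
Definition cd (p : R * R) : R := (f - 1) * (f + 3 - p.2) + (p.1 - 1).
Definition eg (p : R * R) : R := (2 - f) * (f + 3 - p.2) + (p.1 - 2 + f).

Lemma in_left p : in_poly hexagon_left p =
  [&& 0 < p.1, p.1 < 2 - f, 0 < ab p & 0 < eg p].
Proof.
have hf := golden_sqr R; have bf := golden_bounds R.
have f1 : 0 < f - 1 by lra.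
have f3 : 0 < 3 - f by lra.
have e1 : orient (0, f + 1) (2 - f, 2 * f) p = (f - 1) * ab p.
  by rewrite /orient /ab /=; ring: hf.
have e2 : orient (2 - f, 2 * f) (2 - f, f + 3) p = (3 - f) * (2 - f - p.1).
  by rewrite /orient /=; ring.
have e3 : orient (2 - f, f + 3) (0, f + 2) p = eg p by rewrite /orient /eg /=; ring.
have e4 : orient (0, f + 2) (0, f + 1) p = p.1 by rewrite /orient /=; ring.
rewrite /in_poly /= e1 e2 e3 e4 (pmulr_rgt0 _ f1) (pmulr_rgt0 _ f3) (subr_gt0 p.1 (2 - f)).
by case: (0 < p.1); case: (p.1 < 2 - f); case: (0 < ab p); case: (0 < eg p).
Qed.

Lemma in_right p : in_poly hexagon_right p =
  [&& 0 < p.1, 0 < ab p, 0 < bc p & 0 < cd p].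
Proof.
have hf := golden_sqr R; have bf := golden_bounds R.
have f0 : 0 < f by lra.
have f2 : 0 < 2 - f by lra.
have e1 : orient (0, f + 1) (f - 1, f + 2) p = ab p by rewrite /orient /ab /=; ring.
have e2 : orient (f - 1, f + 2) (1, f + 3) p = bc p by rewrite /orient /bc /=; ring.
have e3 : orient (1, f + 3) (0, 3) p = f * cd p by rewrite /orient /cd /=; ring: hf.
have e4 : orient (0, 3) (0, f + 1) p = (2 - f) * p.1 by rewrite /orient /=; ring.
rewrite /in_poly /= e1 e2 e3 e4 (pmulr_rgt0 _ f0) (pmulr_rgt0 _ f2) andbT.
by case: (0 < p.1); case: (0 < ab p); case: (0 < bc p); case: (0 < cd p).
Qed.

Lemma hexagon_boundary p : polygon_boundary hexagon p <-> exists2 r : R, 0 <= r <= 1 &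
  [\/ p = (r * (f - 1), f + 1 + r), p = (f - 1 + r * (2 - f), f + 2 + r),
      p = (1 - r * (f - 1), f + 3 - r) | [\/ p = (2 - f, f + 2 + r),
      p = ((1 - r) * (2 - f), f + 3 - r) | p = (0, f + 2 - r)]].
Proof.
have seg (a b : R * R) r q : (1 - r) *: a + r *: b = q -> 0 <= r <= 1 -> segment a b q.
  by move=> <- hr; exists r; rewrite //= in_itv.
have bd : polygon_boundary hexagon p <-> exists2 ab, ab \in edges hexagon & segment ab.1 ab.2 p.
  split=> [/boundaryP[i hi h]|[[a b] /(nthP (0, 0))[i hi e] h]].
    exists (nth (0, 0) (edges hexagon) i); first by rewrite mem_nth.
    by move: i hi h => [|[|[|[|[|[|//]]]]]].
  apply/boundaryP; exists i; first by move: i hi {e} => [|[|[|[|[|[|//]]]]]].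
  by move: i hi e h => [|[|[|[|[|[|//]]]]]] _ [<- <-].
rewrite bd; split=> [[ab]|[r hr h]].
  rewrite /edges rot1_cons /= !inE => + [r]; rewrite /= in_itv /= => + hr <-.
  case/or4P => [/eqP->|/eqP->|/eqP->|/or3P[/eqP->|/eqP->|/eqP->]] /=; exists r => //;
  [apply: Or41|apply: Or42|apply: Or43|apply: Or44; apply: Or31|apply: Or44; apply: Or32
  |apply: Or44; apply: Or33];
  by rewrite [LHS]surjective_pairing /GRing.scale /= /GRing.scale /=; congr pair; ring.
pose H := ((0, f + 1), (f - 1, f + 2)) :: [:: ((f - 1, f + 2), (1, f + 3));
  ((1, f + 3), (2 - f, f + 2)); ((2 - f, f + 2), (2 - f, f + 3));
  ((2 - f, f + 3), (0, f + 2)); ((0, f + 2), (0, f + 1))].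
have -> : edges hexagon = H by [].
case: h => [->|->|->|[->|->|->]];
  [exists (nth (0, 0) H 0)|exists (nth (0, 0) H 1)|exists (nth (0, 0) H 2)
  |exists (nth (0, 0) H 3)|exists (nth (0, 0) H 4)|exists (nth (0, 0) H 5)];
  rewrite ?mem_nth //; apply: (seg _ _ r) => //;
  by rewrite [LHS]surjective_pairing /GRing.scale /= /GRing.scale /=; congr pair; ring.
Qed.

Lemma hexagon_interior : polygon_interior hexagon =
  [set p | in_poly hexagon_left p || in_poly hexagon_right p].
Proof.
have hf := golden_sqr R; have bf := golden_bounds R.
(* The ray follows [d], opposite to the gradient of [l], so that [l] stays negative on it. *)
have half (l : R * R -> R) (d : R * R) : d != 0 ->
    (forall p r, l (p + r *: d) = l p - r * (d.1 ^+ 2 + d.2 ^+ 2)) ->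
    (forall q, polygon_boundary hexagon q -> 0 <= l q) ->
    forall p, l p < 0 -> exists2 d, d != 0 &
      forall r : R, 0 <= r -> ~ polygon_boundary hexagon (p + r *: d).
  move=> d0 hl hbd p lp; exists d => // r r0 /hbd; rewrite hl.
  have : 0 <= r * (d.1 ^+ 2 + d.2 ^+ 2) by rewrite mulr_ge0 // addr_ge0 ?sqr_ge0.
  by lra.
(* The last piece is the sector at the reflex vertex, not cut off by a single edge; its points
   escape upwards. *)
pose E := [set p | ab p < 0] `|` [set p | bc p < 0] `|` [set p : R * R | p.1 < 0] `|`
  [set p | eg p < 0] `|` [set p | 2 - f < p.1 /\ cd p < 0].
have affine a b c (l : R * R -> R) : (forall p, l p = a * p.1 + b * p.2 + c) ->
    open [set p | l p < 0].
  move=> hl; rewrite (_ : [set p | _] =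
    [set p : R * R | 0 < (- a) * p.1 + (- b) * p.2 + (- c)]); first exact: open_affine.
  by apply/seteqP; split=> p /=; rewrite hl; lra.
have memE p : E p <-> [\/ ab p < 0, bc p < 0, p.1 < 0 | eg p < 0 \/ (2 - f < p.1 /\ cd p < 0)].
  split=> [[[[[h|h]|h]|h]|h]|[h|h|h|[h|h]]].
  - exact: Or41.
  - exact: Or42.
  - exact: Or43.
  - by apply: Or44; left.
  - by apply: Or44; right.
  - by left; left; left; left.
  - by left; left; left; right.
  - by left; left; right.
  - by left; right.
  - by right.
have bdE p : polygon_boundary hexagon p -> [/\ 0 <= ab p, 0 <= bc p, 0 <= p.1, 0 <= eg p &
    p.1 <= 2 - f \/ 0 <= cd p].
  move=> /hexagon_boundary[r /andP[r0 r1]].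
  have q1 : 0 <= r * (f - 1) by nra.
  have q2 : r * (f - 1) <= f - 1 by nra.
  have q3 : r * f * f = r * f + r by rewrite -mulrA hf; ring.
  case=> [->|->|->|[->|->|->]]; rewrite /ab /bc /cd /eg /=; split; try nra;
    try (by left; nra); by right; nra.
apply: (polygon_interiorE (E := E)).
- rewrite (_ : [set p | _] = [set p | in_poly hexagon_left p] `|`
    [set p | in_poly hexagon_right p]); first by apply: openU; apply: open_in_poly.
  by apply/seteqP; split=> p /= => [/orP|h]; [|apply/orP].
- apply: openU; [apply: openU; [apply: openU; [apply: openU|]|]|].
  + by apply: (affine (-1) (f - 1) (- (f - 1) * (f + 1))) => p; rewrite /ab; ring.
  + by apply: (affine (-1) (2 - f) (- (2 - f) * (f + 2) + f - 1)) => p; rewrite /bc; ring.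
  + by apply: (affine 1 0 0) => p; ring.
  + by apply: (affine 1 (- (2 - f)) ((2 - f) * (f + 3) - 2 + f)) => p; rewrite /eg; ring.
  + rewrite (_ : [set _ | _] = [set p : R * R | 2 - f - p.1 < 0] `&` [set p | cd p < 0]).
      apply: openI.
        by apply: (affine (-1) 0 (2 - f)) => p; ring.
      by apply: (affine 1 (- (f - 1)) ((f - 1) * (f + 3) - 1)) => p; rewrite /cd; ring.
    by apply/seteqP; split=> p /= [h1 h2]; split=> //; lra.
- have [M1 h1] := in_poly_bounded hexagon_left; have [M2 h2] := in_poly_bounded hexagon_right.
  exists (Num.max M1 M2) => p /orP[/h1|/h2] h; rewrite le_max h ?orbT //.
- move=> p; rewrite /= in_left in_right => h /hexagon_boundary[r /andP[r0 r1]].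
  have q1 : 0 <= r * (f - 1) by nra.
  have q2 : r * (f - 1) <= f - 1 by nra.
  have q3 : r * f * f = r * f + r by rewrite -mulrA hf; ring.
  by case/orP: h => /and4P[]; rewrite /ab /bc /cd /eg => k1 k2 k3 k4;
    case=> [e|e|e|[e|e|e]]; move: k1 k2 k3 k4; rewrite e /=; nra.
- move=> p; have [Ep|/memE nE] := pselect (E p); first exact: Or33.
  have [Ap|] := boolP (in_poly hexagon_left p || in_poly hexagon_right p); first exact: Or31.
  rewrite in_left in_right => nA; apply: Or32; apply/hexagon_boundary.
  have a0 : 0 <= ab p by rewrite leNgt; apply/negP => h; apply: nE; apply: Or41.
  have b0 : 0 <= bc p by rewrite leNgt; apply/negP => h; apply: nE; apply: Or42.
  have x0 : 0 <= p.1 by rewrite leNgt; apply/negP => h; apply: nE; apply: Or43.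
  have e0 : 0 <= eg p by rewrite leNgt; apply/negP => h; apply: nE; apply: Or44; left.
  have c0 : 2 - f < p.1 -> 0 <= cd p.
    by move=> h; rewrite leNgt; apply/negP => h'; apply: nE; apply: Or44; right.
  case: p a0 b0 x0 e0 c0 nA {nE} => x y; rewrite /ab /bc /eg /cd /= => a0 b0 x0 e0 c0.
  rewrite negb_or !negb_and -!leNgt => /andP[nl nr].
  move: x0; rewrite le_eqVlt => /predU1P[x0|x0].
    exists (f + 2 - y); first by apply/andP; split; nra.
    by apply: Or44; apply: Or33; congr pair; lra.
  rewrite [x <= 0]leNgt x0 /= in nl nr.
  move: a0; rewrite le_eqVlt => /predU1P[a0|a0].
    have yE : x = (y - (f + 1)) * (f - 1) by lra.
    exists (y - (f + 1)); first by apply/andP; split; nra.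
    by apply: Or41; congr pair; lra.
  rewrite (leNgt (_ - x)) a0 /= in nl nr.
  have u0 : 0 < 2 * f - 3 by lra.
  case: (ltrgtP x (2 - f)) nl => [xt|xt|xt] /= nl.
  - exists (f + 3 - y); first by apply/andP; split; nra.
    by apply: Or44; apply: Or32; congr pair; nra.
  - have {}c0 := c0 xt; case/orP: nr => h.
      have bcE : x = f - 1 + (y - f - 2) * (2 - f) by lra.
      have r0 : 0 <= (y - f - 2) * (2 * f - 3) by nra.
      have r1 : 0 <= (1 - (y - f - 2)) * (2 * f - 3) by nra.
      exists (y - f - 2); first by rewrite !pmulr_lge0 // in r0 r1; lra.
      by apply: Or42; congr pair; lra.
    have cdE : x = 1 - (f + 3 - y) * (f - 1) by lra.
    have r0 : 0 <= (f + 3 - y) * (2 * f - 3) by nra.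
    have r1 : 0 <= (1 - (f + 3 - y)) * (f - 1) by nra.
    have f1 : 0 < f - 1 by lra.
    exists (f + 3 - y); first by rewrite !pmulr_lge0 // in r0 r1; lra.
    by apply: Or43; congr pair; lra.
  - have f1 : 0 < f - 1 by lra.
    have f2 : 0 < 2 - f by lra.
    have y1 : 0 <= (f + 3 - y) * (2 - f) by rewrite xt in e0; lra.
    have y2 : 0 <= (y - f - 2) * (f - 1).
      case/orP: nr => h; last by rewrite xt in h; lra.
      by rewrite xt in h a0; nra.
    exists (y - f - 2); first by rewrite !pmulr_lge0 // in y1 y2; lra.
    by apply: Or44; apply: Or31; congr pair; lra.
- move=> p; rewrite /= in_left in_right => h /memE.
  case/orP: h => /and4P[]; rewrite /ab /bc /cd /eg => k1 k2 k3 k4;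
    by case=> [h|h|h|[h|[h1 h2]]]; nra.
- move=> p /memE[h|h|h|[h|[h1 h2]]].
  + apply: (half _ (1, - (f - 1))) h.
    * by apply/eqP => -[/eqP]; rewrite oner_eq0.
    * by move=> q r; rewrite /ab /GRing.scale /= /GRing.scale /=; ring.
    * by move=> q /bdE[].
  + apply: (half _ (1, - (2 - f))) h.
    * by apply/eqP => -[/eqP]; rewrite oner_eq0.
    * by move=> q r; rewrite /bc /GRing.scale /= /GRing.scale /=; ring.
    * by move=> q /bdE[].
  + apply: (half _ (-1, 0)) h.
    * by apply/eqP => -[/eqP]; rewrite oppr_eq0 oner_eq0.
    * by move=> q r; rewrite /GRing.scale /= /GRing.scale /=; ring.
    * by move=> q /bdE[].
  + apply: (half _ (-1, 2 - f)) h.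
    * by apply/eqP => -[/eqP]; rewrite oppr_eq0 oner_eq0.
    * by move=> q r; rewrite /eg /GRing.scale /= /GRing.scale /=; ring.
    * by move=> q /bdE[].
  + exists (0, 1); first by apply/eqP => -[/eqP]; rewrite oner_eq0.
    move=> r r0 /bdE[_ _ _ _]; rewrite /cd /GRing.scale /= /GRing.scale /= in h2 *.
    have : 0 <= r * (f - 1) by nra.
    by case; lra.
Qed.

End Hexagon.

(** * Towers over rectangles *)

Section Rectangular.
Variable R : realType.
Local Notation f := (golden R).
Implicit Types (p q : R * R) (a b : R).

Lemma rect_congr a b p q : congr_mod (rectangular a b) p q <->
  exists m n : int, q.1 = p.1 + m%:~R * a /\ q.2 = p.2 + n%:~R * b.
Proof.
have lat (m n : int) : (a, 0) *~ m + (0, b) *~ n = (a *~ m, b *~ n) :> R * R.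
  by rewrite !mulrz_pair [LHS]surjective_pairing /= !mul0rz addr0 add0r.
split=> [[m [n e]]|[m [n [e1 e2]]]]; exists m, n.
  rewrite lat in e; rewrite !mulrzl; have := congr1 fst e; have := congr1 snd e.
  by move=> /= <- <-; rewrite ![_ + (_ - _)]addrC !subrK.
rewrite lat [LHS]surjective_pairing /= e1 e2 !mulrzl.
by congr pair; rewrite addrC addKr.
Qed.

Lemma generic_neq1 p k : generic p -> inK k -> p.1 != k.
Proof.
move=> gp kk; apply/eqP => e; have [] := gp 1 0 (- k).
- exact: inK1.
- exact: inK0.
- exact: inKN.
- by rewrite e; ring.
by move/eqP; rewrite oner_eq0.
Qed.

Lemma generic_neq2 p k : generic p -> inK k -> p.2 != k.
Proof.
move=> gp kk; apply/eqP => e; have [] := gp 0 1 (- k).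
- exact: inK0.
- exact: inK1.
- exact: inKN.
- by rewrite e; ring.
by move=> _ /eqP; rewrite oner_eq0.
Qed.

Definition swap p : R * R := (p.2, p.1).

Lemma swapK : involutive swap.
Proof. by case. Qed.

Lemma generic_swap p : generic p -> generic (swap p).
Proof.
by move=> gp A B C kA kB kC e; have [] := gp B A C kB kA kC _; rewrite -?e //= [B * _ + _]addrC.
Qed.

Definition redz a (x : R) : R := x - (Num.floor (x / a))%:~R * a.

Lemma redz_itv a x : 0 < a -> 0 <= redz a x < a.
Proof.
move=> a0; have /andP[h1 h2] := floor_itv (x / a).
rewrite /redz subr_ge0 -ler_pdivlMr // h1 /= ltrBlDr.
by move: h2; rewrite ltr_pdivrMr // rmorphD /= mulrDl mul1r addrC.
Qed.

Lemma redzD a x (m : int) : a != 0 -> redz a (x + m%:~R * a) = redz a x.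
Proof.
move=> a0; rewrite /redz mulrDl mulfK // floorDrz ?intr_int // intrKfloor.
by rewrite rmorphD /=; ring.
Qed.

Lemma redz_id a x : 0 <= x < a -> redz a x = x.
Proof.
move=> /andP[x0 xa]; have a0 : 0 < a by apply: le_lt_trans xa.
rewrite /redz (_ : Num.floor _ = 0) ?mul0r ?subr0 //.
apply: floor_def; apply/andP; split; first by rewrite divr_ge0 // ltW.
by rewrite add0r ltr_pdivrMr // mul1r.
Qed.

Definition redr a b p : R * R := (redz a p.1, redz b p.2).

Lemma redr_congr a b p : congr_mod (rectangular a b) p (redr a b p).
Proof.
apply/rect_congr; exists (- Num.floor (p.1 / a)), (- Num.floor (p.2 / b)).
by rewrite !rmorphN /= !mulNr.
Qed.

Lemma redr_rectangle a b p : generic p -> inK a -> inK b -> 0 < a -> 0 < b ->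
  rectangle a b (redr a b p).
Proof.
move=> gp ka kb a0 b0; rewrite /rectangle /redr /=.
have /andP[h1 ->] := redz_itv p.1 a0; have /andP[h2 ->] := redz_itv p.2 b0.
rewrite !andbT !lt_def h1 h2 !andbT; split; rewrite subr_eq0.
  by apply: generic_neq1 => //; apply: inKM => //; apply: inK_int.
by apply: generic_neq2 => //; apply: inKM => //; apply: inK_int.
Qed.

Lemma redr_id a b p : rectangle a b p -> redr a b p = p.
Proof.
case: p => x y [/= /andP[x0 xa] /andP[y0 yb]].
by rewrite /redr /= !redz_id ?xa ?yb ?ltW.
Qed.

Lemma redr_eq a b p q : a != 0 -> b != 0 -> congr_mod (rectangular a b) p q ->
  redr a b p = redr a b q.
Proof. by move=> a0 b0 /rect_congr[m [n [e1 e2]]]; rewrite /redr e1 e2 !redzD. Qed.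

Lemma congr_swap a b p q : congr_mod (rectangular a b) p q ->
  congr_mod (rectangular b a) (swap p) (swap q).
Proof. by move=> /rect_congr[m [n [e1 e2]]]; apply/rect_congr; exists n, m. Qed.

Lemma rectangle_swap a b p : rectangle a b p -> rectangle b a (swap p).
Proof. by case. Qed.

Lemma swapD p q : swap (p + q) = swap p + swap q. Proof. by []. Qed.

Lemma swapMz p (m : int) : swap (p *~ m) = swap p *~ m.
Proof. by rewrite !mulrz_pair. Qed.

Lemma open_rectangle a b : open (rectangle a b : set (R * R)).
Proof.
rewrite (_ : rectangle a b = [set p | 0 < p.1] `&` [set p | p.1 < a] `&`
  ([set p | 0 < p.2] `&` [set p | p.2 < b])); last first.
  by apply/seteqP; split=> p; [case=> /andP[? ?] /andP[? ?]|case=> -[h1 h2] [h3 h4];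
    split; apply/andP].
have o1 (l : R * R -> R) : continuous l -> open [set p | 0 < l p].
  by move=> cl; apply: (@open_comp _ _ l [set x | 0 < x]) => //; exact: open_gt.
have o2 (l : R * R -> R) k : continuous l -> open [set p | l p < k].
  by move=> cl; apply: (@open_comp _ _ l [set x | x < k]) => //; exact: open_lt.
by apply: openI; apply: openI; [apply: o1|apply: o2|apply: o1|apply: o2] => p;
  [exact: cvg_fst|exact: cvg_fst|exact: cvg_snd|exact: cvg_snd].
Qed.

(** Vertical inductions are horizontal ones seen through the exchange of coordinates. *)
Lemma tower_swap a b a' b' va vb va' vb' w h c c' om :
  tower (rectangular a b) (rectangular a' b') va vb va' vb' (rectangle w h) c c' om ->
  tower (rectangular b a) (rectangular b' a') (swap va) (swap vb) (swap va') (swap vb')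
    (rectangle h w) (c \o swap) (c' \o swap) om.
Proof.
move=> T.
have cs x y p q : congr_mod (rectangular x y) (swap p) q ->
    congr_mod (rectangular y x) p (swap q) by move=> /congr_swap; rewrite swapK.
split.
- case: (tower_K T) => -[[a1 a2] [b1 b2]] [[a1' a2'] [b1' b2']] [[? ?] [? ?]] [[? ?] [? ?]].
  by split; split; split.
- by move=> p q /congr_swap h1; apply: (tower_per T).
- by move=> p q /congr_swap h1; apply: (tower_per' T).
- by move=> q gq Wq; apply: (tower_lt T); [apply: generic_swap|apply: rectangle_swap].
- move=> q k gq Wq hk /=; rewrite swapD swapMz swapK.
  by apply: (tower_word T) => //; [apply: generic_swap|apply: rectangle_swap].
- move=> q gq Wq; have [q' [W' e e']] := tower_ret T (generic_swap gq) (rectangle_swap Wq).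
  exists (swap q'); split; first exact: rectangle_swap.
    by apply: cs; rewrite swapD swapMz swapK.
  by apply: cs; rewrite swapD swapK.
- move=> q gq Wq; have [q' [W' e e']] := tower_side T (generic_swap gq) (rectangle_swap Wq).
  exists (swap q'); split; first exact: rectangle_swap.
    by apply: cs; rewrite swapD swapK.
  by apply: cs; rewrite swapD swapK.
- move=> q gq Wq; have [q' W' e] := tower_side_inv T (generic_swap gq) (rectangle_swap Wq).
  exists (swap q'); first exact: rectangle_swap.
  by apply: cs; rewrite swapD.
- move=> p gp; have [q Wq e] := tower_red T (generic_swap gp).
  by exists (swap q); [apply: rectangle_swap|apply: cs].
- move=> p gp; have [q [k [gq Wq hk e]]] := tower_cover T (generic_swap gp).
  exists (swap q), k; rewrite /= swapK; split=> //; first exact: generic_swap.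
    exact: rectangle_swap.
  by rewrite -swapMz -swapD; apply: cs.
Qed.

End Rectangular.
Arguments swap {R} p.

Section Towers.
Variable R : realType.
Local Notation f := (golden R).
Local Notation s := (f - 1).
Local Notation t := (2 - f).
Local Notation u := (2 * f - 3).
Implicit Types (p q : R * R) (c : R * R -> nat) (om : seq (seq nat)).

(** Towers have one or two floors: the window of width [w], and the points reached from it by a move
    of [sh] to the right. *)
Definition strip_code a w sh b om c p : nat :=
  let q := redr a b p in
  if q.1 < w then nth 0%N (nth [::] om (c q)) 0
  else nth 0%N (nth [::] om (c (q - (sh, 0)))) 1.

Let inKs : inK s. Proof. by apply: inKB; [exact: inKg|exact: inK1]. Qed.
Let inKt : inK t. Proof. by apply: inKB; [exact: inK_nat|exact: inKg]. Qed.
Let inKu : inK u.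
Proof. by apply: inKB; [apply: inKM; [exact: inK_nat|exact: inKg]|exact: inK_nat]. Qed.

(** The inductions have two consecutive return times; [C] tells the points with the shorter one. *)
Definition sizes (W : set (R * R)) (C : R * R -> bool) n om c := forall q, generic q -> W q ->
  (c q < size om)%N /\ size (nth [::] om (c q)) = if C q then n else n.+1.

Section Strip.
Variables (a w sh al b be : R) (om : seq (seq nat)) (c' : R * R -> nat) (C : R * R -> bool).
Hypotheses (a0 : 0 < a) (w0 : 0 < w) (wa : w < a) (sh0 : 0 < sh) (shw : a <= w + sh)
  (b0 : 0 < b) (sha : sh <= w).
Hypotheses (ka : inK a) (kw : inK w) (ks : inK sh) (kal : inK al) (kb : inK b) (kbe : inK be).
Hypothesis per' : forall p q, congr_mod (rectangular w b) p q -> c' p = c' q.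
Hypothesis sz : sizes (rectangle w b) C 1 om c'.
Hypothesis ret : forall q, generic q -> rectangle w b q -> if C q then
    exists x (m n : int), [/\ 0 < x < w, x = q.1 + sh + m%:~R * a & x = q.1 + al + n%:~R * w]
  else q.1 + sh < a /\
    exists x (m n : int), [/\ 0 < x < w, x = q.1 + sh + sh + m%:~R * a & x = q.1 + al + n%:~R * w].
Hypothesis far : forall q, generic q -> rectangle w b q -> w < q.1 + sh < a -> ~~ C q.
Hypothesis near : forall q, generic q -> rectangle w b q -> ~~ C q -> w < q.1 + sh.

Lemma tower_strip : tower (rectangular a b) (rectangular w b) (sh, 0) (0, be) (al, 0) (0, be)
  (rectangle w b) (strip_code a w sh b om c') c' om.
Proof.
have side q r : inK r -> generic q -> rectangle w b q -> exists q', [/\ rectangle w b q',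
    congr_mod (rectangular a b) (q + (0, r)) q' & congr_mod (rectangular w b) (q + (0, r)) q'].
  move=> kr gq [h1 h2]; exists (q.1, redz b (q.2 + r)).
  have gq' : generic (q + (0, r)) by apply: genericD => //; split => //; exact: inK0.
  have [_ h2'] := redr_rectangle gq' ka kb a0 b0.
  split=> //; apply/rect_congr; exists 0, (- Num.floor ((q.2 + r) / b));
    by rewrite /= rmorphN /= /redz mul0r !addr0 mulNr.
split.
- by split; split=> //; try exact: inK0; split=> //; exact: inK0.
- by move=> p q e; rewrite /strip_code (redr_eq _ _ e) // gt_eqF.
- exact: per'.
- by move=> q gq Wq; have [] := sz gq Wq.
- move=> q k gq Wq; have [_ szq] := sz gq Wq; rewrite szq.
  have [/andP[q0 qw] q2] := Wq.
  case: k => [|[|k]] hk.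
  + rewrite mulr0z addr0 /strip_code redr_id ?qw //.
    by split=> //; rewrite q0 (lt_trans qw).
  + have nC : ~~ C q by move: hk; case: ifP.
    have := ret gq Wq; rewrite (negPf nC) => -[h1 _].
    have h2 := near gq Wq nC.
    rewrite /strip_code redr_id; last first.
      by split; rewrite /= ?addr0 // h1 andbT; lra.
    by rewrite mulr1z /= ltNge (ltW h2) /= addrK.
  + by move: hk; case: ifP.
- move=> q gq Wq; have [_ ->] := sz gq Wq; have := ret gq Wq.
  case: ifP => _ [].
  + move=> x [m [n [hx e1 e2]]]; exists (x, q.2); rewrite mulr1z; split.
    * by split=> //; case: Wq.
    * by apply/rect_congr; exists m, 0; rewrite mul0r /= !addr0.
    * by apply/rect_congr; exists n, 0; rewrite mul0r /= !addr0.
  + move=> _ [x [m [n [hx e1 e2]]]]; exists (x, q.2); split.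
    * by split=> //; case: Wq.
    * have -> : (sh, 0) *~ 2%:Z = (sh + sh, 0) :> R * R by rewrite mulrz_pair /= mul0rz.
      by apply/rect_congr; exists m, 0; rewrite mul0r /= !addr0 addrA.
    * by apply/rect_congr; exists n, 0; rewrite mul0r /= !addr0.
- by move=> q gq Wq; apply: side.
- move=> q gq Wq; have [q' [W' e _]] := side q (- be) (inKN kbe) gq Wq; exists q' => //.
  by rewrite (_ : q - (0, be) = q + (0, - be)) // [LHS]surjective_pairing /= oppr0.
- by move=> p gp; exists (redr w b p); [exact: redr_rectangle|exact: redr_congr].
- move=> p gp; pose q := redr a b p; have pq := redr_congr a b p.
  have gq : generic q.
    by apply: generic_congr pq gp; split => //; exact: inK0.
  have [/andP[q0 qa] q2] := redr_rectangle gp ka kb a0 b0.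
  have [lt|gt|eq] := ltgtP q.1 w.
  + have Wq : rectangle w b q by split=> //; rewrite q0.
    exists q, 0%N; rewrite mulr0z addr0; split=> //.
    by have [_ ->] := sz gq Wq; case: ifP.
  + pose q' := q - (sh, 0).
    have gq' : generic q' by apply: genericD => //; apply: inK2N; split=> //; exact: inK0.
    have Wq' : rectangle w b q'.
      have e1 : q'.1 = q.1 - sh by [].
      have e2 : q'.2 = q.2 by rewrite -[RHS]subr0.
      split; rewrite ?e1 ?e2; last exact: q2.
      move: gt qa; rewrite -/q; move: (q.1) => x gt qa; apply/andP; split.
        by rewrite subr_gt0 (le_lt_trans sha).
      by rewrite ltrBlDr (lt_le_trans qa).
    have nC : ~~ C q'.
      by apply: far => //; have -> : q'.1 + sh = q.1; [exact: subrK|rewrite gt].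
    exists q', 1%N; split=> //; first by have [_ ->] := sz gq' Wq'; rewrite (negPf nC).
    by rewrite mulr1z subrK.
  + by have := generic_neq1 gq kw; rewrite eq eqxx.
Qed.

End Strip.

(** From [x] in the window of length [s], either [x + t] is already back, or [x + 2 t - 1 = x - u]
    is; since [x + t = x - u + s], both are the rotation by [- u] modulo [s]. *)
Lemma tower_golden b be om c' : 0 < b -> inK b -> inK be ->
  (forall p q, congr_mod (rectangular s b) p q -> c' p = c' q) ->
  sizes (rectangle s b) (fun q => q.1 < u) 1 om c' ->
  tower (rectangular 1 b) (rectangular s b) (t, 0) (0, be) (- u, 0) (0, be)
    (rectangle s b) (strip_code 1 s t b om c') c' om.
Proof.
move=> b0 kb kbe per' sz; have bf := golden_bounds R.
apply: (tower_strip (C := fun q => q.1 < u)) => //; try lra.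
- exact: inK1.
- exact: inKN.
- move=> q gq [/andP[q0 q1] _]; case: ifP => [lt|/negbT]; last rewrite -leNgt le_eqVlt.
    by exists (q.1 + t), 0, 1; rewrite mul0r mul1r; split; lra.
  rewrite eq_sym (negPf (generic_neq1 gq inKu)) /= => gt.
  split; first by lra.
  by exists (q.1 - u), (-1), 0; rewrite mulN1r mul0r; split; lra.
- by move=> q gq _ /andP[h1 h2]; rewrite -leNgt; lra.
- move=> q gq _; rewrite -leNgt le_eqVlt eq_sym (negPf (generic_neq1 gq inKu)) /=; lra.
Qed.

(** Either [x + 1 - f = x - s] or [x + 2 - f = x + t] is back in the unit window, and both agree
    modulo 1 because [s + t = 1]. *)
Lemma tower_kappa om c' :
  (forall p q, congr_mod (rectangular 1 1) p q -> c' p = c' q) ->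
  sizes (rectangle 1 1) (fun q => s < q.1) 1 om c' ->
  tower (rectangular f 1) (rectangular 1 1) (1, 0) (0, t) (t, 0) (0, t)
    (rectangle 1 1) (strip_code f 1 1 1 om c') c' om.
Proof.
move=> per' sz; have bf := golden_bounds R.
apply: (tower_strip (C := fun q => s < q.1)) => //; try lra; try exact: inK1.
- exact: inKg.
- move=> q gq [/andP[q0 q1] _]; case: ifP => [lt|/negbT]; last rewrite -leNgt le_eqVlt.
    by exists (q.1 - s), (-1), (-1); rewrite !mulN1r; split; lra.
  rewrite (negPf (generic_neq1 gq inKs)) /= => gt.
  split; first by lra.
  by exists (q.1 + t), (-1), 0; rewrite mulN1r mul0r; split; lra.
- by move=> q gq _ /andP[h1 h2]; rewrite -leNgt; lra.
- by move=> q gq [/andP[h1 h2] _] _; lra.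
Qed.

End Towers.

Section Skew.
Variable R : realType.
Local Notation f := (golden R).
Local Notation s := (f - 1).
Local Notation t := (2 - f).
Local Notation h := (f + 3).
Variables (om : seq (seq nat)) (c' : R * R -> nat).

Definition skew_red (p : R * R) : R * R :=
  let m := (Num.floor (p.2 / h))%:~R in (redz f (p.1 - m), p.2 - m * h).

(** The fundamental domain is sliced into floors of height 1; the integer part of the ordinate is
    the rank in the word of the base point. *)
Definition skew_code (p : R * R) : nat :=
  let q := skew_red p in let k := absz (Num.floor q.2) in
  nth 0%N (nth [::] om (c' (q - (0, k%:R)))) k.

Lemma skew_congr p q : congr_mod (Gamma0 R) p q <->
  exists m n : int, q.1 = p.1 + m%:~R * f + n%:~R /\ q.2 = p.2 + n%:~R * h.
Proof.
have lat (m n : int) : (Gamma0 R).1 *~ m + (Gamma0 R).2 *~ n =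
    (m%:~R * f + n%:~R, n%:~R * h) :> R * R.
  by rewrite !mulrz_pair [LHS]surjective_pairing /= mul0rz add0r !mulrzl.
split=> [[m [n e]]|[m [n [e1 e2]]]]; exists m, n.
  rewrite lat in e; have := congr1 fst e; have := congr1 snd e.
  by move=> /= <-; rewrite -addrA => <-; rewrite ![_ + (_ - _)]addrC !subrK.
rewrite lat [LHS]surjective_pairing /= e1 e2.
by congr pair; ring.
Qed.

Lemma skew_red_congr p : congr_mod (Gamma0 R) p (skew_red p).
Proof.
apply/skew_congr; pose m := Num.floor (p.2 / h).
exists (- Num.floor ((p.1 - m%:~R) / f)), (- m).
by rewrite /skew_red /redz /= -/m !rmorphN /=; split; ring.
Qed.

Let f0 : 0 < f. Proof. by have := golden_bounds R; lra. Qed.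
Let h0 : 0 < h. Proof. by have := golden_bounds R; lra. Qed.
Let inKh : inK h. Proof. by apply: inKD; [exact: inKg|exact: inK_nat]. Qed.
Let kG1 : inK2 (Gamma0 R).1. Proof. by split; [exact: inKg|exact: inK0]. Qed.
Let kG2 : inK2 (Gamma0 R).2. Proof. by split; [exact: inK1|exact: inKh]. Qed.

Lemma skew_red_rectangle p : generic p -> rectangle f h (skew_red p).
Proof.
move=> gp; have gq := generic_congr kG1 kG2 (skew_red_congr p) gp.
have /andP[h1 h2] := redz_itv (p.1 - (Num.floor (p.2 / h))%:~R) f0.
have /andP[h3 h4] := redz_itv p.2 h0.
split; apply/andP; split=> //; rewrite lt_def.
  by rewrite h1 andbT; apply: (generic_neq1 gq); exact: inK0.
by rewrite h3 andbT; apply: (generic_neq2 gq); exact: inK0.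
Qed.

Lemma skew_red_id p : rectangle f h p -> skew_red p = p.
Proof.
move=> [/andP[x0 xf] /andP[y0 yh]]; rewrite /skew_red.
have -> : Num.floor (p.2 / h) = 0.
  apply: floor_def; apply/andP; split; first by rewrite divr_ge0 // ltW.
  by rewrite add0r ltr_pdivrMr // mul1r.
rewrite mul0r !subr0 redz_id ?xf ?ltW //.
by rewrite -surjective_pairing.
Qed.

Lemma skew_red_eq p q : congr_mod (Gamma0 R) p q -> skew_red p = skew_red q.
Proof.
move=> /skew_congr[m [n [e1 e2]]]; rewrite /skew_red e1 e2.
have -> : Num.floor ((p.2 + n%:~R * h) / h) = Num.floor (p.2 / h) + n.
  by rewrite mulrDl mulfK ?gt_eqF // floorDrz ?intr_int // intrKfloor.
rewrite rmorphD /=; congr pair; last by ring.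
rewrite (_ : p.1 + m%:~R * f + n%:~R - _ = p.1 - (Num.floor (p.2 / h))%:~R + m%:~R * f).
  by rewrite redzD // gt_eqF.
by ring.
Qed.

Hypothesis per' : forall p q, congr_mod (rectangular f 1) p q -> c' p = c' q.
Hypothesis sz : sizes (rectangle f 1) (fun q => s < q.2) 4 om c'.

Lemma skew_levels (q : R * R) (k : nat) : 0 < q.2 < 1 -> Num.floor (q.2 + k%:R) = k.
Proof.
move=> /andP[q0 q1]; apply: floor_def.
rewrite -[(k : int)%:~R]/(k%:R) (_ : (k%:Z + 1)%:~R = k%:R + 1 :> R); last by rewrite rmorphD.
by apply/andP; split; lra.
Qed.

(** The height [f + 3] equals [4 + s], whence 4 floors over the points higher than [s] and 5 over
    the others. Coming back subtracts the oblique generator [(1, f + 3)]; a move by -1 is a move by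
    [s] modulo [f], and the ordinate moves by [- s] or [t]: the induced translation is [(s, t)]. *)
Lemma tower_skew : tower (Gamma0 R) (rectangular f 1) (0, 1) (1, 0) (s, t) (1, 0)
  (rectangle f 1) skew_code c' om.
Proof.
have bf := golden_bounds R.
have k1 : inK (1 : R) by exact: inK1.
have k0 : inK (0 : R) by exact: inK0.
have kf : inK f by exact: inKg.
have ks : inK s by apply: inKB.
have kt : inK t by apply: inKB => //; exact: inK_nat.
have side q r : inK r -> generic q -> rectangle f 1 q -> exists q', [/\ rectangle f 1 q',
    congr_mod (Gamma0 R) (q + (r, 0)) q' & congr_mod (rectangular f 1) (q + (r, 0)) q'].
  move=> kr gq [h1 h2]; exists (redz f (q.1 + r), q.2).
  have gq' : generic (q + (r, 0)) by apply: genericD.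
  have [h1' _] := redr_rectangle gq' kf k1 f0 ltr01.
  split=> //; [apply/skew_congr|apply/rect_congr];
    exists (- Num.floor ((q.1 + r) / f)), 0;
    by rewrite /= rmorphN /= /redz !mul0r !addr0 mulNr.
have va (k : nat) : (0, 1) *~ k = (0, k%:R) :> R * R.
  by rewrite mulrz_pair /= mul0rz.
have n2s q : generic q -> q.2 <= s -> q.2 < s.
  by move=> gq; rewrite le_eqVlt (negPf (generic_neq2 gq ks)).
split.
- by split; split.
- by move=> p q e; rewrite /skew_code (skew_red_eq e).
- exact: per'.
- by move=> q gq Wq; have [] := sz gq Wq.
- move=> q k gq Wq; have [_ szq] := sz gq Wq; rewrite szq => hk.
  have [q1 q2] := Wq; have /andP[q20 q21] := q2.
  have Dq : rectangle f h (q + (0, k%:R)).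
    split; rewrite /= ?addr0 //; apply/andP; split; first by rewrite ltr_pwDl ?ler0n.
    move: hk; case: ifP => [_ hk|/negbT].
      have : (k%:R <= 3%:R :> R) by rewrite ler_nat.
      by lra.
    rewrite -leNgt => /(n2s q gq) q2s hk; have : (k%:R <= 4%:R :> R) by rewrite ler_nat.
    by lra.
  by rewrite va /skew_code skew_red_id //= skew_levels //= addrK.
- move=> q gq Wq; have [_ ->] := sz gq Wq; have [q1 /andP[q20 q21]] := Wq.
  have gq' : generic (q + (s, 0)) by apply: genericD.
  have [h1' _] := redr_rectangle gq' kf k1 f0 ltr01.
  pose m := Num.floor ((q.1 + s) / f).
  case: ifP => [lt|/negbT]; [|rewrite -leNgt => /(n2s q gq) lt].
  + exists (redz f (q.1 + s), q.2 - s); rewrite va; split.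
    * by split=> //=; apply/andP; split; lra.
    * apply/skew_congr; exists (1 - m), (-1).
      by rewrite rmorphB rmorphN /= /redz /=; split; ring.
    * apply/rect_congr; exists (- m), (-1).
      by rewrite !rmorphN /= /redz /=; split; ring.
  + exists (redz f (q.1 + s), q.2 + t); rewrite va; split.
    * by split=> //=; apply/andP; split; lra.
    * apply/skew_congr; exists (1 - m), (-1).
      by rewrite rmorphB rmorphN /= /redz /=; split; ring.
    * apply/rect_congr; exists (- m), 0.
      by rewrite !rmorphN /= /redz /=; split; ring.
- by move=> q gq Wq; apply: side.
- move=> q gq Wq; have [q' [W' e _]] := side q (- 1) (inKN k1) gq Wq; exists q' => //.
  by rewrite (_ : q - (1, 0) = q + (- 1, 0)) // [LHS]surjective_pairing /= oppr0.
- by move=> p gp; exists (redr f 1 p); [exact: redr_rectangle|exact: redr_congr].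
- move=> p gp; have pq := skew_red_congr p; have [q1 /andP[q0 qh]] := skew_red_rectangle gp.
  move: (skew_red p) pq q1 q0 qh => q pq q1 q0 qh.
  have gq : generic q := generic_congr kG1 kG2 pq gp.
  pose k := absz (Num.floor q.2).
  have /andP[kl ku] := floor_itv q.2.
  have k_ge0 : 0 <= Num.floor q.2 by rewrite floor_ge0 ltW.
  have kE : (Num.floor q.2)%:~R = k%:R :> R.
    by rewrite -[in LHS](gez0_abs k_ge0).
  rewrite rmorphD /= kE in ku; rewrite kE in kl.
  pose q' := q - (0, k%:R).
  have gq' : generic q'.
    by apply: genericD => //; apply: inK2N; split=> //; exact: inK_nat.
  have kl' : k%:R < q.2 by rewrite lt_def kl andbT; apply: (generic_neq2 gq); exact: inK_nat.
  have Wq' : rectangle f 1 q'.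
    split; first by rewrite /q' /= subr0.
    by rewrite /q' /= subr_gt0 kl' ltrBlDr addrC.
  exists q', k; rewrite va subrK; split=> //.
  have [_ ->] := sz gq' Wq'.
  have k4 : (k < 5)%N.
    by rewrite -(ltr_nat R); lra.
  case: ifP => // lt; rewrite ltn_neqAle -ltnS k4 andbT.
  apply/eqP => e; move: lt; rewrite /q' /= e; lra.
Qed.

End Skew.

(** * The triangulated atoms *)

Section Data.
Local Open Scope Z_scope.
Local Notation o := ((0, 0) : zf).
Local Notation i := ((1, 0) : zf).
Local Notation g := ((0, 1) : zf).
Local Notation s := ((-1, 1) : zf).
Local Notation t := ((2, -1) : zf).
Local Notation u := ((-3, 2) : zf).
Local Notation t2 := ((4, -2) : zf).
Local Notation v := ((5, -3) : zf).

Definition tiles : seq (seq zpt) := [::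
  [:: (s, s); (t2, s); (s, t2)];
  [:: (t2, s); (i, s); (i, i); (s, i); (s, t2)];
  [:: (u, s); (t, s); (o, i)];
  [:: (o, s); (u, s); (o, i)];
  [:: (s, s); (s, t2); (t, i)];
  [:: (s, t2); (s, i); (t, i)];
  [:: (t, s); (t, i); (o, i)];
  [:: (t, s); (s, s); (t, i)];
  [:: (s, o); (i, o); (s, t)];
  [:: (i, o); (i, t); (t2, s); (s, s)];
  [:: (i, t); (i, s); (t2, s)];
  [:: (s, t); (i, o); (s, s)];
  [:: (t, t); (t, s); (u, s)];
  [:: (s, o); (s, t); (t, s); (t, t)];
  [:: (t, o); (t, t); (u, s); (o, s)];
  [:: (t, o); (s, o); (t, t)];
  [:: (o, o); (t, o); (o, t)];
  [:: (t, o); (o, s); (o, t)];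
  [:: (s, t); (s, s); (t, s)]].

(** An exact copy of [polygons0], in which the hexagon is replaced by its two convex
    quadrilaterals. *)
Definition pieces0 : seq (seq (seq zpt)) := [::
  [:: [:: (o, o); (s, o); (s, i)];
      [:: (s, o); (i, o); (i, i)];
      [:: (i, o); (g, o); (g, i)]];
  [:: [:: (o, o); (s, i); (o, i)];
      [:: (s, o); (i, i); (s, i)];
      [:: (i, o); (g, i); (i, i)]];
  [:: [:: (o, (2, 0)); (s, (2, 1)); (o, (1, 1))]];
  [:: [:: (i, i); (g, (2, 0)); (g, (2, 1)); (i, (2, 0))]];
  [:: [:: (o, (2, 0)); (i, (2, 1)); (i, (3, 1))]];
  [:: [:: (o, (1, 1)); (t, (0, 2)); (t, (3, 1)); (o, (2, 1))];
      [:: (o, (1, 1)); (s, (2, 1)); (i, (3, 1)); (o, (3, 0))]];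
  [:: [:: (o, (2, 1)); (t, (3, 1)); (o, (3, 1))];
      [:: (t, (2, 1)); (i, (3, 1)); (t, (3, 1))];
      [:: (i, (2, 1)); (g, (3, 1)); (i, (3, 1))]];
  [:: [:: (o, i); (i, (2, 1)); (o, (2, 0))];
      [:: (i, (1, 1)); (g, (2, 1)); (g, (3, 1)); (i, (2, 1))]];
  [:: [:: (s, i); (g, (2, 1)); (s, (2, 0))]];
  [:: [:: (o, i); (s, i); (s, (2, 0))];
      [:: (s, i); (i, i); (i, (2, 0))];
      [:: (i, i); (g, i); (g, (2, 0))]];
  [:: [:: (o, i); (i, (1, 1)); (i, (2, 1))]]].

(** A certificate that the tiles cover the unit square: vertical slabs between consecutive abscissas
    of vertices, each with the moves of a segment climbing across it and the tiles that contain the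
    swept triangles. *)
Definition slabs : seq (zf * seq (bool * zf * nat)) := [::
  (u, [:: (true, v, 16%N); (false, t, 16%N); (true, u, 17%N); (false, s, 17%N); (true,
   s, 14%N); (false, i, 3%N); (true, t2, 2%N); (true, i, 6%N)]);
  (t, [:: (false, v, 16%N); (false, u, 17%N); (true, t, 14%N); (false, s, 14%N);
   (true, s, 12%N); (false, t2, 2%N); (true, i, 6%N); (false, i, 6%N)]);
  (s, [:: (false, t, 15%N); (true, t, 13%N); (false, s, 13%N); (true, s, 18%N);
   (false, i, 7%N); (true, t2, 4%N); (true, i, 5%N)]);
  (t2, [:: (true, u, 8%N); (false, t, 8%N); (true, t, 11%N); (false, s, 11%N); (true,
   s, 9%N); (false, t2, 0%N); (true, i, 1%N); (false, i, 1%N)]);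
  (i, [:: (false, u, 8%N); (false, t, 11%N); (true, t, 9%N); (false, s, 9%N); (true,
   s, 10%N); (true, i, 1%N); (false, i, 1%N)])].

Definition zs : zf := s.
Definition zt : zf := t.
Definition zu : zf := u.
Definition z1 : zf := i.
Definition zg : zf := g.
Definition z0 : zf := o.
Definition zh : zf := (3, 1).
End Data.

Definition tri_map (h : zpt -> zpt) (T : tri) : tri := let: (A, B, C) := T in (h A, h B, h C).
(** For maps reversing orientation: two vertices are exchanged to keep the triangle
    counterclockwise. *)
Definition tri_flip (h : zpt -> zpt) (T : tri) : tri := let: (A, B, C) := T in (h A, h C, h B).
Definition cell := (nat * tri)%type.
(** Inverse of [x -> 1 - golden * x] on the abscissa, [zs] being the inverse of [golden]. *)
Definition pt_mirror (p : zpt) : zpt := (zmul zs (zsub z1 p.1), p.2).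
(** Up to an integer translation, the inverse of the rescaling by [- golden]. *)
Definition pt_reflect (p : zpt) : zpt := (zmul zs (zsub z1 p.1), zmul zs (zsub z1 p.2)).
Definition pt_swap (p : zpt) : zpt := (p.2, p.1).
Fixpoint extend (v : zpt) (w : seq nat) (T : tri) : seq cell :=
  if w is a :: w' then (a, T) :: extend v w' (tri_map (ptadd v) T) else [::].
Definition extend_cells v (om : seq (seq nat)) (l : seq cell) : seq cell :=
  flatten [seq extend v (nth [::] om c.1) c.2 | c <- l].
Definition swap_cells (l : seq cell) : seq cell := [seq (c.1, tri_flip pt_swap c.2) | c <- l].
(** The line through [P] and [Q] separates the two return times; no triangle may straddle it. *)
Definition sizes_ok (P Q : zpt) (n : nat) (om : seq (seq nat)) (l : seq cell) : bool :=
  all (fun c => let w := nth [::] om c.1 in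
    (size w == n) && tri_side P Q c.2 || (size w == n.+1) && tri_side Q P c.2) l.


(** Forgets whether the images of letters are rows or columns. *)
Definition words (om : morphism2) : seq (seq nat) := map flatten om.

Definition tile_cells : seq cell :=
  flatten [seq [seq (aV.1, T) | T <- fan aV.2] | aV <- zip (iota 0 (size tiles)) tiles].
Definition mirror_cells (h : nat -> nat) (l : seq cell) : seq cell :=
  [seq (h c.1, tri_flip pt_mirror c.2) | c <- l].
Definition reflect_cells (l : seq cell) : seq cell :=
  [seq (c.1, tri_map pt_reflect c.2) | c <- l].
Definition strip_cells om l := extend_cells (zt, z0) om l.
Definition strip_cells_v om l := swap_cells (strip_cells om (swap_cells l)).

(** The labelled triangles of each level, computed from those of the level above it and never merged
    into atoms. *)
Definition cells8 := mirror_cells rho tile_cells.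
Definition cells7 := reflect_cells (strip_cells (words omega11) cells8).
Definition cells6 := strip_cells_v (words omega10) cells7.
Definition cells5 := reflect_cells (strip_cells (words omega9) cells6).
Definition cells4 := strip_cells_v (words omega8) cells5.
Definition cells3 := strip_cells (words omega7) cells4.
Definition cells2 := extend_cells (z1, z0) (words kappa) cells3.
Definition cells0 := extend_cells (z0, z1) (words omega0123) cells2.

Section Cells.
Variable R : realType.
Local Notation f := (golden R).
Implicit Types (p : R * R) (v : zpt) (l : seq cell) (c : R * R -> nat).

Definition covers (a b : R) c l := forall p, generic p -> rectangle a b p ->
  exists2 x, x \in l & in_tri x.2 p /\ c p = x.1.

Lemma zevE : [/\ [/\ zev R zs = f - 1, zev R zt = 2 - f & zev R zu = 2 * f - 3],
  zev R z1 = 1, zev R zg = f, zev R z0 = 0 & zev R zh = f + 3].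
Proof.
split; first split.
- by rewrite -[LHS]/((-1)%:~R + 1%:~R * f) rmorphN; ring.
- by rewrite -[LHS]/(2%:~R + (-1)%:~R * f) rmorphN; ring.
- by rewrite -[LHS]/((-3)%:~R + 2%:~R * f) rmorphN; ring.
- by rewrite -[LHS]/(1%:~R + 0%:~R * f); ring.
- by rewrite -[LHS]/(0%:~R + 1%:~R * f); ring.
- by rewrite -[LHS]/(0%:~R + 0%:~R * f); ring.
- by rewrite -[LHS]/(3%:~R + 1%:~R * f); ring.
Qed.

Lemma in_tri_map (h : zpt -> zpt) (g : R * R -> R * R) (k : R) T p : 0 < k ->
  (forall A B x, orient (pev R (h A)) (pev R (h B)) (g x) = k * orient (pev R A) (pev R B) x) ->
  in_tri T p -> in_tri (tri_map h T) (g p).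
Proof. by case: T => -[A B] C k0 e [h1 h2 h3]; split; rewrite e mulr_gt0. Qed.

Lemma in_tri_flip (h : zpt -> zpt) (g : R * R -> R * R) (k : R) T p : 0 < k ->
  (forall A B x, orient (pev R (h A)) (pev R (h B)) (g x) = - (k * orient (pev R A) (pev R B) x)) ->
  in_tri T p -> in_tri (tri_flip h T) (g p).
Proof.
by case: T => -[A B] C k0 e [h1 h2 h3]; split; rewrite orientC e opprK mulr_gt0.
Qed.

Lemma pev_add v w : pev R (ptadd v w) = pev R v + pev R w.
Proof. by rewrite /pev !zevD. Qed.

Lemma in_tri_shift v T p : in_tri T p -> in_tri (tri_map (ptadd v) T) (p + pev R v).
Proof.
apply: (in_tri_map (g := fun p => p + pev R v) ltr01) => A B x.
by rewrite !pev_add /orient /=; ring.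
Qed.

Lemma in_tri_swap T p : in_tri T p -> in_tri (tri_flip pt_swap T) (swap p).
Proof. by apply: (in_tri_flip ltr01) => A B x; rewrite /orient /=; ring. Qed.

Lemma in_tri_mirror T p : in_tri T (1 - f * p.1, p.2) -> in_tri (tri_flip pt_mirror T) p.
Proof.
have hf := golden_sqr R; have bf := golden_bounds R.
have [[es _ _] e1 _ _ _] := zevE.
have s0 : 0 < f - 1 by lra.
move=> /(in_tri_flip (h := pt_mirror) (g := fun x => ((f - 1) * (1 - x.1), x.2)) s0).
have -> : ((f - 1) * (1 - (1 - f * p.1, p.2).1), (1 - f * p.1, p.2).2) = p :> R * R.
  by rewrite [RHS]surjective_pairing /=; congr pair; ring: hf.
by apply=> A B x; rewrite /pev /= !zevM !zevB es e1 /orient /=; ring.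
Qed.

Lemma in_tri_reflect T p : in_tri T (1 - f * p.1, 1 - f * p.2) ->
  in_tri (tri_map pt_reflect T) p.
Proof.
have hf := golden_sqr R; have bf := golden_bounds R.
have [[es _ _] e1 _ _ _] := zevE.
have s0 : 0 < (f - 1) * (f - 1) by rewrite mulr_gt0 //; lra.
move=> /(in_tri_map (h := pt_reflect)
  (g := fun x => ((f - 1) * (1 - x.1), (f - 1) * (1 - x.2))) s0).
have -> : ((f - 1) * (1 - (1 - f * p.1, 1 - f * p.2).1),
    (f - 1) * (1 - (1 - f * p.1, 1 - f * p.2).2)) = p :> R * R.
  by rewrite [RHS]surjective_pairing /=; congr pair; ring: hf.
by apply=> A B x; rewrite /pev /= !zevM !zevB es e1 /orient /=; ring.
Qed.

Lemma extend_mem v w T p k : in_tri T p -> (k < size w)%N ->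
  exists2 x, x \in extend v w T & in_tri x.2 (p + pev R v *~ k) /\ x.1 = nth 0%N w k.
Proof.
elim: w T p k => [|a w IH] T p [|k] //= pT hk.
  by exists (a, T); rewrite ?mem_head // mulr0z addr0.
have [x hx [h1 h2]] := IH _ _ k (in_tri_shift v pT) hk.
exists x; first by rewrite inE hx orbT.
by split=> //; rewrite intS mulrzDr mulr1z addrA.
Qed.

Lemma extend_cells_mem v om l x p k : x \in l -> in_tri x.2 p ->
  (k < size (nth [::] om x.1))%N ->
  exists2 y, y \in extend_cells v om l &
    in_tri y.2 (p + pev R v *~ k) /\ y.1 = nth 0%N (nth [::] om x.1) k.
Proof.
move=> hx px hk; have [y hy h] := extend_mem v px hk.
by exists y => //; apply/flatten_mapP; exists x.
Qed.

Lemma sizes_okP a b P Q n om l c C : covers a b c l -> (0 < n)%N ->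
  sizes_ok P Q n om l -> (forall q, generic q -> C q = (0 < orient (pev R P) (pev R Q) q)) ->
  sizes (rectangle a b) C n om c.
Proof.
move=> cov n0 /allP ok hC q gq Wq; have [x xl [qx ->]] := cov q gq Wq.
have lt k : size (nth [::] om x.1) = k -> (0 < k)%N -> (x.1 < size om)%N.
  by move=> <-; case: (ltnP x.1 (size om)) => // h; rewrite nth_default.
rewrite hC //; case/orP: (ok x xl) => /andP[/eqP e /tri_side_gt0-/(_ _ _ qx) h].
  by rewrite h; split=> //; apply: lt e n0.
by rewrite orientC in h; rewrite ltNge ltW ?e -?oppr_gt0 //; split=> //; apply: lt e _.
Qed.

Lemma covers_swap a b c l : covers a b c l -> covers b a (c \o swap) (swap_cells l).
Proof.
move=> cov p gp Wp; have [x xl [px e]] := cov _ (generic_swap gp) (rectangle_swap Wp).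
exists (x.1, tri_flip pt_swap x.2); first by apply: map_f.
by split=> //=; rewrite -[p]swapK; apply: in_tri_swap.
Qed.

Lemma covers_tower G G' va vb va' vb' a b w h c c' om l (v : zpt) :
  tower G G' va vb va' vb' (rectangle w h) c c' om -> pev R v = va ->
  covers w h c' l ->
  (forall p, generic p -> rectangle a b p -> exists q (k : nat), [/\ generic q,
     rectangle w h q, (k < size (nth [::] om (c' q)))%N & p = q + va *~ k]) ->
  covers a b c (extend_cells v om l).
Proof.
move=> T ev cov H p gp Wp; have [q [k [gq Wq hk e]]] := H p gp Wp.
have [x xl [qx cx]] := cov q gq Wq; rewrite cx in hk.
have [y hy [h1 h2]] := extend_cells_mem v xl qx hk; exists y => //.
by rewrite e (tower_word T) ?cx // -ev.
Qed.

End Cells.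

(** * The codes of all levels *)

Section Codes.
Variable R : realType.
Local Notation f := (golden R).
Local Notation s := (f - 1).
Local Notation t := (2 - f).
Local Notation u := (2 * f - 3).
Implicit Types (p q : R * R) (c : R * R -> nat) (om : seq (seq nat)) (l : seq cell).

(** [find] returns the meaningless value 19 off all tiles, which no generic point takes. *)
Definition tile_code p : nat :=
  find (fun V => in_poly (map (pev R) V) (redr 1 1 p)) tiles.

Lemma slabs_tiles : slabs_ok tiles z1 z0 z1 slabs.
Proof. by []. Qed.

Lemma tiles_disjoint : pairwise disjoint_polygons tiles.
Proof. by []. Qed.

Lemma tile_codeE p a : generic p -> rectangle 1 1 p -> (a < size tiles)%N ->
  in_poly (map (pev R) (nth [::] tiles a)) p -> tile_code p = a.
Proof.
move=> gp Wp ha pa; rewrite /tile_code redr_id //.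
set P := fun V => _; have hP : has P tiles.
  by apply/(has_nthP [::]); exists a.
case: (ltngtP (find P tiles) a) => // h.
  have := nth_find [::] hP; rewrite /P => pb.
  have hm : find P tiles \in gtn (size tiles) by rewrite inE -has_find.
  have dis := elimT (pairwiseP [::]) tiles_disjoint _ _ hm ha h.
  by case: (disjoint_polygonsP gp dis pb pa).
by have := before_find [::] h; rewrite /P pa.
Qed.

Lemma tile_exists p : generic p -> rectangle 1 1 p -> exists2 a, (a < size tiles)%N &
  in_poly (map (pev R) (nth [::] tiles a)) p.
Proof.
have [_ e1 _ e0 _] := zevE R; move=> gp [h1 h2].
by apply: (slabs_cover gp slabs_tiles); rewrite ?e1 ?e0.
Qed.

Lemma covers_tiles : covers 1 1 tile_code tile_cells.
Proof.
move=> p gp Wp; have [a ha pa] := tile_exists gp Wp.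
have [T hT pT] := fan_cover gp pa; exists (a, T); last by rewrite (tile_codeE gp Wp ha).
apply/flatten_mapP; exists (a, nth [::] tiles a); last exact: map_f.
apply/(nthP (0%N, [::])); exists a; first by rewrite size_zip size_iota minnn.
by rewrite nth_zip ?size_iota // nth_iota.
Qed.

Definition periodic (a b : R) c :=
  forall p q, congr_mod (rectangular a b) p q -> c p = c q.

Lemma periodic_tile_code : periodic 1 1 tile_code.
Proof. by move=> p q e; rewrite /tile_code (redr_eq _ _ e) ?oner_eq0. Qed.

Definition golden_code b om c := strip_code 1 s t b om c.

Lemma orient_u q : orient (pev R (zu, z0)) (pev R (zu, z1)) q = u - q.1.
Proof. by have [[_ _ eu] e1 _ e0 _] := zevE R; rewrite /orient /= eu e1 e0; ring. Qed.

(** Carries both the tower and the labelled triangles from one level to the next. *)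
Lemma golden_step b be om c l : 0 < b -> inK b -> inK be -> periodic s b c ->
  covers s b c l -> sizes_ok (zu, z0) (zu, z1) 1 om l ->
  tower (rectangular 1 b) (rectangular s b) (t, 0) (0, be) (- u, 0) (0, be)
    (rectangle s b) (golden_code b om c) c om /\
  covers 1 b (golden_code b om c) (strip_cells om l).
Proof.
move=> b0 kb kbe per cov sz; have bf := golden_bounds R.
have szc : sizes (rectangle s b) (fun q => q.1 < u) 1 om c.
  by apply: sizes_okP cov _ sz _ => // q _; rewrite orient_u subr_gt0.
have ks : inK s by apply: inKB; [exact: inKg|exact: inK1].
have kt : inK t by apply: inKB; [exact: inK_nat|exact: inKg].
have T := tower_golden b0 kb kbe per szc; split=> //.
apply: (covers_tower T _ cov) => [|p gp [/andP[p0 p1] p2]].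
  by have [[_ et _] _ _ e0 _] := zevE R; rewrite /pev /= et e0.
have [lt|gt|eq] := ltgtP p.1 s.
- exists p, 0%N; rewrite mulr0z addr0; split=> //; first by split=> //; rewrite p0.
  have [|_ ->] := szc p gp; first by split=> //; rewrite p0.
  by case: ifP.
- pose q := p - (t, 0); have gq : generic q.
    by apply: genericD => //; apply: inK2N; split=> //; exact: inK0.
  have e1 : q.1 = p.1 - t by [].
  have e2 : q.2 = p.2 by rewrite -[RHS]subr0.
  have Wq : rectangle s b q by split; rewrite ?e1 ?e2 //; apply/andP; split; lra.
  exists q, 1%N; rewrite mulr1z subrK; split=> //.
  by have [_ ->] := szc q gq Wq; rewrite ifN // -leNgt e1; lra.
- by have := generic_neq1 gp ks; rewrite eq eqxx.
Qed.

Lemma golden_step_v b be om c l : 0 < b -> inK b -> inK be -> periodic b s c ->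
  covers b s c l -> sizes_ok (zu, z0) (zu, z1) 1 om (swap_cells l) ->
  let d := golden_code b om (c \o swap) \o swap in
  tower (rectangular b 1) (rectangular b s) (0, t) (be, 0) (0, - u) (be, 0)
    (rectangle b s) d c om /\ covers b 1 d (strip_cells_v om l).
Proof.
move=> b0 kb kbe per cov sz d.
have per' : periodic s b (c \o swap) by move=> p q /congr_swap/per.
have [T co] := golden_step b0 kb kbe per' (covers_swap cov) sz.
split; last exact: covers_swap.
have := tower_swap T; have -> // : (c \o swap) \o swap = c.
by apply/funext => p /=; rewrite swapK.
Qed.

Lemma kappa_step om c l : periodic 1 1 c -> covers 1 1 c l ->
  sizes_ok (zs, z1) (zs, z0) 1 om l ->
  let d := strip_code f 1 1 1 om c in
  tower (rectangular f 1) (rectangular 1 1) (1, 0) (0, t) (t, 0) (0, t)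
    (rectangle 1 1) d c om /\ covers f 1 d (extend_cells (z1, z0) om l).
Proof.
move=> per cov sk d; have bf := golden_bounds R.
have k1 : inK (1 : R) by exact: inK1.
have k0 : inK (0 : R) by exact: inK0.
have [[es et eu] e1 eg e0 eh] := zevE R.
have szk : sizes (rectangle 1 1) (fun q => s < q.1) 1 om c.
  apply: sizes_okP cov _ sk _ => // q _.
  by rewrite /orient /= es e1 e0 -[LHS]subr_gt0; congr (_ < _); ring.
have T := tower_kappa per szk.
split=> //; apply: (covers_tower T _ cov) => [|p gp [/andP[p0 p1] p2]]; first by rewrite /pev /= e1 e0.
have [lt|gt|eq] := ltgtP p.1 1.
- exists p, 0%N; rewrite mulr0z addr0; split=> //; first by split=> //; rewrite p0.
  have [|_ ->] := szk p gp; first by split=> //; rewrite p0.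
  by case: ifP.
- pose q := p - (1, 0); have gq : generic q by apply: genericD => //; apply: inK2N.
  have q1 : q.1 = p.1 - 1 by [].
  have q2 : q.2 = p.2 by rewrite -[RHS]subr0.
  have Wq : rectangle 1 1 q by split; rewrite ?q1 ?q2 //; apply/andP; split; lra.
  exists q, 1%N; rewrite mulr1z subrK; split=> //.
  by have [_ ->] := szk q gq Wq; rewrite ifN // -leNgt q1; lra.
- by have := generic_neq1 gp k1; rewrite eq eqxx.
Qed.

Lemma skew_step om c l : periodic f 1 c -> covers f 1 c l ->
  sizes_ok (z0, zs) (z1, zs) 4 om l ->
  let d := skew_code om c in
  tower (Gamma0 R) (rectangular f 1) (0, 1) (1, 0) (s, t) (1, 0)
    (rectangle f 1) d c om /\ covers f (f + 3) d (extend_cells (z0, z1) om l).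
Proof.
move=> per cov sk d; have bf := golden_bounds R.
have k0 : inK (0 : R) by exact: inK0.
have [[es et eu] e1 eg e0 eh] := zevE R.
have sz0 : sizes (rectangle f 1) (fun q => s < q.2) 4 om c.
  apply: sizes_okP cov _ sk _ => // q _.
  by rewrite /orient /= es e1 e0 -[LHS]subr_gt0; congr (_ < _); ring.
have T := tower_skew per sz0.
split=> //; apply: (covers_tower T _ cov) => [|p gp Wp]; first by rewrite /pev /= e1 e0.
have [p1 /andP[p20 p2h]] := Wp.
pose k := absz (Num.floor p.2).
have /andP[kl ku'] := floor_itv p.2.
have k_ge0 : 0 <= Num.floor p.2 by rewrite floor_ge0 ltW.
have kE : (Num.floor p.2)%:~R = k%:R :> R by rewrite -[in LHS](gez0_abs k_ge0).
rewrite rmorphD /= kE in ku'; rewrite kE in kl.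
pose q := p - (0, k%:R).
have gq : generic q by apply: genericD => //; apply: inK2N; split=> //; exact: inK_nat.
have q1 : q.1 = p.1 by rewrite -[RHS]subr0.
have q2 : q.2 = p.2 - k%:R by [].
have kl' : k%:R < p.2 by rewrite lt_def kl andbT; apply: (generic_neq2 gp); exact: inK_nat.
have Wq : rectangle f 1 q.
  by split; rewrite ?q1 ?q2 //; apply/andP; split; lra.
have va : (0, 1) *~ k = (0, k%:R) :> R * R by rewrite mulrz_pair /= mul0rz.
exists q, k; rewrite va subrK; split=> //.
have [_ ->] := sz0 q gq Wq.
have k4 : (k < 5)%N by rewrite -(ltr_nat R); lra.
case: ifP => // lt; rewrite ltn_neqAle -ltnS k4 andbT.
by apply/eqP => e; move: lt; rewrite q2 e; lra.
Qed.

(** Pulls a code of the unit torus back to the torus of side [s] through [rescale]; the periods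
    match because [golden * s = 1]. *)
Definition reflect_code c p : nat := c (- f * p.1, - f * p.2).

Lemma golden_mul_inv : f * s = 1.
Proof. by have hf := golden_sqr R; ring: hf. Qed.

Lemma periodic_reflect c : periodic 1 1 c -> periodic s s (reflect_code c).
Proof.
move=> per p q /rect_congr[m [n [e1 e2]]]; apply: per; apply/rect_congr.
exists (- m), (- n); rewrite /= e1 e2 !rmorphN /= !mulr1 !mulrDr.
by have hf := golden_sqr R; split; ring: hf.
Qed.

Lemma covers_reflect c l : periodic 1 1 c -> covers 1 1 c l ->
  covers s s (reflect_code c) (reflect_cells l).
Proof.
move=> per cov p gp [/andP[x0 xs] /andP[y0 ys]].
have bf := golden_bounds R; have e := golden_mul_inv.
have gq : generic (1 - f * p.1, 1 - f * p.2).
  have -> : (1 - f * p.1, 1 - f * p.2) = (- f * p.1, - f * p.2) + (1, 1).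
    by rewrite [RHS]surjective_pairing /=; congr pair; ring.
  apply: genericD; last by split; exact: inK1.
  by apply: genericM => //; try (apply: inKN; exact: inKg); lra.
have [|x xl [h1 h2]] := cov _ gq.
  by split=> /=; apply/andP; split; nra.
exists (x.1, tri_map pt_reflect x.2); first by apply: map_f.
split; first exact: in_tri_reflect.
rewrite /= -h2; apply: per; apply/rect_congr; exists 1, 1 => /=.
by split; ring.
Qed.

(** The map [x -> 1 - f x] turns the rotation by [- u] of the circle of length [s] into the rotation
    by [t] of the circle of length 1: the last system is a relabelled mirror image of the one of
    [PU]. *)
Definition code8 p := rho (tile_code (1 - f * p.1, p.2)).
(** The suffix [h] marks the codes of the rescaled partitions, on which the next horizontal
    induction is performed. *)
Definition code7h := golden_code 1 (words omega11) code8.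
Definition code7 := reflect_code code7h.
Definition code6 := golden_code s (words omega10) (code7 \o swap) \o swap.
Definition code5h := golden_code 1 (words omega9) code6.
Definition code5 := reflect_code code5h.
Definition code4 := golden_code s (words omega8) (code5 \o swap) \o swap.
Definition code3 := golden_code 1 (words omega7) code4.
Definition code2 := strip_code f 1 1 1 (words kappa) code3.
Definition code0 := skew_code (words omega0123) code2.

Lemma periodic8 : periodic s 1 code8.
Proof.
move=> p q /rect_congr[m [n [e1 e2]]]; rewrite /code8.
have -> // : tile_code (1 - f * p.1, p.2) = tile_code (1 - f * q.1, q.2).
apply: periodic_tile_code; apply/rect_congr; exists (- m), n.
rewrite /= e1 e2 rmorphN /= mulr1; split=> //.
by have hf := golden_sqr R; ring: hf.
Qed.

Lemma covers8 : covers s 1 code8 cells8.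
Proof.
move=> p gp [/andP[x0 xs] h2]; have bf := golden_bounds R; have e := golden_mul_inv.
have gq : generic (1 - f * p.1, p.2).
  have -> : (1 - f * p.1, p.2) = (- f * p.1, 1 * p.2) + (1, 0).
    by rewrite [RHS]surjective_pairing /=; congr pair; ring.
  apply: genericD; last by split; [exact: inK1|exact: inK0].
  by apply: genericM => //; [apply: inKN; exact: inKg|exact: inK1|lra].
have [|x xl [px cx]] := covers_tiles gq.
  by split=> //=; apply/andP; split; nra.
exists (rho x.1, tri_flip pt_mirror x.2); first exact: (map_f (fun c : cell => (rho c.1, tri_flip pt_mirror c.2))).
by split; [exact: in_tri_mirror|rewrite /code8 cx].
Qed.

Lemma sizes_words : [&& sizes_ok (zu, z0) (zu, z1) 1 (words omega11) cells8,
  sizes_ok (zu, z0) (zu, z1) 1 (words omega10) (swap_cells cells7),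
  sizes_ok (zu, z0) (zu, z1) 1 (words omega9) cells6,
  sizes_ok (zu, z0) (zu, z1) 1 (words omega8) (swap_cells cells5),
  sizes_ok (zu, z0) (zu, z1) 1 (words omega7) cells4,
  sizes_ok (zs, z1) (zs, z0) 1 (words kappa) cells3 &
  sizes_ok (z0, zs) (z1, zs) 4 (words omega0123) cells2].
Proof. by []. Qed.

#[local] Opaque cells8 cells7 cells6 cells5 cells4 cells3 cells2 cells0.

Record all_towers : Prop := AllTowers {
  tower11 : tower (rectangular 1 1) (rectangular s 1) (t, 0) (0, t) (- u, 0) (0, t)
    (rectangle s 1) code7h code8 (words omega11);
  tower10 : tower (rectangular s 1) (rectangular s s) (0, t) (- u, 0) (0, - u) (- u, 0)
    (rectangle s s) code6 code7 (words omega10);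
  tower9 : tower (rectangular 1 1) (rectangular s 1) (t, 0) (0, t) (- u, 0) (0, t)
    (rectangle s 1) code5h code6 (words omega9);
  tower8 : tower (rectangular s 1) (rectangular s s) (0, t) (- u, 0) (0, - u) (- u, 0)
    (rectangle s s) code4 code5 (words omega8);
  tower7 : tower (rectangular 1 1) (rectangular s 1) (t, 0) (0, t) (- u, 0) (0, t)
    (rectangle s 1) code3 code4 (words omega7);
  towerk : tower (rectangular f 1) (rectangular 1 1) (1, 0) (0, t) (t, 0) (0, t)
    (rectangle 1 1) code2 code3 (words kappa);
  tower0 : tower (Gamma0 R) (rectangular f 1) (0, 1) (1, 0) (s, t) (1, 0)
    (rectangle f 1) code0 code2 (words omega0123);
  covers0 : covers f (f + 3) code0 cells0 }.

Lemma all_towersP : all_towers.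
Proof.
have bf := golden_bounds R.
have k1 : inK (1 : R) by exact: inK1.
have kf : inK f by exact: inKg.
have k0 : inK (0 : R) by exact: inK0.
have ks : inK s by apply: inKB.
have kt : inK t by apply: inKB => //; exact: inK_nat.
have ku : inK (- u) by apply: inKN; apply: inKB; [apply: inKM => //|]; exact: inK_nat.
have s0 : 0 < s by lra.
case/and5P: sizes_words => s11 s10 s9 s8 /and3P[s7 sk s0123].
have [T11 C7h] : _ /\ covers 1 1 code7h (strip_cells (words omega11) cells8) := golden_step ltr01 k1 kt periodic8 covers8 s11.
have P7h : periodic 1 1 code7h := tower_per T11.
have C7 : covers s s code7 cells7 := covers_reflect P7h C7h.
have P7 : periodic s s code7 := periodic_reflect P7h.
have [T10 C6] : _ /\ covers s 1 code6 cells6 := golden_step_v s0 ks ku P7 C7 s10.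
have P6 : periodic s 1 code6 := tower_per T10.
have [T9 C5h] : _ /\ covers 1 1 code5h (strip_cells (words omega9) cells6) := golden_step ltr01 k1 kt P6 C6 s9.
have P5h : periodic 1 1 code5h := tower_per T9.
have C5 : covers s s code5 cells5 := covers_reflect P5h C5h.
have P5 : periodic s s code5 := periodic_reflect P5h.
have [T8 C4] : _ /\ covers s 1 code4 cells4 := golden_step_v s0 ks ku P5 C5 s8.
have P4 : periodic s 1 code4 := tower_per T8.
have [T7 C3] : _ /\ covers 1 1 code3 cells3 := golden_step ltr01 k1 kt P4 C4 s7.
have P3 : periodic 1 1 code3 := tower_per T7.
have [Tk C2] : _ /\ covers f 1 code2 cells2 := kappa_step P3 C3 sk.
have P2 : periodic f 1 code2 := tower_per Tk.
have [T0 C0] : _ /\ covers f (f + 3) code0 cells0 := skew_step P2 C2 s0123.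
by split.
Qed.

End Codes.
Arguments tile_code {R}.
Arguments code8 {R}.
Arguments code7h {R}.
Arguments code7 {R}.
Arguments code6 {R}.
Arguments code5h {R}.
Arguments code5 {R}.
Arguments code4 {R}.
Arguments code3 {R}.
Arguments code2 {R}.
Arguments code0 {R}.

(** * Every letter of every code is attained *)

Section Attained.
Variable R : realType.
Local Notation f := (golden R).
Local Notation s := (f - 1).
Implicit Types (c : R * R -> nat) (om : seq (seq nat)).

(** A letter that is never taken would remove its word from the list of words that occur, and shift
    the radix numbering of the atoms after it. *)
Definition attained c n := forall a, (a < n)%N -> exists2 q, generic q & c q = a.

Lemma attained_rectangle a b c n : 0 < a -> 0 < b -> inK a -> inK b -> periodic a b c ->
  attained c n -> forall i, (i < n)%N -> exists q, [/\ generic q, rectangle a b q & c q = i].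
Proof.
move=> a0 b0 ka kb per at_c i /at_c[q gq e]; have cq := redr_congr a b q.
exists (redr a b q); rewrite -(per _ _ cq); split=> //; last exact: redr_rectangle.
by apply: generic_congr cq gq; split=> //; exact: inK0.
Qed.

Lemma attained_tower G G' va vb va' vb' W c c' om n :
  tower G G' va vb va' vb' W c c' om -> attained c' (size om) ->
  all (fun a => has (fun w => a \in w) om) (iota 0 n) -> attained c n.
Proof.
move=> T at_c' /allP h a an; have /h /hasP[w] : a \in iota 0 n by rewrite mem_iota.
move=> /(nthP [::])[b b_lt <-] /(nthP 0%N)[k k_lt <-].
have [p gp ep] := at_c' b b_lt; have [q Wq pq] := tower_red T gp.
have gq := tower_generic' T pq gp; have eq : c' q = b by rewrite -(tower_per' T pq).
exists (q + va *~ k); last by rewrite (tower_word T gq Wq) eq.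
by have [_ _ [ka _] _] := tower_K T; apply: genericD => //; apply: inK2i.
Qed.

Lemma attained_reflect c n : periodic 1 1 c -> attained c n -> attained (reflect_code c) n.
Proof.
move=> per at_c a /at_c[q gq <-]; have hf := golden_sqr R; have bf := golden_bounds R.
have ks : inK (1 - f) by apply: inKB; [exact: inK1|exact: inKg].
exists ((1 - f) * q.1, (1 - f) * q.2); first by apply: genericM => //; lra.
rewrite /reflect_code /=; congr (c _).
by rewrite [RHS]surjective_pairing; congr pair; ring: hf.
Qed.

Definition unit_box : seq zpt := [:: (z0, z0); (z1, z0); (z1, z1); (z0, z1)].

Lemma tiles_box : all (fun V => all (tri_in unit_box) (fan V)) tiles.
Proof. by []. Qed.

Lemma unit_boxP (p : R * R) : in_poly (map (pev R) unit_box) p -> rectangle 1 1 p.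
Proof.
have [_ e1 _ e0 _] := zevE R.
rewrite /in_poly /= /orient /pev /= e1 e0 => /and5P[h1 h2 h3 h4 _].
by split; apply/andP; split; lra.
Qed.

Lemma tile_rectangle V p : V \in tiles -> generic p -> in_poly (map (pev R) V) p ->
  rectangle 1 1 p.
Proof.
move=> Vt gp pV; have [T hT pT] := fan_cover gp pV.
by apply: unit_boxP; apply: tri_in_poly (allP (allP tiles_box V Vt) T hT) pT.
Qed.

Lemma tiles_nonempty : all (fun V => has (fun T => tri_in V T && zpos (zorient T.1.1 T.1.2 T.2))
  (fan V)) tiles.
Proof. by []. Qed.

Lemma attained_tiles : attained tile_code 19.
Proof.
move=> a a_lt; have Vt : nth [::] tiles a \in tiles by apply: mem_nth.
have /hasP[[[A B] C] _ /andP[inV /(zpos_gt0 R)]] := allP tiles_nonempty _ Vt.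
rewrite zev_orient /= => pos.
pose m (x y z : R) := (x + y + z) / 3.
(* The centroid of a nondegenerate triangle of the tile is in the open tile, which is therefore
   nonempty and contains a generic point. *)
pose g := (m (pev R A).1 (pev R B).1 (pev R C).1, m (pev R A).2 (pev R B).2 (pev R C).2).
have third (P Q : R * R) : orient P Q g = (orient P Q (pev R A) + orient P Q (pev R B) +
    orient P Q (pev R C)) / 3.
  by rewrite /orient /g /m /=; field.
have rot P Q S : orient P Q S = orient Q S P :> R by rewrite /orient; ring.
have deg P Q : orient P P Q = 0 :> R by rewrite /orient; ring.
have deg' P Q : orient P Q P = 0 :> R by rewrite /orient; ring.
have deg'' P Q : orient P Q Q = 0 :> R by rewrite /orient; ring.
have hg : in_tri (A, B, C) g.
  split; rewrite third !(deg, deg', deg'') ?add0r ?addr0; apply: divr_gt0 => //.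
    by rewrite -rot.
  by rewrite rot.
have [||p gp pV] := @exists_generic R [set p | in_poly (map (pev R) (nth [::] tiles a)) p].
- exact: open_in_poly.
- by exists g; apply: tri_in_poly hg.
by exists p => //; apply: (tile_codeE gp (tile_rectangle Vt gp pV) _ pV).
Qed.

Lemma rho_onto : all (fun b => has (fun a => rho a == b) (iota 0 19)) (iota 0 19).
Proof. by []. Qed.

Lemma attained_code8 : attained code8 19.
Proof.
move=> b b_lt; have /(allP rho_onto)/hasP[a] : b \in iota 0 19 by rewrite mem_iota.
rewrite mem_iota => a_lt /eqP <-; have [q gq <-] := attained_tiles a_lt.
have hf := golden_sqr R; have bf := golden_bounds R.
have ks : inK s by apply: inKB; [exact: inKg|exact: inK1].
exists (s * (1 - q.1), q.2).
  have -> : (s * (1 - q.1), q.2) = (- s * q.1, 1 * q.2) + (s, 0).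
    by rewrite [RHS]surjective_pairing /=; congr pair; ring.
  apply: genericD; last by split=> //; exact: inK0.
  by apply: genericM => //; [apply: inKN|exact: inK1|lra].
rewrite /code8 /=; congr (rho (tile_code _)).
by rewrite [RHS]surjective_pairing; congr pair; ring: hf.
Qed.

Definition letters_occur om n := all (fun a => has (fun w => a \in w) om) (iota 0 n).

Lemma words_occur : [&& letters_occur (words omega11) 21, letters_occur (words omega10) 18,
  letters_occur (words omega9) 22, letters_occur (words omega8) 20,
  letters_occur (words omega7) 20 & letters_occur (words kappa) 28].
Proof. by []. Qed.

Record all_attained : Prop := AllAttained {
  attained8 : attained code8 19;
  attained7 : attained code7 21;
  attained6 : attained code6 18;
  attained5 : attained code5 22;
  attained4 : attained code4 20;
  attained3 : attained code3 20;
  attained2 : attained code2 28 }.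

Lemma all_attainedP : all_attained.
Proof.
have T := all_towersP R.
case/and5P: words_occur => w11 w10 w9 w8 /andP[w7 wk].
have h8 : attained code8 19 by exact: attained_code8.
have h7 := attained_reflect (tower_per (tower11 T)) (attained_tower (tower11 T) h8 w11).
have h6 := attained_tower (tower10 T) h7 w10.
have h5 := attained_reflect (tower_per (tower9 T)) (attained_tower (tower9 T) h6 w9).
have h4 := attained_tower (tower8 T) h5 w8.
have h3 := attained_tower (tower7 T) h4 w7.
by split=> //; apply: attained_tower (towerk T) h3 wk.
Qed.

End Attained.

(** * Coding by the polygons *)

Section Base.
Variable R : realType.
Local Notation f := (golden R).
Local Notation s := (f - 1).
Local Notation t := (2 - f).
Local Notation u := (2 * f - 3).

Definition polygon_union (V : seq (seq (R * R))) : set (R * R) :=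
  \bigcup_(v in [set` V]) polygon_interior v.

Lemma coded_polygons (G : lattice R) (V : seq (seq (seq (R * R)))) c :
  inK2 G.1 -> inK2 G.2 -> (forall p q, congr_mod G p q -> c p = c q) ->
  (forall a, open (polygon_union (nth [::] V a))) ->
  (forall p a, generic p -> polygon_union (nth [::] V a) p -> c p = a) ->
  (forall p, generic p -> exists2 q, congr_mod G p q & polygon_union (nth [::] V (c p)) q) ->
  coded (polygon_partition G V) c.
Proof.
move=> k1 k2 per oV hV cV; split=> [a|p a gp]; first by apply: tproj_open; apply: oV.
split=> [[q Vq /tproj_eq qp]|<-].
  by rewrite -(per _ _ qp); apply: hV Vq; apply: generic_congr (congr_mod_sym qp) gp.
by have [q pq Vq] := cV p gp; exists q => //; apply/tproj_eq; apply: congr_mod_sym.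
Qed.

Lemma tiles_convex : all convex_ok tiles.
Proof. by []. Qed.

Lemma polygonsUE : polygonsU R = [seq [:: map (pev R) V] | V <- tiles].
Proof.
have [[es et eu] e1 eg e0 eh] := zevE R.
(* [2 * t] is written as the exact sum of [zt] with itself, so that both sides become equal by
   computation. *)
have e2 : zev R (zadd zt zt) = 2 * (2 - f) by rewrite zevD et; ring.
rewrite /polygonsU golden_inv golden_inv2 golden_inv3 -e2 -es -et -eu -e1 -e0.
by [].
Qed.

Lemma polygon_union1 (V : seq zpt) : convex_ok V ->
  polygon_union [:: map (pev R) V] = [set p | in_poly (map (pev R) V) p].
Proof.
move=> cV; rewrite /polygon_union -(convex_interior R cV); apply/seteqP; split=> p.
  by move=> [v /=]; rewrite inE => /eqP ->.
by move=> h; exists (map (pev R) V) => //=; rewrite mem_head.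
Qed.

Lemma polygon_union0 : polygon_union [::] = set0.
Proof. by apply/seteqP; split=> p // []. Qed.

Lemma codedU : coded (PU R) tile_code.
Proof.
have unionE a : polygon_union (nth [::] (polygonsU R) a) =
    [set p | (a < size tiles)%N && in_poly (map (pev R) (nth [::] tiles a)) p].
  rewrite polygonsUE; case: (ltnP a (size tiles)) => h.
    by rewrite (nth_map [::]) // polygon_union1 //; apply: (allP tiles_convex); apply: mem_nth.
  by rewrite nth_default ?size_map // polygon_union0; apply/seteqP; split.
apply: coded_polygons.
- by split; [exact: inK1|exact: inK0].
- by split; [exact: inK0|exact: inK1].
- exact: periodic_tile_code.
- move=> a; rewrite unionE; case: (a < size tiles)%N; first exact: open_in_poly.
  by rewrite (_ : [set _ | _] = set0) ?open0 //; apply/seteqP; split.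
- move=> p a gp; rewrite unionE => /andP[h hp].
  have Wp : rectangle 1 1 p by apply: tile_rectangle hp => //; apply: mem_nth.
  exact: tile_codeE hp.
move=> p gp; have k1 : inK (1 : R) by exact: inK1.
have cq := redr_congr 1 1 p; have Wq := redr_rectangle gp k1 k1 ltr01 ltr01.
exists (redr 1 1 p) => //; have gq : generic (redr 1 1 p).
  by apply: generic_congr cq gp; split=> //; exact: inK0.
have [a h hp] := tile_exists gq Wq.
by rewrite unionE (periodic_tile_code cq) (tile_codeE gq Wq h hp) /= h.
Qed.

Definition box0 : seq zpt := [:: (z0, z0); (zg, z0); (zg, zh); (z0, zh)].

Lemma pieces0_box : all (all (fun V => all (tri_in box0) (fan V))) pieces0.
Proof. by []. Qed.

Lemma pieces0_convex : all (all convex_ok) pieces0.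
Proof. by []. Qed.

Lemma pieces0_disjoint :
  pairwise (fun L L' => all (fun V => all (disjoint_polygons V) L') L) pieces0.
Proof. by []. Qed.

(** The two constructions meet here: every triangle carried along the towers to level 0 lies in a
    piece of the atom that bears its letter. *)
Lemma cells0_pieces : all (fun c => has (fun V => tri_in V c.2) (nth [::] pieces0 c.1)) cells0.
Proof. exact: isT. Qed.

Lemma box0P (p : R * R) : in_poly (map (pev R) box0) p -> rectangle f (f + 3) p.
Proof.
have [_ e1 eg e0 eh] := zevE R; have bf := golden_bounds R.
rewrite /in_poly /= /orient /pev /= eg e0 eh => /and5P[h1 h2 h3 h4 _].
by split; apply/andP; split; nra.
Qed.

Definition pieces_union (L : seq (seq zpt)) : set (R * R) :=
  [set p | exists2 V, V \in L & in_poly (map (pev R) V) p].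

Lemma pieces_union_cons V L : pieces_union (V :: L) =
  [set p | in_poly (map (pev R) V) p] `|` pieces_union L.
Proof.
apply/seteqP; split=> p /=.
  by move=> [W]; rewrite inE => /predU1P[->|h] hW; [left|right; exists W].
move=> [h|[W WL hW]]; first by exists V; rewrite ?mem_head.
by exists W; rewrite ?inE ?WL ?orbT.
Qed.

Lemma polygon_unionE (L : seq (seq zpt)) : all convex_ok L ->
  polygon_union (map (map (pev R)) L) = pieces_union L.
Proof.
elim: L => [_|V L IH /= /andP[cV cL]].
  by rewrite polygon_union0; apply/seteqP; split=> p // [].
rewrite pieces_union_cons -IH // -polygon_union1 //; apply/seteqP; split=> p.
  move=> [v /=]; rewrite inE => /predU1P[->|h] hp; [left|right].
    by exists (map (pev R) V) => //=; rewrite mem_head.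
  by exists v.
move=> [[v /=]|[v /=]]; first by rewrite inE => /eqP -> h; exists (map (pev R) V) => //=; rewrite mem_head.
by move=> h hp; exists v => //=; rewrite inE h orbT.
Qed.

Lemma pieces_union_nil : pieces_union [::] = set0.
Proof. by apply/seteqP; split=> p // []. Qed.

Lemma polygons0E a : polygon_union (nth [::] (polygons0 R) a) = pieces_union (nth [::] pieces0 a).
Proof.
have [[es et eu] e1 eg e0 eh] := zevE R.
have e2 : zev R (zadd z1 z1) = 2 by rewrite zevD e1; ring.
have e21 : zev R (zadd zg (zadd z1 z1)) = f + 2 by rewrite zevD eg e2.
have e11 : zev R (zadd zg z1) = f + 1 by rewrite zevD eg e1.
have e30 : zev R (zadd z1 (zadd z1 z1)) = 3 by rewrite zevD e1 e2; ring.
have e02 : zev R (zadd zg zg) = 2 * f by rewrite zevD eg; ring.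
have [lt|ge] := ltnP a (size pieces0); last by rewrite !nth_default // polygon_union0 pieces_union_nil.
have [e5|n5] := eqVneq a 5%N.
  have -> : nth [::] (polygons0 R) a = [:: hexagon R].
    by rewrite e5 /polygons0 golden_inv golden_inv2.
  have hl : map (pev R) (nth [::] (nth [::] pieces0 5) 0) = hexagon_left R.
    by rewrite /= /pev /= /hexagon_left -e02 -e11 -e21 -eh -et -e0.
  have hr : map (pev R) (nth [::] (nth [::] pieces0 5) 1) = hexagon_right R.
    by rewrite /= /pev /= /hexagon_right -e11 -e21 -eh -e30 -es -e1 -e0.
  have -> : polygon_union [:: hexagon R] = polygon_interior (hexagon R).
    apply/seteqP; split=> p; first by move=> [v /=]; rewrite inE => /eqP ->.
    by move=> h; exists (hexagon R) => //=; rewrite mem_head.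
  rewrite hexagon_interior e5 !pieces_union_cons pieces_union_nil setU0 hl hr.
  by apply/seteqP; split=> p /= /orP.
have -> : nth [::] (polygons0 R) a = map (map (pev R)) (nth [::] pieces0 a).
  move: a lt n5 => [|[|[|[|[|[|[|[|[|[|[|a]]]]]]]]]]] //= _ _;
  by rewrite ?golden_inv ?golden_inv2 -?et -?eh -?e21 -?e11 -?e2 -?es -?e1 -?e0 -?eg.
by rewrite polygon_unionE //; apply: (allP pieces0_convex); apply: mem_nth.
Qed.

(** A generic point of an atom is also in the atom prescribed by its code, and pieces of distinct
    atoms are disjoint. *)
Lemma coded0 : coded (P0 R) code0.
Proof.
have k1 : inK (1 : R) by exact: inK1.
have k0 : inK (0 : R) by exact: inK0.
have kf : inK f by exact: inKg.
have T := all_towersP R.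
have kG1 : inK2 (Gamma0 R).1 by split.
have kG2 : inK2 (Gamma0 R).2 by split=> //; apply: inKD => //; exact: (inK_nat _ 3).
have per : forall p q, congr_mod (Gamma0 R) p q -> code0 p = code0 q.
  exact: tower_per (tower0 T).
have inL p : generic p -> rectangle f (f + 3) p -> pieces_union (nth [::] pieces0 (code0 p)) p.
  move=> gp Wp; have [x xl [px ->]] := covers0 T gp Wp.
  have /hasP[V VL hV] := allP cells0_pieces x xl.
  by exists V => //; apply: tri_in_poly px.
apply: coded_polygons => //.
- move=> a; rewrite polygons0E.
  elim: (nth [::] pieces0 a) => [|V L IH]; first by rewrite pieces_union_nil; exact: open0.
  by rewrite pieces_union_cons; apply: openU => //; exact: open_in_poly.
- move=> p a gp; rewrite polygons0E => -[V VL pV].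
  have lt : forall b, pieces_union (nth [::] pieces0 b) p -> (b < size pieces0)%N.
    by move=> b [W]; case: ltnP => // h; rewrite nth_default.
  have a_lt : (a < size pieces0)%N by apply: lt; exists V.
  have Wp : rectangle f (f + 3) p.
    have [U hU pU] := fan_cover gp pV; apply: box0P.
    by apply: tri_in_poly (allP (allP (allP pieces0_box _ (mem_nth _ a_lt)) V VL) U hU) pU.
  have [W WL pW] := inL p gp Wp; have b_lt : (code0 p < size pieces0)%N by apply: lt; exists W.
  have dis i j V' W' : (i < size pieces0)%N -> (j < size pieces0)%N -> (i < j)%N ->
      V' \in nth [::] pieces0 i -> W' \in nth [::] pieces0 j ->
      in_poly (map (pev R) V') p -> in_poly (map (pev R) W') p -> False.
    move=> hi hj ij hV' hW'; have := elimT (pairwiseP [::]) pieces0_disjoint _ _ hi hj ij.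
    by move/allP/(_ _ hV')/allP/(_ _ hW'); apply: disjoint_polygonsP.
  by case: (ltngtP (code0 p) a) => // h; [case: (dis _ _ _ _ b_lt a_lt h WL VL)|
    case: (dis _ _ _ _ a_lt b_lt h VL WL)].
move=> p gp; have cq := skew_red_congr p; exists (skew_red p) => //.
rewrite polygons0E (per _ _ cq); apply: inL; last exact: skew_red_rectangle.
exact: generic_congr cq gp.
Qed.

(** [rescale] goes through a chosen representative, which is harmless since [golden] maps the
    lattice of side [s] onto the integer lattice. *)
Lemma rescaleE p : rescale (tproj (Gamma5 R) p) = tproj (GammaU R) (- f *: p).
Proof.
apply/tproj_eq; have /tproj_eq/rect_congr[m [n [e1 e2]]] := treprK (tproj (Gamma5 R) p).
have hf := golden_sqr R.
apply/rect_congr; exists (- m), (- n); rewrite !rmorphN /= /GRing.scale /= e1 e2 golden_inv.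
by rewrite /GRing.scale /=; split; ring: hf.
Qed.

(** The inverse of the rescaling is the multiplication by [1 - f], the inverse of [- f]. *)
Lemma coded_rescale (P : nat -> set (torus (Gamma5 R))) c :
  coded P (reflect_code c) -> coded (fun a => @rescale R @` P a) c.
Proof.
have hf := golden_sqr R; have bf := golden_bounds R.
have ks : inK (1 - f) by apply: inKB; [exact: inK1|exact: inKg].
have scale (a : R) (q : R * R) : a *: q = (a * q.1, a * q.2) by [].
move=> [oP hP].
have memE a q : (@rescale R @` P a) (tproj (GammaU R) q) <-> P a (tproj (Gamma5 R) ((1 - f) *: q)).
  split=> [[x Px]|h].
    rewrite -(treprK x) rescaleE => /tproj_eq/rect_congr[m [n [e1 e2]]].
    have -> // : tproj (Gamma5 R) ((1 - f) *: q) = x.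
    rewrite -(treprK x); apply/tproj_eq/rect_congr; exists m, n.
    by rewrite golden_inv !scale /= e1 e2 !scale /=; split; ring: hf.
  exists (tproj (Gamma5 R) ((1 - f) *: q)) => //; rewrite rescaleE; congr (tproj _).
  by rewrite [RHS]surjective_pairing !scale /=; congr pair; ring: hf.
split=> [a|p a gp].
  rewrite (_ : _ @` _ = tproj (GammaU R) @` [set q | P a (tproj (Gamma5 R) ((1 - f) *: q))]).
    apply: tproj_open; have := open_preimage_tproj (oP a).
    apply: (@open_comp _ _ (fun q : R * R => (1 - f) *: q)) => x _.
    exact: scaler_continuous.
  apply/seteqP; split=> [x hx|_ [q hq <-]]; last exact/memE.
  by exists (trepr x); [apply/memE; rewrite treprK|exact: treprK].
apply: (iff_trans (memE a p)); rewrite scale.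
apply: (iff_trans (hP _ _ _)); first by apply: genericM => //; lra.
rewrite /reflect_code /=.
have -> // : (- f * ((1 - f) * p.1), - f * ((1 - f) * p.2)) = p.
by rewrite [RHS]surjective_pairing /=; congr pair; ring: hf.
Qed.

End Base.

(** * The chain of inductions *)

Definition inducible (om : morphism2) : bool :=
  marked_words (words om) && pairwise radix_lt (words om).

Lemma all_inducible : [/\ [/\ inducible omega11, inducible omega9 & inducible omega7],
  [/\ inducible omega10, inducible omega8 & inducible omega0123] & inducible kappa].
Proof. by []. Qed.

Lemma morphism_words :
  [/\ [/\ omega11 = map hword (words omega11), omega9 = map hword (words omega9) &
       omega7 = map hword (words omega7)],
      [/\ omega10 = map vword (words omega10), omega8 = map vword (words omega8) &
       omega0123 = map vword (words omega0123)] &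
      kappa = map hword (words kappa)].
Proof. by []. Qed.

Section Chain.
Variable R : realType.
Local Notation f := (golden R).
Local Notation s := (f - 1).
Local Notation t := (2 - f).
Local Notation u := (2 * f - 3).

Lemma rotation_e1 (G : lattice R) v1 v2 (k : nat) p :
  rotation G v1 v2 (e1 *+ k) (tproj G p) = tproj G (p + v1 *~ k).
Proof.
have -> : e1 *+ k = (k%:Z, 0) by rewrite /e1; elim: k => // k IH; rewrite mulrSr IH -addn1.
by rewrite rotationE /= mulr0z addr0.
Qed.

Lemma rotation_e2 (G : lattice R) v1 v2 (k : nat) p :
  rotation G v1 v2 (e2 *+ k) (tproj G p) = tproj G (p + v2 *~ k).
Proof.
have -> : e2 *+ k = (0, k%:Z) by rewrite /e2; elim: k => // k IH; rewrite mulrSr IH -addn1.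
by rewrite rotationE /= mulr0z addr0.
Qed.

Lemma coded_e1 (G G' : lattice R) va vb va' vb' a b c c' om P : inducible om ->
  tower G G' va vb va' vb' (rectangle a b) c c' (words om) ->
  0 < a -> 0 < b -> inK a -> inK b -> periodic a b c' -> attained c' (size (words om)) ->
  coded P c -> coded (induced_on G' P (rotation G va vb) (rectangle a b) e1) c'.
Proof.
move=> /andP[mw rad] T a0 b0 ka kb per at_c cP.
apply: (coded_induced mw T cP) => //; first exact: open_rectangle.
  exact: rotation_e1.
exact: attained_rectangle.
Qed.

Lemma coded_e2 (G G' : lattice R) va vb va' vb' a b c c' om P : inducible om ->
  tower G G' va vb va' vb' (rectangle a b) c c' (words om) ->
  0 < a -> 0 < b -> inK a -> inK b -> periodic a b c' -> attained c' (size (words om)) ->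
  coded P c -> coded (induced_on G' P (rotation G vb va) (rectangle a b) e2) c'.
Proof.
move=> /andP[mw rad] T a0 b0 ka kb per at_c cP.
apply: (coded_induced mw T cP) => //; first exact: open_rectangle.
  exact: rotation_e2.
exact: attained_rectangle.
Qed.

Record all_coded : Prop := AllCoded {
  coded1 : coded (P1 R) code2;
  coded3 : coded (P3 R) code3;
  coded4 : coded (P4 R) code4;
  coded5 : coded (P5 R) code5;
  coded6 : coded (P6 R) code6;
  coded7 : coded (P7 R) code7;
  coded8 : coded (P8 R) code8 }.

Lemma all_codedP : all_coded.
Proof.
have bf := golden_bounds R.
have k1 : inK (1 : R) by exact: inK1.
have kf : inK f by exact: inKg.
have iE := golden_inv R; have i2E := golden_inv2 R; have i3E := golden_inv3 R.
have ks : inK f^-1 by rewrite iE; apply: inKB.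
have s0 : 0 < f^-1 by rewrite iE; lra.
have f0 : 0 < f by lra.
have T := all_towersP R; have A := all_attainedP R.
have [[g11 g9 g7] [g10 g8 g0] gk] := all_inducible.
(* The towers are established with [f - 1], [2 - f] and [2 * f - 3]; they are restated with the
   powers of [golden] used by the systems. *)
have T0 : tower (Gamma0 R) (Gamma1 R) (0, 1) (1, 0) (f^-1, f^-2) (1, 0)
    (rectangle f 1) code0 code2 (words omega0123) by rewrite iE i2E; exact: tower0.
have Tk : tower (Gamma1 R) (GammaU R) (1, 0) (0, f^-2) (f^-2, 0) (0, f^-2)
    (rectangle 1 1) code2 code3 (words kappa) by rewrite i2E; exact: towerk.
have T7 : tower (GammaU R) (Gamma4 R) (f^-2, 0) (0, f^-2) (- f^-3, 0) (0, f^-2)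
    (rectangle f^-1 1) code3 code4 (words omega7).
  by rewrite /Gamma4 iE i2E i3E; exact: tower7.
have T8 : tower (Gamma4 R) (Gamma5 R) (0, f^-2) (- f^-3, 0) (0, - f^-3) (- f^-3, 0)
    (rectangle f^-1 f^-1) code4 code5 (words omega8).
  by rewrite /Gamma4 /Gamma5 iE i2E i3E; exact: tower8.
have T9 : tower (GammaU R) (Gamma4 R) (f^-2, 0) (0, f^-2) (- f^-3, 0) (0, f^-2)
    (rectangle f^-1 1) code5h code6 (words omega9).
  by rewrite /Gamma4 iE i2E i3E; exact: tower9.
have T10 : tower (Gamma4 R) (Gamma5 R) (0, f^-2) (- f^-3, 0) (0, - f^-3) (- f^-3, 0)
    (rectangle f^-1 f^-1) code6 code7 (words omega10).
  by rewrite /Gamma4 /Gamma5 iE i2E i3E; exact: tower10.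
have T11 : tower (GammaU R) (Gamma4 R) (f^-2, 0) (0, f^-2) (- f^-3, 0) (0, f^-2)
    (rectangle f^-1 1) code7h code8 (words omega11).
  by rewrite /Gamma4 iE i2E i3E; exact: tower11.
have c1 : coded (P1 R) code2.
  exact: (coded_e2 g0 T0 f0 ltr01 kf k1 (tower_per' T0) (attained2 A) (coded0 R)).
have c3 : coded (P3 R) code3.
  exact: (coded_e1 gk Tk ltr01 ltr01 k1 k1 (tower_per' Tk) (attained3 A) c1).
have c4 : coded (P4 R) code4.
  exact: (coded_e1 g7 T7 s0 ltr01 ks k1 (tower_per' T7) (attained4 A) c3).
have c5 : coded (P5 R) code5.
  exact: (coded_e2 g8 T8 s0 s0 ks ks (tower_per' T8) (attained5 A) c4).
have c6 : coded (P6 R) code6.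
  exact: (coded_e1 g9 T9 s0 ltr01 ks k1 (tower_per' T9) (attained6 A) (coded_rescale c5)).
have c7 : coded (P7 R) code7.
  exact: (coded_e2 g10 T10 s0 s0 ks ks (tower_per' T10) (attained7 A) c6).
have c8 : coded (P8 R) code8.
  exact: (coded_e1 g11 T11 s0 ltr01 ks k1 (tower_per' T11) (attained8 A) (coded_rescale c7)).
exact: (AllCoded c1 c3 c4 c5 c6 c7 c8).
Qed.

(** Multiplication by [- f] sends the translation by [- u] to the one by [t]: a rescaling leaves the
    shift unchanged, which is why no morphism corresponds to it. *)
Lemma reflect_shift c : coded_shift (reflect_code c) (- u, 0) (0, - u) =
  coded_shift c (t, 0) (0, t).
Proof.
have hf := golden_sqr R; have bf := golden_bounds R.
have ks : inK (1 - f) by apply: inKB; [exact: inK1|exact: inKg].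
have kf : inK (- f) by apply: inKN; exact: inKg.
have shift (v w : R) p (i j : int) : p + (v, 0) *~ i + (0, w) *~ j =
    (p.1 + v *~ i, p.2 + w *~ j) :> R * R.
  by rewrite !mulrz_pair /= !mul0rz [LHS]surjective_pairing /= !addr0.
have mz (a b : R) (i : int) : a * (b *~ i) = (a * b) *~ i by rewrite mulrzAr.
apply/seteqP; split=> x hx N; have [p gp hp] := hx N.
  exists (- f * p.1, - f * p.2); first by apply: genericM => //; lra.
  move=> i j hi hj; rewrite -hp // !shift /reflect_code /=; congr (c _).
  by rewrite !mulrDr !mz; congr pair; congr (_ + _ *~ _); ring: hf.
exists ((1 - f) * p.1, (1 - f) * p.2); first by apply: genericM => //; lra.
move=> i j hi hj; rewrite -hp // !shift /reflect_code /=; congr (c _).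
by rewrite !mulrDr !mz; congr pair; congr (_ + _ *~ _); ring: hf.
Qed.

(** Modulo [f] the abscissa [s] is -1: the translation by [(s, t)] is the one by [(0, t)] combined
    with a step to the left, hence the shear [theta]. *)
Lemma theta_shift c : periodic f 1 c ->
  coded_shift c (1, 0) (s, t) = theta @` coded_shift c (1, 0) (0, t).
Proof.
move=> per.
have shift (v : R) p (i j : int) : p + (1, 0) *~ i + (v, t) *~ j =
    (p.1 + i%:~R + v *~ j, p.2 + t *~ j) :> R * R.
  by rewrite !mulrz_pair /= !mul0rz [LHS]surjective_pairing /= addr0.
have mz (a : R) (i : int) : a *~ i = a * i%:~R by rewrite mulrzr.
have codeE p (i j : int) : c (p + (1, 0) *~ i + (s, t) *~ j) =
    c (p + (1, 0) *~ (i - j) + (0, t) *~ j).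
  apply: per; apply/rect_congr; exists (- j), 0; rewrite !shift /= mul0r addr0; split=> //.
  by rewrite mz !rmorphN rmorphB /=; ring.
apply/seteqP; split=> [x hx|_ [y hy <-] N].
  exists (fun n => x (n.1 + n.2, n.2)) => [N|].
    (* The shear moves a box of size [N] into the box of size [N + N]. *)
    have [p gp hp] := hx (N + N)%N; exists p => // i j hi hj.
    have h1 : (absz (i + j)%R <= N + N)%N by lia.
    have h2 : (absz j <= N + N)%N by lia.
    by rewrite -(hp _ _ h1 h2) codeE addrK.
  by apply/funext => -[i j]; rewrite /theta /= subrK.
have [p gp hp] := hy (N + N)%N; exists p => // i j hi hj.
have h1 : (absz (i - j)%R <= N + N)%N by lia.
have h2 : (absz j <= N + N)%N by lia.
by rewrite codeE (hp _ _ h1 h2).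
Qed.

Lemma tile_code_lt (p : R * R) : generic p -> (tile_code p < 19)%N.
Proof.
move=> gp; have k1 : inK (1 : R) by exact: inK1.
have cq := redr_congr 1 1 p; have Wq := redr_rectangle gp k1 k1 ltr01 ltr01.
have gq : generic (redr 1 1 p) by apply: generic_congr cq gp; split=> //; exact: inK0.
have [a h hp] := tile_exists gq Wq.
by rewrite (periodic_tile_code cq) (tile_codeE gq Wq h hp).
Qed.

Lemma rho_inverse : all (fun a => index (rho a) [seq rho b | b <- iota 0 19] == a) (iota 0 19).
Proof. by []. Qed.

(** The mirror [flip] intertwines the two rotations, and [rho] is injective on the 19 letters. *)
Lemma relabel_shift : coded_shift code8 (- u, 0) (0, t) =
  relabel rho @` coded_shift (@tile_code R) (t, 0) (0, t).
Proof.
have hf := golden_sqr R; have bf := golden_bounds R.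
have k1 : inK (1 : R) by exact: inK1.
have k0 : inK (0 : R) by exact: inK0.
have kf : inK (- f) by apply: inKN; exact: inKg.
have ks : inK (1 - f) by apply: inKB => //; exact: inKg.
have shift (v : R) p (i j : int) : p + (v, 0) *~ i + (0, t) *~ j =
    (p.1 + v *~ i, p.2 + t *~ j) :> R * R.
  by rewrite !mulrz_pair /= !mul0rz [LHS]surjective_pairing /= !addr0.
have kt : inK2 (t, 0) /\ inK2 (0, t).
  by split; split=> //; apply: inKB; [exact: inK_nat|exact: inKg|exact: inK_nat|exact: inKg].
pose flip p : R * R := (1 - f * p.1, p.2).
have mz (a : R) (i : int) : a *~ i = a * i%:~R by rewrite mulrzr.
have code8E p (i j : int) : code8 (p + (- u, 0) *~ i + (0, t) *~ j) =
    rho (tile_code (flip p + (t, 0) *~ i + (0, t) *~ j)).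
  rewrite !shift /code8 /flip /=; congr (rho (tile_code (_, _))).
  by rewrite (mz (- u)) (mz t); ring: hf.
have gflip p : generic p -> generic (flip p).
  move=> gp; have -> : flip p = (- f * p.1, 1 * p.2) + (1, 0).
    by rewrite [RHS]surjective_pairing /flip /=; congr pair; ring.
  by apply: genericD => //; apply: genericM => //; lra.
apply/seteqP; split=> [x hx|_ [y hy <-] N].
  pose g b := index b [seq rho b | b <- iota 0 19].
  have gK a : (a < 19)%N -> g (rho a) = a.
    by move=> h; apply/eqP; apply: (allP rho_inverse); rewrite mem_iota.
  have rep N : exists2 p, generic p & forall i j : int, (absz i <= N)%N -> (absz j <= N)%N ->
      x (i, j) = rho (tile_code (p + (t, 0) *~ i + (0, t) *~ j)).
    have [p gp hp] := hx N; exists (flip p); first exact: gflip.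
    by move=> i j hi hj; rewrite -hp.
  have gen p (i j : int) : generic p -> generic (p + (t, 0) *~ i + (0, t) *~ j).
    by case: kt => *; apply: genericD; [apply: genericD|]; rewrite //; apply: inK2i.
  exists (fun n => g (x n)) => [N|].
    have [p gp hp] := rep N; exists p => // i j hi hj.
    by rewrite hp // gK //; apply: tile_code_lt; apply: gen.
  apply/funext => -[i j]; rewrite /relabel.
  have [p gp hp] := rep (absz i + absz j)%N.
  by rewrite hp ?leq_addr ?leq_addl // gK //; apply: tile_code_lt; apply: gen.
have [p gp hp] := hy N.
exists ((1 - f) * (p.1 - 1), p.2).
  have -> : ((1 - f) * (p.1 - 1), p.2) = ((1 - f) * p.1, 1 * p.2) + (f - 1, 0).
    by rewrite [RHS]surjective_pairing /=; congr pair; ring.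
  apply: genericD; last by split=> //; apply: inKB => //; exact: inKg.
  by apply: genericM => //; lra.
have fl : flip ((1 - f) * (p.1 - 1), p.2) = p.
  by rewrite [RHS]surjective_pairing /flip /=; congr pair; ring: hf.
by move=> i j hi hj; rewrite code8E fl /relabel (hp i j hi hj).
Qed.

Lemma all_marked : [/\ [/\ marked_words (words omega11), marked_words (words omega9) &
    marked_words (words omega7)],
  [/\ marked_words (words omega10), marked_words (words omega8) &
    marked_words (words omega0123)] & marked_words (words kappa)].
Proof.
have [[/andP[h11 _] /andP[h9 _] /andP[h7 _]] [/andP[h10 _] /andP[h8 _] /andP[h0 _]] /andP[hk _]] :=
  all_inducible.
by split; [exact: And3 h11 h9 h7|exact: And3 h10 h8 h0|exact: hk].
Qed.

Record omega_shifts : Prop := OmegaShifts {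
  shift12 : coded_shift code8 (- u, 0) (0, t) = Omega12;
  shift11 : coded_shift code7 (- u, 0) (0, - u) = Omega11;
  shift10 : coded_shift code6 (- u, 0) (0, t) = Omega10;
  shift9 : coded_shift code5 (- u, 0) (0, - u) = Omega9;
  shift8 : coded_shift code4 (- u, 0) (0, t) = Omega8;
  shift7 : coded_shift code3 (t, 0) (0, t) = Omega7;
  shift5 : coded_shift code2 (1, 0) (s, t) = jOmega5;
  shift0 : coded_shift (@code0 R) (1, 0) (0, 1) = X0 }.

Lemma omega_shiftsP : coded_shift (@tile_code R) (t, 0) (0, t) = OmegaU -> omega_shifts.
Proof.
move=> eU; have T := all_towersP R.
have [[m11 m9 m7] [m10 m8 m0] mk] := all_marked.
have [[w11 w9 w7] [w10 w8 w0] wk] := morphism_words.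
have h12 : coded_shift code8 (- u, 0) (0, t) = Omega12 by rewrite relabel_shift eU.
have h11 : coded_shift code7 (- u, 0) (0, - u) = Omega11.
  by rewrite /code7 reflect_shift (tower_shift_h m11 (tower11 T)) -w11 h12.
have h10 : coded_shift code6 (- u, 0) (0, t) = Omega10.
  by rewrite (tower_shift_v m10 (tower10 T)) -w10 h11.
have h9 : coded_shift code5 (- u, 0) (0, - u) = Omega9.
  by rewrite /code5 reflect_shift (tower_shift_h m9 (tower9 T)) -w9 h10.
have h8 : coded_shift code4 (- u, 0) (0, t) = Omega8.
  by rewrite (tower_shift_v m8 (tower8 T)) -w8 h9.
have h7 : coded_shift code3 (t, 0) (0, t) = Omega7.
  by rewrite (tower_shift_h m7 (tower7 T)) -w7 h8.
have h5 : coded_shift code2 (1, 0) (s, t) = jOmega5.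
  have per : periodic f 1 code2 := tower_per (towerk T).
  by rewrite (theta_shift per) (tower_shift_h mk (towerk T)) -wk h7.
have h0 : coded_shift (@code0 R) (1, 0) (0, 1) = X0.
  by rewrite (tower_shift_v m0 (tower0 T)) -w0 h5.
exact: (OmegaShifts h12 h11 h10 h9 h8 h7 h5 h0).
Qed.

End Chain.

(** * Images of valid words *)

Section Words.
Local Open Scope nat_scope.

Definition same_color (c c' : option Ascii.ascii) : bool :=
  match c, c' with
  | Some x, Some y => Ascii.eqb x y
  | None, None => true
  | _, _ => false
  end.

Lemma same_colorP c c' : reflect (c = c') (same_color c c').
Proof.
case: c c' => [x|] [y|] /=; try by constructor.
by apply: (iffP idP) => [/Ascii.eqb_eq ->|[->]] //; apply/Ascii.eqb_eq.
Qed.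

(* [hc a b]: the tile [b] fits on the right of the tile [a]; [vc a b]: on top of it. *)
Definition hc (a b : nat) : bool :=
  [&& a < 19, b < 19 & same_color (right_color a) (left_color b)].
Definition vc (a b : nat) : bool :=
  [&& a < 19, b < 19 & same_color (top_color a) (bottom_color b)].

Definition im (a : nat) : word2 := image_of_letter omegaU a.

Definition valid_column (c : seq nat) : bool :=
  [&& 0 < size c, all (gtn 19) c & sorted vc c].
Definition valid (u : word2) : bool :=
  [&& 0 < size u, all valid_column u & sorted (all2 hc) u].

(* On valid words the relation [word_image omegaU] is the graph of [img]. *)
Definition col_image (c : seq nat) : word2 :=
  [seq flatten [seq nth [::] (im a) k | a <- c] | k <- iota 0 (size (im (head 0 c)))].
Definition img (u : word2) : word2 := flatten (map col_image u).

Lemma im_valid : all (fun a => valid (im a)) (iota 0 19).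
Proof. by []. Qed.

(** With [hc_im], a finite check that the morphism respects matching: images of stacked tiles have
    equal widths and facing letters that stack. *)
Lemma vc_im : all (fun a => all (fun b => vc a b ==> (size (im a) == size (im b)) &&
  all (fun k => vc (last 0 (nth [::] (im a) k)) (head 0 (nth [::] (im b) k)))
    (iota 0 (size (im a)))) (iota 0 19)) (iota 0 19).
Proof. by []. Qed.

Lemma hc_im : all (fun a => all (fun b => hc a b ==>
  all2 hc (last [::] (im a)) (head [::] (im b))) (iota 0 19)) (iota 0 19).
Proof. by []. Qed.

Lemma mem_letters a : (a \in iota 0 19) = (a < 19).
Proof. by rewrite mem_iota. Qed.

Lemma imP a : a < 19 -> valid (im a).
Proof. by rewrite -mem_letters => /(allP im_valid). Qed.

Lemma im_gt0 a : a < 19 -> 0 < size (im a).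
Proof. by move=> /imP/andP[]. Qed.

Lemma im_column a k : a < 19 -> k < size (im a) -> valid_column (nth [::] (im a) k).
Proof. by move=> /imP/and3P[_ /allP h _] hk; apply: h; apply: mem_nth. Qed.

Lemma vcP a b : vc a b -> size (im a) = size (im b) /\ forall k, k < size (im a) ->
  vc (last 0 (nth [::] (im a) k)) (head 0 (nth [::] (im b) k)).
Proof.
move=> h; have /and3P[a19 b19 _] := h.
have := allP (allP vc_im a _) b; rewrite !mem_letters => /(_ a19 b19); rewrite h.
by move=> /andP[/eqP-> /allP e]; split=> // k hk; apply: e; rewrite mem_iota.
Qed.

Lemma hcP a b : hc a b -> all2 hc (last [::] (im a)) (head [::] (im b)).
Proof.
move=> h; have /and3P[a19 b19 _] := h.
by have := allP (allP hc_im a _) b; rewrite !mem_letters => /(_ a19 b19); rewrite h.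
Qed.

Lemma sorted_flatten (T : Type) (e : rel T) (x0 : T) (ss : seq (seq T)) :
  all (fun s => (0 < size s) && sorted e s) ss ->
  sorted (fun s s' => e (last x0 s) (head x0 s')) ss -> sorted e (flatten ss).
Proof.
elim: ss => [|[|x s] ss IH] //= /andP[hs hss] he.
rewrite cat_path hs; have := IH hss (path_sorted he).
by case: ss hss he {IH} => [|[|y s'] ss] //= _ /andP[-> _] ->.
Qed.

Lemma all2_cat (T : Type) (e : rel T) (s1 s1' s2 s2' : seq T) : size s1 = size s1' ->
  all2 e (s1 ++ s2) (s1' ++ s2') = all2 e s1 s1' && all2 e s2 s2'.
Proof. by elim: s1 s1' => [|a s IH] [|b s'] //= [/IH ->]; rewrite andbA. Qed.

Lemma all2_size (T : Type) (e : rel T) (s s' : seq T) : all2 e s s' -> size s = size s'.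
Proof. by elim: s s' => [|a s IH] [|b s'] //= /andP[_ /IH ->]. Qed.

Lemma all2_flatten (T : Type) (e : rel T) (ss ss' : seq (seq T)) :
  all2 (all2 e) ss ss' -> all2 e (flatten ss) (flatten ss').
Proof.
elim: ss ss' => [|s ss IH] [|s' ss'] //= /andP[h /IH h'].
by rewrite all2_cat ?h //; apply: all2_size h.
Qed.

Lemma column_widths c : valid_column c -> all (fun a => size (im a) == size (im (head 0 c))) c.
Proof.
case/and3P; case: c => // a c _ _ /=; rewrite eqxx /=.
elim: c a => //= b c IH a /andP[/vcP[e _] /IH h].
by rewrite e eqxx; apply: sub_all h => d /eqP ->.
Qed.

Lemma valid_column_image c k : valid_column c -> k < size (im (head 0 c)) ->
  valid_column (flatten [seq nth [::] (im a) k | a <- c]).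
Proof.
move=> vcol hk; have /allP wd := column_widths vcol.
have /and3P[c0 /allP c19 sc] := vcol.
have col a : a \in c -> valid_column (nth [::] (im a) k).
  by move=> ac; apply: im_column; [exact: c19|rewrite (eqP (wd a ac))].
apply/and3P; split.
- case: c c0 col {vcol hk wd c19 sc} => //= a c _ col; rewrite size_cat addn_gt0.
  by have /and3P[-> _ _] := col a (mem_head _ _).
- apply/allP => x /flattenP[_ /mapP[a ac ->]].
  by have /and3P[_ /allP h _] := col a ac; apply: h.
apply: (@sorted_flatten _ _ 0).
  by apply/allP => _ /mapP[a ac ->]; have /and3P[-> _] := col a ac.
rewrite sorted_map; apply: (@sub_in_sorted _ (mem c) vc) sc; last exact/allP.
by move=> a b ac bc /= /vcP[_]; apply; rewrite (eqP (wd a ac)).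
Qed.

Lemma all2_valid_flatten c k k' : valid_column c ->
  (forall a, a \in c -> all2 hc (nth [::] (im a) k) (nth [::] (im a) k')) ->
  all2 hc (flatten [seq nth [::] (im a) k | a <- c]) (flatten [seq nth [::] (im a) k' | a <- c]).
Proof.
move=> _ h; apply: all2_flatten; elim: c h => //= a c IH h.
by rewrite h ?mem_head //=; apply: IH => b bc; apply: h; rewrite inE bc orbT.
Qed.

Lemma size_col_image c : size (col_image c) = size (im (head 0 c)).
Proof. by rewrite size_map size_iota. Qed.

Lemma nth_col_image c k : k < size (im (head 0 c)) ->
  nth [::] (col_image c) k = flatten [seq nth [::] (im a) k | a <- c].
Proof. by move=> hk; rewrite (nth_map 0) ?size_iota // nth_iota. Qed.

Lemma head_lt c : valid_column c -> head 0 c < 19.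
Proof. by case: c => [|a c] /and3P[] //= _ /andP[]. Qed.

Lemma valid_col_image c : valid_column c -> valid (col_image c).
Proof.
move=> vcol; have h19 := head_lt vcol; apply/and3P; split.
- by rewrite size_col_image im_gt0.
- apply/(all_nthP [::]) => k; rewrite size_col_image => hk.
  by rewrite nth_col_image //; apply: valid_column_image.
apply/(sortedP [::]) => k; rewrite size_col_image => hk.
rewrite !nth_col_image ?(ltnW hk) //; apply: all2_valid_flatten => // a ac.
have /allP wd := column_widths vcol.
have /and3P[_ /allP c19 _] := vcol.
have /and3P[_ _ /(sortedP [::])] := imP (c19 a ac).
by apply; rewrite (eqP (wd a ac)).
Qed.

Lemma all2_map_in (S T : Type) (r : S -> S -> bool) (e : T -> T -> bool) (f g : S -> T) s s' :
  (forall a b, r a b -> e (f a) (g b)) -> all2 r s s' -> all2 e (map f s) (map g s').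
Proof.
move=> h; elim: s s' => [|a s IH] [|b s'] //= /andP[/h -> /IH ->] //.
Qed.

Lemma valid_img u : valid u -> valid (img u).
Proof.
case/and3P => u0 /allP cu su; apply/and3P; split.
- case: u u0 cu su => //= c u _ cu _; rewrite /img /= size_cat size_col_image addn_gt0.
  by rewrite im_gt0 // head_lt // cu ?mem_head.
- apply/allP => x /flattenP[_ /mapP[c ucl ->]].
  by have /and3P[_ /allP h _] := valid_col_image (cu c ucl); apply: h.
apply: (@sorted_flatten _ _ [::]).
  by apply/allP => _ /mapP[c ucl ->]; have /and3P[-> _] := valid_col_image (cu c ucl).
rewrite sorted_map; apply: (@sub_in_sorted _ (mem u) (all2 hc)) su; last exact/allP.
move=> c c' uc uc' /= cc'.
have [v v'] := (cu c uc, cu c' uc').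
have /allP wd := column_widths v; have /allP wd' := column_widths v'.
rewrite -nth_last -nth0 !nth_col_image ?size_col_image ?im_gt0 ?head_lt //; last first.
  by rewrite prednK // im_gt0 // head_lt.
have -> : [seq nth [::] (im a) (size (im (head 0 c))).-1 | a <- c] =
    [seq last [::] (im a) | a <- c].
  by apply/eq_in_map => a ac; rewrite -(eqP (wd a ac)) nth_last.
have -> : [seq nth [::] (im a) 0 | a <- c'] = [seq head [::] (im a) | a <- c'].
  by apply: eq_map => a; rewrite nth0.
by apply: all2_flatten; apply: all2_map_in cc' => a b; apply: hcP.
Qed.

(** [hcat] and [vcat] act on arbitrary lists of columns, and [zip] truncates; under this invariant
    they are genuine concatenations. *)
Definition rectangular_word (u : word2) : bool :=
  [&& 0 < size u, 0 < height u & all (fun c => size c == height u) u].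

Lemma valid_rectangular u : valid u -> rectangular_word u.
Proof.
case/and3P; case: u => //= c u _ /andP[/and3P[c0 _ _] _] su.
rewrite /rectangular_word /= c0 /height /= eqxx /=.
elim: u c su {c0} => //= d u IH c /andP[/all2_size -> /IH ->].
by rewrite eqxx.
Qed.

Lemma word_image_rectangular u u' : word_image omegaU u u' -> rectangular_word u.
Proof.
elim=> [//|{}u v {}u' v' e _ /and3P[u0 hu au] _ /and3P[v0 hv av] _|
  {}u v {}u' v' e _ /and3P[u0 hu au] _ /and3P[v0 hv av] _].
  case: u u0 hu au e => //= c u _ hu au e.
  rewrite /height /= in e au hu av.
  rewrite /rectangular_word /hcat /height /= all_cat hu; case/andP: au => -> -> /=.
  by rewrite e.
case: u u0 hu au e => //= c u _ hu /andP[_ au]; case: v v0 hv av => //= d v _ hv /andP[_ av] [e].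
rewrite /rectangular_word /vcat /height /= !size_cat eqxx /= addn_gt0 hu /=.
rewrite /height /= in au av.
elim: u v e au av {hu hv} => [|c' u IH] [|d' v] //= [e] /andP[/eqP hc hu] /andP[/eqP hd hv].
by rewrite size_cat hc hd eqxx /=; apply: IH.
Qed.

Lemma img_cat u v : img (u ++ v) = img u ++ img v.
Proof. by rewrite /img map_cat flatten_cat. Qed.

Lemma valid_column_catl c d : 0 < size c -> valid_column (c ++ d) -> valid_column c.
Proof.
move=> c0 /and3P[_]; rewrite all_cat => /andP[h _] sc; apply/and3P; split=> //.
by move: sc; case: c c0 {h} => //= a c _; rewrite cat_path => /andP[].
Qed.

Lemma valid_column_catr c d : 0 < size d -> valid_column (c ++ d) -> valid_column d.
Proof.
move=> d0 /and3P[_]; rewrite all_cat => /andP[_ h] sc; apply/and3P; split=> //.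
by move: sc => /cat_sorted2[].
Qed.

Lemma col_image_cat c d : 0 < size c -> 0 < size d -> valid_column (c ++ d) ->
  col_image (c ++ d) = vcat (col_image c) (col_image d).
Proof.
move=> c0 d0 h; have /allP wd := column_widths h.
have hcd : head 0 (c ++ d) = head 0 c by case: c c0 {h wd}.
have e : size (im (head 0 d)) = size (im (head 0 c)).
  rewrite -hcd; apply/eqP/wd; rewrite mem_cat orbC.
  by case: d d0 {h wd hcd} => //= b d _; rewrite mem_head.
rewrite /vcat /col_image hcd e zip_map -map_comp; apply: eq_map => k /=.
by rewrite map_cat flatten_cat.
Qed.

Lemma vcat_cat u v u' v' : size u = size u' -> vcat (u ++ v) (u' ++ v') = vcat u u' ++ vcat v v'.
Proof. by move=> e; rewrite /vcat zip_cat // map_cat. Qed.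

Lemma img_vcat u v : size u = size v -> all (fun c => 0 < size c) u ->
  all (fun c => 0 < size c) v -> all valid_column (vcat u v) ->
  img (vcat u v) = vcat (img u) (img v).
Proof.
elim: u v => [|c u IH] [|d v] //= [e] /andP[c0 u0] /andP[d0 v0] /andP[h hs].
rewrite [LHS]/(col_image (c ++ d) ++ img (vcat u v)) IH // col_image_cat //.
rewrite [in RHS]/img /= vcat_cat // !size_col_image.
have /allP wd := column_widths h.
have hcd : head 0 (c ++ d) = head 0 c by case: c c0 {h hs wd}.
rewrite -hcd; apply/esym/eqP/wd; rewrite mem_cat orbC.
by case: d d0 {h hs wd hcd} => //= b d _; rewrite mem_head.
Qed.

Lemma img_letter a : img (letter a) = im a.
Proof.
rewrite /img /= cats0 /col_image /=.
by rewrite (eq_map (g := nth [::] (im a))) ?map_nth_iota0 ?take_size // => k; rewrite cats0.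
Qed.

Lemma valid_hcat u v : 0 < size u -> 0 < size v -> valid (u ++ v) -> valid u /\ valid v.
Proof.
move=> u0 v0 /and3P[_]; rewrite all_cat => /andP[au av] s.
have [su sv] := cat_sorted2 s.
by split; apply/and3P.
Qed.

Lemma rectangular_columns u : rectangular_word u -> all (fun c => 0 < size c) u.
Proof. by case/and3P => _ h; apply: sub_all => c /eqP ->. Qed.

Lemma valid_vcat u v : size u = size v -> rectangular_word u -> rectangular_word v ->
  valid (vcat u v) -> valid u /\ valid v.
Proof.
move=> e ru rv; have pu := rectangular_columns ru; have pv := rectangular_columns rv.
move: ru rv; rewrite /rectangular_word => /and3P[u0 _ hu] /and3P[v0 _ hv].
move: (height u) (height v) hu hv => n m hu hv.
case/and3P=> _ av sv; rewrite /valid u0 v0 /=.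
elim: u v e pu pv u0 v0 hu hv av sv => [|c u IH] [|d v] //= [e] /andP[c0 pu] /andP[d0 pv] _ _.
move=> /andP[/eqP nc hu] /andP[/eqP md hv] /andP[h av] sv.
rewrite (valid_column_catl c0 h) (valid_column_catr d0 h) /=.
case: u v IH e pu pv hu hv av sv => [|c' u] [|d' v] //= IH e pu pv hu hv av /andP[].
have [/andP[/eqP nc' _] /andP[/eqP md' _]] := (hu, hv).
rewrite all2_cat ?nc ?nc' // => /andP[-> ->] sv /=.
exact: (IH (d' :: v)).
Qed.

Lemma word_image_img u : valid u -> word_image omegaU u (img u).
Proof.
have colP c : valid_column c -> word_image omegaU [:: c] (col_image c).
  elim: c => // a [|b c] IH vcol.
    have a19 : a < 19 by case/and3P: vcol => _ /andP[].
    have -> : col_image [:: a] = im a by rewrite -img_letter /img /= cats0.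
    exact: WordImageLetter.
  have /and3P[_ /andP[a19 _] /andP[/vcP[e _] _]] := vcol.
  have vcol' : valid_column (b :: c) by apply: (@valid_column_catr [:: a]).
  have -> : [:: [:: a, b & c]] = vcat (letter a) [:: b :: c] by [].
  have -> : col_image [:: a, b & c] = vcat (im a) (col_image (b :: c)).
    rewrite -[_ :: _]/([:: a] ++ _) col_image_cat //; congr (vcat _ _).
    by rewrite -img_letter /img /= cats0.
  apply: WordImageV => //; [exact: WordImageLetter|exact: IH|].
  by rewrite /width size_col_image.
elim: u => // c [|d u] IH vu.
  by rewrite /img /= cats0; apply: colP; case/and3P: vu => _ /andP[].
have [vc' vu'] : valid [:: c] /\ valid (d :: u) by apply: valid_hcat.
have vcol : valid_column c by case/and3P: vu => _ /andP[].
rewrite -[_ :: _]/([:: c] ++ _) img_cat.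
apply: (@WordImageH omegaU [:: c] (d :: u) (img [:: c]) (img (d :: u))).
- by case/and3P: vu => _ _ /andP[/all2_size].
- by rewrite /img /= cats0; apply: colP.
- exact: IH.
have := valid_img vu; rewrite -[_ :: _]/([:: c] ++ _) img_cat => /valid_rectangular/and3P[_ _].
rewrite all_cat => /andP[_ /allP h]; have /and3P[i0 _ _] := valid_img vu'.
have /and3P[i1 _ _] := valid_img vc'.
have /eqP : size (head [::] (img (d :: u))) == height (img [:: c] ++ img (d :: u)).
  by apply: h; case: (img (d :: u)) i0 => // x s _; rewrite mem_head.
by rewrite /height => ->; case: (img [:: c]) i1.
Qed.

(** A word can be cut in many ways in the derivations of [word_image]; on valid words each of them
    computes [img]. *)
Lemma word_image_det u u' : word_image omegaU u u' -> valid u -> u' = img u.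
Proof.
elim=> [a _ _|{}u v {}u' v' e hu IHu hv IHv _|{}u v {}u' v' e hu IHu hv IHv _].
- by rewrite img_letter.
- have /and3P[u0 _ _] := word_image_rectangular hu.
  have /and3P[v0 _ _] := word_image_rectangular hv.
  by move=> /(valid_hcat u0 v0)[/IHu -> /IHv ->]; rewrite /hcat img_cat.
have ru := word_image_rectangular hu; have rv := word_image_rectangular hv.
move=> h; have [vu vv] := valid_vcat e ru rv h.
rewrite (IHu vu) (IHv vv) img_vcat //; try exact: rectangular_columns.
by case/and3P: h.
Qed.

Lemma valid_letter a : a < 19 -> valid (letter a).
Proof. by rewrite /valid /valid_column /= => ->. Qed.

Lemma valid_iter k a : a < 19 -> valid (iter k img (letter a)).
Proof. by move=> ha; elim: k => [|k IH]; [exact: valid_letter|exact: valid_img]. Qed.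

Lemma iter_image_lt k a v : iter_image omegaU k a v -> a < 19.
Proof. by elim: k v => [v []|k IH v [u /IH]]. Qed.

Lemma iter_imageP k a v : a < 19 -> iter_image omegaU k a v <-> v = iter k img (letter a).
Proof.
move=> ha; elim: k v => [|k IH] v /=; first by split=> [[]|->].
split=> [[u /IH -> /word_image_det]|->]; first by apply; exact: valid_iter.
by exists (iter k img (letter a)); [exact/IH|apply: word_image_img; exact: valid_iter].
Qed.

(** Widths are read on the bottom row and heights on the left column, each of which undergoes a
    one-dimensional substitution. *)
Definition row_image (r : seq nat) : seq nat := flatten [seq map (head 0) (im a) | a <- r].
Definition side_image (c : seq nat) : seq nat := flatten [seq head [::] (im a) | a <- c].

Lemma heads_img u : valid u -> map (head 0) (img u) = row_image (map (head 0) u).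
Proof.
case/and3P=> _ /allP h _; rewrite /img /row_image map_flatten -!map_comp; congr flatten.
apply/eq_in_map => c /h vcol /=; have h19 := head_lt vcol.
have e : im (head 0 c) = [seq nth [::] (im (head 0 c)) k | k <- iota 0 (size (im (head 0 c)))].
  by rewrite map_nth_iota0 // take_size.
rewrite [in RHS]e -!map_comp.
apply/eq_in_map => k; rewrite mem_iota add0n => /andP[_ hk].
have /and3P[c0 _ _] := im_column h19 hk.
case: c c0 vcol {h19 hk e} => [|a c] //= a0 _.
by case: (nth [::] (im a) k) a0.
Qed.

Lemma head_img u : valid u -> head [::] (img u) = side_image (head [::] u).
Proof.
case: u => // c u /and3P[_ /andP[vcol _] _]; have := im_gt0 (head_lt vcol).
rewrite /img /= -size_col_image; case e : (col_image c) => [|d v] //= _.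
have -> : d = nth [::] (col_image c) 0 by rewrite e.
by rewrite nth_col_image ?im_gt0 ?head_lt.
Qed.

(** Two steps are taken because some letters have an image of width or height 1. *)
Lemma flatten_double (g : nat -> seq nat) r : all (gtn 19) r ->
  all (fun a => 1 < size (flatten (map g (g a)))) (iota 0 19) ->
  2 * size r <= size (flatten (map g (flatten (map g r)))).
Proof.
move=> hr /allP hg; elim: r hr => // a r IH /andP[a19 /IH h] /=.
rewrite map_cat flatten_cat size_cat mulnS leq_add //.
by apply: hg; rewrite mem_letters.
Qed.

Lemma heads_lt u : valid u -> all (gtn 19) (map (head 0) u).
Proof.
by case/and3P=> _ h _; apply/allP => _ /mapP[c /(allP h) vcol ->]; apply: head_lt.
Qed.

Lemma size_img_img u : valid u -> 2 * size u <= size (img (img u)).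
Proof.
move=> vu; rewrite -(size_map (head 0)) -(size_map (head 0) (img _)).
rewrite heads_img ?valid_img // heads_img //; apply: flatten_double => //.
exact: heads_lt.
Qed.

Lemma height_img_img u : valid u -> 2 * height u <= height (img (img u)).
Proof.
move=> vu; rewrite /height head_img ?valid_img // head_img //; apply: flatten_double => //.
by case: u vu => // c u /and3P[_ /andP[/and3P[]]].
Qed.

Lemma iter_img_size k a : a < 19 ->
  2 ^ k <= size (iter (k + k) img (letter a)) /\ 2 ^ k <= height (iter (k + k) img (letter a)).
Proof.
move=> ha; elim: k => // k [IH1 IH2]; rewrite addSn addnS !iterS expnS.
have v := valid_iter (k + k) ha; split.
- by apply: leq_trans (size_img_img v); rewrite leq_mul2l.
- by apply: leq_trans (height_img_img v); rewrite leq_mul2l.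
Qed.

Lemma expansive_omegaU : expansive omegaU.
Proof.
move=> a K ha; exists (K + K), (iter (K + K) img (letter a)); have [h1 h2] := iter_img_size K ha.
by split; [exact/iter_imageP|exact: leq_trans (ltn_expl _ _) h1|exact: leq_trans (ltn_expl _ _) h2].
Qed.

End Words.

(** * Squares and desubstitution *)

Section Squares.
Local Open Scope nat_scope.

(** Bottom row first, then top row, each from left to right. *)
Definition square := ((nat * nat) * (nat * nat))%type.

Definition squares0 : seq square :=
  let l := iota 0 19 in
  flatten [seq flatten [seq [seq ((a, b), (cd.1, cd.2)) |
      cd <- [seq (c, d) | c <- [seq c <- l | vc a c], d <- [seq d <- l | vc b d]] & hc cd.1 cd.2] |
    b <- [seq b <- l | hc a b]] | a <- l].

Definition hglue (q r : square) : bool := (q.1.2 == r.1.1) && (q.2.2 == r.2.1).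
Definition vglue (q r : square) : bool := q.2 == r.1.

(** Keeps the squares that extend to a pattern of size 3 towards the south-east with all its squares
    in [S]; this discards squares that match locally but cannot be continued. *)
Definition refine_se (S : seq square) : seq square :=
  [seq q <- S | has (fun q1 => has (fun q2 => has (hglue q2) [seq r <- S | vglue r q1])
     [seq r <- S | vglue r q]) [seq r <- S | hglue q r]].
Definition refine_nw (S : seq square) : seq square :=
  [seq q <- S | has (fun q1 => has (fun q2 => has (hglue^~ q2) [seq r <- S | vglue q1 r])
     [seq r <- S | vglue q r]) [seq r <- S | hglue r q]].
Definition squares : seq square := refine_se (refine_nw (refine_se squares0)).

(* The letters of the columns, and of the rows, that are second in their blocks. *)
Definition right_col (a : nat) : bool := a \in [:: 0; 1; 8; 9; 10; 11].
Definition top_row (a : nat) : bool := a < 8.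

(** The shape of the block starting at [a] is read on the right and upper neighbours of [a], which
    belong to it exactly when they are second letters. *)
Definition block_of (q : square) : word2 :=
  let: ((a, b), (c, d)) := q in
  if right_col b then (if top_row c then [:: [:: a; c]; [:: b; d]] else [:: [:: a]; [:: b]])
  else (if top_row c then [:: [:: a; c]] else [:: [:: a]]).
Definition preimage_letter (q : square) : nat := index (block_of q) omegaU.

(** What desubstitution needs: second columns and second rows are whole lines, never adjacent, and
    the blocks that they delimit are images of letters. *)
Lemma squares_ok : all (fun q : square => let: ((a, b), (c, d)) := q in
  [&& right_col a == right_col c, ~~ (right_col a && right_col b),
   top_row a == top_row b, ~~ (top_row a && top_row c) &
   ~~ right_col a && ~~ top_row a ==> (block_of q \in omegaU)]) squares.
Proof. exact: isT. Qed.

(** The converse of [hc_im]: it makes the preimage of a valid configuration valid. *)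
Lemma hc_back : all (fun a => all (fun b =>
  all2 hc (last [::] (im a)) (head [::] (im b)) ==> hc a b) (iota 0 19)) (iota 0 19).
Proof. exact: isT. Qed.

Lemma vc_back : all (fun a => all (fun b =>
  all2 vc (map (last 0) (im a)) (map (head 0) (im b)) ==> vc a b) (iota 0 19)) (iota 0 19).
Proof. exact: isT. Qed.

Lemma letter12_occurs : all (fun a => has (fun c => 12 \in c) (iter 7 img (letter a))) (iota 0 19).
Proof. exact: isT. Qed.

Definition square_at (v : word2) (p r : nat) : square :=
  ((wletter v p r, wletter v p.+1 r), (wletter v p r.+1, wletter v p.+1 r.+1)).

Lemma squares_occur : let v := iter 7 img (letter 12) in
  all (fun q => has (fun p => has (fun r => square_at v p r == q) (iota 0 (height v).-1))
     (iota 0 (width v).-1)) squares.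
Proof. exact: isT. Qed.

Definition square_of (y : config) (n : int * int) : square :=
  ((y n, y (n + e1)%R), (y (n + e2)%R, y (n + e1 + e2)%R)).

Lemma OmegaU_hc y n : OmegaU y -> hc (y n) (y (n + e1)%R).
Proof.
by move=> hy; have [h1 h2 _] := hy n; have [h3 _ _] := hy (n + e1)%R; apply/and3P; split=> //;
  apply/same_colorP.
Qed.

Lemma OmegaU_vc y n : OmegaU y -> vc (y n) (y (n + e2)%R).
Proof.
by move=> hy; have [h1 _ h2] := hy n; have [h3 _ _] := hy (n + e2)%R; apply/and3P; split=> //;
  apply/same_colorP.
Qed.

Lemma OmegaUP y : OmegaU y <-> forall n, hc (y n) (y (n + e1)%R) && vc (y n) (y (n + e2)%R).
Proof.
split=> [hy n|h n]; first by rewrite OmegaU_hc // OmegaU_vc.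
by have /andP[/and3P[h1 h2 /same_colorP e] /and3P[_ _ /same_colorP e']] := h n.
Qed.

Lemma square_of_glue (y : config) n : hglue (square_of y n) (square_of y (n + e1)%R) /\
  vglue (square_of y n) (square_of y (n + e2)%R).
Proof. by rewrite /hglue /vglue /square_of /= (addrAC n e2 e1) !eqxx. Qed.

Lemma refine_seP (S : seq square) y : (forall n, square_of y n \in S) ->
  forall n, square_of y n \in refine_se S.
Proof.
move=> h n; rewrite mem_filter h andbT.
have [g1 _] := square_of_glue y n.
have [_ g2] := square_of_glue y (n - e2)%R; rewrite subrK in g2.
have [g3 _] := square_of_glue y (n - e2)%R.
have [_ g4] := square_of_glue y (n - e2 + e1)%R; rewrite addrAC subrK in g4.
apply/hasP; exists (square_of y (n + e1)%R); first by rewrite mem_filter g1 h.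
apply/hasP; exists (square_of y (n - e2)%R); first by rewrite mem_filter g2 h.
by apply/hasP; exists (square_of y (n - e2 + e1)%R); rewrite ?mem_filter ?h ?andbT // addrAC.
Qed.

Lemma refine_nwP (S : seq square) y : (forall n, square_of y n \in S) ->
  forall n, square_of y n \in refine_nw S.
Proof.
move=> h n; rewrite mem_filter h andbT.
have [g1 _] := square_of_glue y (n - e1)%R; rewrite subrK in g1.
have [_ g2] := square_of_glue y n.
have [g3 _] := square_of_glue y (n - e1 + e2)%R; rewrite addrAC subrK in g3.
have [_ g4] := square_of_glue y (n - e1)%R.
apply/hasP; exists (square_of y (n - e1)%R); first by rewrite mem_filter g1 h.
apply/hasP; exists (square_of y (n + e2)%R); first by rewrite mem_filter g2 h.
by apply/hasP; exists (square_of y (n - e1 + e2)%R); rewrite ?mem_filter ?h ?andbT // addrAC.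
Qed.

Lemma square_in y n : OmegaU y -> square_of y n \in squares.
Proof.
move=> hy; move: n; apply: refine_seP; apply: refine_nwP; apply: refine_seP => n.
have h1 := OmegaU_hc n hy; have h2 := OmegaU_vc n hy.
have h3 := OmegaU_hc (n + e2)%R hy; have h4 := OmegaU_vc (n + e1)%R hy.
rewrite addrAC in h3; have /and3P[a19 b19 _] := h1; have /and3P[_ c19 _] := h2.
have /and3P[_ d19 _] := h4.
apply/flatten_mapP; exists (y n); first by rewrite mem_iota.
apply/flatten_mapP; exists (y (n + e1)%R); first by rewrite mem_filter h1 mem_iota.
apply/mapP; exists (y (n + e2)%R, y (n + e1 + e2)%R) => //.
rewrite mem_filter; apply/andP; split; first exact: h3.
apply/allpairsP; exists (y (n + e2)%R, y (n + e1 + e2)%R).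
by split; rewrite ?mem_filter ?h2 ?h4 ?mem_iota ?c19 ?d19.
Qed.

Record square_facts (q : square) : Prop := SquareFacts {
  sq_col : right_col q.1.1 = right_col q.2.1;
  sq_col2 : ~~ (right_col q.1.1 && right_col q.1.2);
  sq_row : top_row q.1.1 = top_row q.1.2;
  sq_row2 : ~~ (top_row q.1.1 && top_row q.2.1);
  sq_block : ~~ right_col q.1.1 -> ~~ top_row q.1.1 -> block_of q \in omegaU }.

Lemma square_factsP y n : OmegaU y -> square_facts (square_of y n).
Proof.
move=> /square_in-/(_ n)/(allP squares_ok); case: (square_of y n) => -[a b] [c d].
case/and5P=> /eqP h1 h2 /eqP h3 h4 h5; split=> // r t.
by move: h5; rewrite r t.
Qed.

End Squares.

Lemma add_e1 (i j : int) : (i, j) + e1 = (i + 1, j).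
Proof. by rewrite -[LHS]/(i + 1, j + 0) addr0. Qed.

Lemma add_e2 (i j : int) : (i, j) + e2 = (i, j + 1).
Proof. by rewrite -[LHS]/(i + 0, j + 1) addr0. Qed.

Lemma square_ofE (y : config) (i j : int) :
  square_of y (i, j) = ((y (i, j), y (i + 1, j)), (y (i, j + 1), y (i + 1, j + 1))).
Proof. by rewrite /square_of add_e1 !add_e2. Qed.

Lemma int_const (T : Type) (g : int -> T) : (forall k, g k = g (k + 1)) -> forall k, g k = g 0.
Proof.
move=> h; elim=> [//|k IH|k IH]; first by rewrite -IH [RHS]h; congr g; lia.
by rewrite -IH [LHS]h; congr g; lia.
Qed.

Lemma right_col_column y i j : OmegaU y -> right_col (y (i, j)) = right_col (y (i, 0)).
Proof.
move=> hy; apply: (@int_const _ (fun j => right_col (y (i, j)))) => k.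
by have := sq_col (square_factsP (i, k) hy); rewrite square_ofE.
Qed.

Lemma top_row_row y i j : OmegaU y -> top_row (y (i, j)) = top_row (y (0, j)).
Proof.
move=> hy; apply: (@int_const _ (fun i => top_row (y (i, j)))) => k.
by have := sq_row (square_factsP (k, j) hy); rewrite square_ofE.
Qed.

(** [b] tells the lines that come second in a block; all the others are cuts. *)
Lemma enumerate_gaps (b : int -> bool) : (forall i, ~~ (b i && b (i + 1))) ->
  exists Z : int -> int, [/\ forall j, Z j < Z (j + 1), forall j, ~~ b (Z j) &
    forall j, Z (j + 1) = Z j + (if b (Z j + 1) then 2 else 1)].
Proof.
move=> h; have [||Z [hZ iZ gZ]] := @enumerate (fun i => ~~ b i).
- move=> i; have [hi|hi] := boolP (b i); last by exists 0%N; rewrite subr0.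
  by exists 1%N; have := h (i - 1); rewrite subrK hi andbT.
- move=> i; have [hi|hi] := boolP (b i); last by exists 0%N; rewrite addr0.
  by exists 1%N; have := h i; rewrite hi.
exists Z; split=> // j; have lt := iZ j; have g := gZ j.
have hz := hZ (j + 1); have := h (Z j + 1).
move: (Z j) (Z (j + 1)) lt g hz => m m' lt g hz hm.
case: ifP hm => [hb /= hm|hb _].
  have n2 : m' = m + 1 -> False by move=> e; move: hz; rewrite e hb.
  have n3 : ~ (m + 1 + 1 < m') by move=> lt'; apply: (g (m + 1 + 1)); [lia|].
  by lia.
have n3 : ~ (m + 1 < m') by move=> lt'; apply: (g (m + 1)); [lia|rewrite hb].
by lia.
Qed.

(** Like [config_image], but with no cut imposed at the origin, which desubstitution does not
    provide. *)
Definition tiled_by (x y : config) (X Y : int -> int) : Prop := forall i j : int,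
  let u := im (x (i, j)) in
  [/\ X (i + 1) = X i + (size u)%:Z, Y (j + 1) = Y j + (height u)%:Z &
    forall p q : nat, (p < size u)%N -> (q < height u)%N ->
      y (X i + p%:Z, Y j + q%:Z) = wletter u p q].

Lemma all2P (e : rel nat) (s s' : seq nat) : size s = size s' ->
  (forall k, (k < size s)%N -> e (nth 0%N s k) (nth 0%N s' k)) -> all2 e s s'.
Proof.
elim: s s' => [|a s IH] [|b s'] //= [e1] h; rewrite (h 0%N) //=; apply: IH => // k hk.
exact: (h k.+1).
Qed.

Lemma im_height a p : (a < 19)%N -> (p < size (im a))%N ->
  size (nth [::] (im a) p) = height (im a).
Proof.
move=> a19 hp; have /and3P[_ _ /allP h] := valid_rectangular (imP a19).
by apply/eqP/h; apply: mem_nth.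
Qed.

Lemma height_gt0 a : (a < 19)%N -> (0 < height (im a))%N.
Proof. by move=> /imP/valid_rectangular/and3P[]. Qed.

Lemma tiled_OmegaU x y X Y : OmegaU y -> (forall n, (x n < 19)%N) -> tiled_by x y X Y ->
  OmegaU x.
Proof.
move=> hy x19 T; apply/OmegaUP => -[i j]; rewrite add_e1 add_e2.
have [XE YE hw] := T i j; have [_ YE' hw1] := T (i + 1) j; have [XE' _ hw2] := T i (j + 1).
have [[a19 b19] c19] := (x19 (i, j), x19 (i + 1, j), x19 (i, j + 1)).
move: a19 b19 c19 XE YE hw YE' hw1 XE' hw2.
move: (x (i, j)) (x (i + 1, j)) (x (i, j + 1)) => a b c a19 b19 c19 XE YE hw YE' hw1 XE' hw2.
have sa := im_gt0 a19; have sb := im_gt0 b19; have sc := im_gt0 c19.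
have ha := height_gt0 a19; have hc' := height_gt0 c19.
have hab : height (im a) = height (im b) by lia.
have hac : size (im a) = size (im c) by lia.
apply/andP; split.
  have := allP (allP hc_back a _) b; rewrite !mem_letters => /(_ a19 b19)/implyP; apply.
  have e : last [::] (im a) = nth [::] (im a) (size (im a)).-1 by rewrite nth_last.
  rewrite e -nth0; apply: all2P; first by rewrite !im_height // prednK.
  move=> k; rewrite im_height ?prednK // => hk.
  have hk' : (k < height (im b))%N by rewrite -hab.
  have := hw (size (im a)).-1 k; rewrite prednK // => /(_ (leqnn _) hk).
  have := hw1 0%N k sb hk'; rewrite /wletter addr0 => <- <-.
  have := OmegaU_hc (X i + (size (im a)).-1%:Z, Y j + k%:Z) hy.
  by rewrite add_e1 (_ : _ + 1 = X (i + 1)) // XE; lia.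
have := allP (allP vc_back a _) c; rewrite !mem_letters => /(_ a19 c19)/implyP; apply.
apply: all2P; first by rewrite !size_map.
move=> k; rewrite size_map => hk; have hk' : (k < size (im c))%N by rewrite -hac.
rewrite !(nth_map [::]) // -nth_last -nth0 im_height //.
have := hw k (height (im a)).-1 hk; rewrite prednK // => /(_ (leqnn _)).
have := hw2 k 0%N hk' hc'; rewrite /wletter addr0 => <- <-.
have := OmegaU_vc (X i + k%:Z, Y j + (height (im a)).-1%:Z) hy.
by rewrite add_e2 (_ : _ + 1 = Y (j + 1)) // YE; lia.
Qed.

Lemma desubstitution y : OmegaU y -> exists x X Y, [/\ OmegaU x, forall i, X i < X (i + 1),
  forall j, Y j < Y (j + 1) & tiled_by x y X Y].
Proof.
(* Being constant along columns and along rows, the two properties are read on one row and on one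
   column. *)
move=> hy; pose b i := right_col (y (i, 0)); pose d j := top_row (y (0, j)).
have [|X [iX bX XE]] := @enumerate_gaps b.
  by move=> i; have := sq_col2 (square_factsP (i, 0) hy); rewrite square_ofE.
have [|Y [iY dY YE]] := @enumerate_gaps d.
  by move=> i; have := sq_row2 (square_factsP (0, i) hy); rewrite square_ofE.
pose x : config := fun n => preimage_letter (square_of y (X n.1, Y n.2)).
have hin i j : block_of (square_of y (X i, Y j)) \in omegaU.
  apply: (sq_block (square_factsP _ hy)); rewrite square_ofE /=.
    by rewrite right_col_column //; apply: bX.
  by rewrite top_row_row //; apply: dY.
have x19 n : (x n < 19)%N by rewrite -[19%N]/(size omegaU) index_mem; apply: hin.
have imE i j : im (x (i, j)) = block_of (square_of y (X i, Y j)) by apply: nth_index; apply: hin.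
have T : tiled_by x y X Y.
  move=> i j; rewrite imE square_ofE /= (right_col_column _ _ hy) (top_row_row _ _ hy).
  rewrite XE YE -/(b (X i + 1)) -/(d (Y j + 1)).
  case: (b _); case: (d _); split=> //= -[|[|p]] [|[|q]] // _ _; rewrite ?addr0 //.
by exists x, X, Y; split=> //; apply: tiled_OmegaU T.
Qed.

(** * Recurrence *)

Definition column (x : config) (i j : int) (h : nat) : seq nat :=
  [seq x (i, j + q%:Z) | q <- iota 0 h].
Definition rect (x : config) (i j : int) (w h : nat) : word2 :=
  [seq column x (i + p%:Z) j h | p <- iota 0 w].

Lemma columnD x i j (h k : nat) : column x i j (h + k) = column x i j h ++ column x i (j + h%:Z) k.
Proof.
have e : iota h k = map (addn h) (iota 0 k) by rewrite -iotaDl addn0.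
rewrite /column iotaD map_cat add0n e -map_comp; congr (_ ++ _).
by apply: eq_map => q /=; congr (x (_, _)); rewrite PoszD addrA.
Qed.

Lemma rectD x i j (v w h : nat) : rect x i j (v + w) h = rect x i j v h ++ rect x (i + v%:Z) j w h.
Proof.
have e : iota v w = map (addn v) (iota 0 w) by rewrite -iotaDl addn0.
rewrite /rect iotaD map_cat add0n e -map_comp; congr (_ ++ _).
by apply: eq_map => q /=; congr (column x _ _ _); rewrite PoszD addrA.
Qed.

Lemma wletter_rect x i j (w h p q : nat) : (p < w)%N -> (q < h)%N ->
  wletter (rect x i j w h) p q = x (i + p%:Z, j + q%:Z).
Proof.
by move=> hp hq; rewrite /wletter (nth_map 0%N) ?size_iota // (nth_map 0%N) ?size_iota // !nth_iota.
Qed.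

Lemma size_rect x i j (w h : nat) : size (rect x i j w h) = w.
Proof. by rewrite size_map size_iota. Qed.

Lemma height_rect x i j (w h : nat) : (0 < w)%N -> height (rect x i j w h) = h.
Proof. by case: w => // w _; rewrite /height /= size_map size_iota. Qed.

Section Tiled.
Variables (x y : config) (X Y : int -> int).
Hypotheses (T : tiled_by x y X Y) (x19 : forall n, (x n < 19)%N).

Lemma cut_X i j : X (i + 1) = X i + (size (im (x (i, j))))%:Z.
Proof. by have [] := T i j. Qed.

Lemma cut_Y i j : Y (j + 1) = Y j + (height (im (x (i, j))))%:Z.
Proof. by have [] := T i j. Qed.

Lemma iX i : X i < X (i + 1).
Proof. by rewrite (cut_X i 0) ltrDl ltz_nat im_gt0. Qed.

Lemma iY j : Y j < Y (j + 1).
Proof. by rewrite (cut_Y 0 j) ltrDl ltz_nat height_gt0. Qed.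

Lemma col_image_column i j h k : (k < size (im (x (i, j))))%N ->
  flatten [seq nth [::] (im a) k | a <- column x i j h] =
  column y (X i + k%:Z) (Y j) (absz (Y (j + h%:Z) - Y j)).
Proof.
move=> hk; elim: h => [|h IH]; first by rewrite /= addr0 subrr.
rewrite -addn1 columnD map_cat flatten_cat IH /= cats0 addr0.
have hY : Y j <= Y (j + h%:Z) by apply: (incr_le iY); lia.
have e := cut_Y i (j + h%:Z).
pose m := absz (Y (j + h%:Z) - Y j); pose n := height (im (x (i, j + h%:Z))).
have -> : absz (Y (j + (h + 1)%N%:Z) - Y j) = (m + n)%N.
  have -> : j + (h + 1)%N%:Z = j + h%:Z + 1 by lia.
  rewrite e /m -/n; move: (Y _) (Y _) n hY {e} => a b n' hY; lia.
have -> : column y (X i + k%:Z) (Y j) (m + n) =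
    column y (X i + k%:Z) (Y j) m ++ column y (X i + k%:Z) (Y (j + h%:Z)) n.
  rewrite columnD; congr (_ ++ column _ _ _ _).
  by rewrite /m; move: (Y _) (Y _) hY {e} => a b; lia.
congr (_ ++ _).
have hk' : (k < size (im (x (i, (j + h%:Z)%R))))%N.
  by have := cut_X i j; rewrite (cut_X i (j + h%:Z)) => /addrI[->].
apply: (@eq_from_nth _ 0%N); rewrite im_height // ?size_map ?size_iota // => q hq.
rewrite (nth_map 0%N) ?size_iota // nth_iota // add0n.
by have [_ _ ->] := T i (j + h%:Z).
Qed.

Lemma img_rect i j w h : (0 < h)%N ->
  img (rect x i j w h) = rect y (X i) (Y j) (absz (X (i + w%:Z) - X i)) (absz (Y (j + h%:Z) - Y j)).
Proof.
move=> h0; elim: w => [|w IH]; first by rewrite /= addr0 subrr.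
rewrite -addn1 rectD img_cat IH.
have hX : X i <= X (i + w%:Z) by apply: (incr_le iX); lia.
have e := cut_X (i + w%:Z) j.
pose m := absz (X (i + w%:Z) - X i); pose n := size (im (x (i + w%:Z, j))).
have -> : absz (X (i + (w + 1)%N%:Z) - X i) = (m + n)%N.
  have -> : i + (w + 1)%N%:Z = i + w%:Z + 1 by lia.
  rewrite e /m -/n; move: (X _) (X _) n hX {e} => a b n' hX; lia.
rewrite rectD; congr (_ ++ _).
have -> : X i + m%:Z = X (i + w%:Z) by rewrite /m; move: (X _) (X _) hX {e} => a b; lia.
rewrite /img /= cats0 addr0.
have hd : head 0%N (column x (i + w%:Z) j h) = x (i + w%:Z, j).
  by case: h h0 {IH} => // h _; rewrite /= addr0.
rewrite /col_image hd /rect; apply/eq_in_map => k; rewrite mem_iota add0n => /andP[_ hk].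
exact: col_image_column.
Qed.

End Tiled.

(** [X] and [Y] cut [y] into the [k]-th images of the letters of [x], called supertiles below; a
    statement about whole rectangles composes directly. *)
Definition iterated (k : nat) (x y : config) (X Y : int -> int) : Prop :=
  forall i j w h, (0 < w)%N -> (0 < h)%N ->
  iter k img (rect x i j w h) =
  rect y (X i) (Y j) (absz (X (i + w%:Z)%R - X i)%R) (absz (Y (j + h%:Z)%R - Y j)%R).

Lemma iterated_desubstitution k y : OmegaU y -> exists x X Y, [/\ OmegaU x,
  forall i, X i < X (i + 1), forall j, Y j < Y (j + 1) & iterated k x y X Y].
Proof.
elim: k => [|k IH] hy.
  exists y, id, id; split=> //; try by move=> i; lia.
  move=> i j w h _ _ /=.
  have -> : absz (i + w%:Z - i)%R = w by lia.
  by have -> : absz (j + h%:Z - j)%R = h by lia.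
have [x [X [Y [hx iX' iY' IT]]]] := IH hy.
have [z [X' [Y' [hz iX'' iY'' T]]]] := desubstitution hx.
have z19 n : (z n < 19)%N by have [] := hz n.
exists z, (X \o X'), (Y \o Y'); split=> //.
- by move=> i; apply: (incr_lt iX').
- by move=> j; apply: (incr_lt iY').
move=> i j w h w0 h0; rewrite iterSr (img_rect T z19) // IT.
- congr (rect _ _ _ (absz (_ - _)) (absz (_ - _))) => /=; [congr X|congr Y].
    have : X' i <= X' (i + w%:Z) by apply: (incr_le iX''); lia.
    by move: (X' _) (X' _) => a b; lia.
  have : Y' j <= Y' (j + h%:Z) by apply: (incr_le iY''); lia.
  by move: (Y' _) (Y' _) => a b; lia.
- have : X' i < X' (i + w%:Z) by apply: (incr_lt iX''); lia.
  by move: (X' _) (X' _) => a b; lia.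
have : Y' j < Y' (j + h%:Z) by apply: (incr_lt iY''); lia.
by move: (Y' _) (Y' _) => a b; lia.
Qed.

Lemma rect_letter x i j : rect x i j 1 1 = letter (x (i, j)).
Proof. by rewrite /rect /column /= !addr0. Qed.

Lemma iterated_letter k x y X Y i j : iterated k x y X Y ->
  iter k img (letter (x (i, j))) =
  rect y (X i) (Y j) (absz (X (i + 1)%R - X i)%R) (absz (Y (j + 1)%R - Y j)%R).
Proof. by move=> /(_ i j 1%N 1%N isT isT); rewrite rect_letter. Qed.

Lemma mem_rect x i j w h c a : c \in rect x i j w h -> a \in c ->
  exists p q : nat, x (i + p%:Z, j + q%:Z) = a.
Proof. by case/mapP => p _ -> /mapP[q _ ->]; exists p, q. Qed.

(** Supertiles of order [N + N] measure at least [2 ^ N > N] in both directions, so a window of size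
    at most [N] meets at most two consecutive columns and two consecutive rows of them. *)
Lemma iterated_gap N x y X Y : OmegaU x -> (forall i, X i < X (i + 1)) ->
  (forall j, Y j < Y (j + 1)) -> iterated (N + N) x y X Y ->
  (forall i, X i + N%:Z <= X (i + 1)) /\ (forall j, Y j + N%:Z <= Y (j + 1)).
Proof.
move=> hx iX iY T; have lt : (N < 2 ^ N)%N by apply: ltn_expl.
split=> k.
  have [k19 _ _] := hx (k, 0); have [h _] := iter_img_size N k19.
  rewrite (iterated_letter k 0 T) size_rect in h; have := iX k.
  by move: (X _) (X _) h => a b; lia.
have [k19 _ _] := hx (0, k); have [_ h] := iter_img_size N k19.
rewrite (iterated_letter 0 k T) height_rect in h; last by have := iX 0; move: (X _) (X _) => a b; lia.
by have := iY k; move: (Y _) (Y _) h => a b; lia.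
Qed.

(** The window lies in the four supertiles given by one square of [x]. It suffices to find this
    square in the configuration at the same level above [z], inside the seventh image of a letter
    12; the supertile of that letter also provides the word [v]. *)
Lemma recurrence y z (n m : int) (w h : nat) : OmegaU y -> OmegaU z ->
  exists n' m' k v, [/\ iter_image omegaU k 12 v, subword_in y (n, m) (w, h) v &
    forall p q : nat, (p < w)%N -> (q < h)%N -> z (n' + p%:Z, m' + q%:Z) = y (n + p%:Z, m + q%:Z)].
Proof.
move=> hy hz; pose N := (w + h)%N; pose K := (N + N)%N.
have [x [X [Y [hx iX iY T]]]] := iterated_desubstitution K hy.
have [gX gY] := iterated_gap hx iX iY T.
have [i /andP[i1 i2]] := incr_locate iX n; have [j /andP[j1 j2]] := incr_locate iY m.
have [z1 [X1 [Y1 [hz1 iX1 iY1 T1]]]] := iterated_desubstitution K hz.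
(* Seven levels to see every square inside a letter 12, and seven more to be sure of meeting this
   letter. *)
have [z2 [X2 [Y2 [hz2 iX2 iY2 T2]]]] := iterated_desubstitution 7 hz1.
have [z3 [X3 [Y3 [hz3 iX3 iY3 T3]]]] := iterated_desubstitution 7 hz2.
have [a19 _ _] := hz3 (0, 0).
have [a [b eab]] : exists a b, z2 (a, b) = 12%N.
  have /hasP[c] := allP letter12_occurs (z3 (0, 0)) (etrans (mem_letters _) a19).
  by rewrite (iterated_letter 0 0 T3) => hc /(mem_rect hc)[p [q e]]; eexists; eexists; exact: e.
have v7E := iterated_letter a b T2; rewrite eab in v7E.
set W2 := absz _ in v7E; set H2 := absz _ in v7E.
have W2_gt0 : (0 < W2)%N by rewrite /W2; have := iX2 a; move: (X2 _) (X2 _) => c d; lia.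
have H2_gt0 : (0 < H2)%N by rewrite /H2; have := iY2 b; move: (Y2 _) (Y2 _) => c d; lia.
have /hasP[p hp /hasP[r hr /eqP sq]] := allP squares_occur _ (square_in (i, j) hx).
rewrite v7E /width size_rect mem_iota add0n in hp; rewrite v7E height_rect // mem_iota add0n in hr.
have {}hp : (p.+1 < W2)%N by lia.
have {}hr : (r.+1 < H2)%N by lia.
pose i' := X2 a + p%:Z; pose j' := Y2 b + r%:Z.
have rE : rect z1 i' j' 2 2 = rect x i j 2 2.
  move: sq; rewrite square_ofE v7E /square_at !wletter_rect ?(ltnW hp) ?(ltnW hr) //.
  have pS (c : int) (d : nat) : c + d.+1%:Z = c + d%:Z + 1 by lia.
  rewrite (pS _ p) (pS _ r) -/i' -/j' => -[s1 s2 s3 s4].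
  by rewrite /rect /column /= !addr0 s1 s2 s3 s4.
(* Equal squares at level [K] have equal images, so the two rectangles of [z] and [y] coincide,
   sizes included. *)
have := T1 i' j' 2%N 2%N isT isT; rewrite rE (T i j 2%N 2%N isT isT).
set W := absz (X _ - _)%R; set H := absz (Y _ - _)%R; set W1 := absz _; set H1 := absz _ => RE.
have W_gt0 : (0 < W)%N.
  by rewrite /W; have : X i < X (i + 2%:Z) by [apply: (incr_lt iX); lia]; move: (X _) (X _) => c d; lia.
have eW : W1 = W by rewrite -(size_rect z (X1 i') (Y1 j') W1 H1) -RE size_rect.
have eH : H1 = H.
  have W1_gt0 : (0 < W1)%N by rewrite eW.
  by rewrite -(height_rect z (X1 i') (Y1 j') H1 W1_gt0) -RE height_rect.
rewrite eW eH in RE.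
pose n' := X1 i' + (n - X i); pose m' := Y1 j' + (m - Y j).
have hX : n + w%:Z <= X i + W%:Z.
  have := gX (i + 1); have -> : i + 1 + 1 = i + 2%:Z by lia.
  rewrite /W /N; move: (X _) (X (i + 1)) (X _) i1 i2 => c d e; lia.
have hY : m + h%:Z <= Y j + H%:Z.
  have := gY (j + 1); have -> : j + 1 + 1 = j + 2%:Z by lia.
  rewrite /H /N; move: (Y _) (Y (j + 1)) (Y _) j1 j2 => c d e; lia.
have copy (c d : nat) : (c < w)%N -> (d < h)%N ->
    z (n' + c%:Z, m' + d%:Z) = y (n + c%:Z, m + d%:Z).
  move=> hc hd; pose c' := absz (n + c%:Z - X i)%R; pose d' := absz (m + d%:Z - Y j)%R.
  have c'E : c'%:Z = n + c%:Z - X i by rewrite /c'; move: (X i) i1 => ? ?; lia.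
  have d'E : d'%:Z = m + d%:Z - Y j by rewrite /d'; move: (Y j) j1 => ? ?; lia.
  have lc : (c' < W)%N by move: c'E hX; move: (X i) => ?; lia.
  have ld : (d' < H)%N by move: d'E hY; move: (Y j) => ?; lia.
  have := congr1 (fun v => wletter v c' d') RE; rewrite !wletter_rect // c'E d'E => e.
  have -> : (n' + c%:Z, m' + d%:Z) = (X1 i' + (n + c%:Z - X i), Y1 j' + (m + d%:Z - Y j)).
    by rewrite /n' /m'; congr pair; ring.
  by rewrite -e; congr (y (_, _)); ring.
have vE : iter (K + 7) img (letter 12) = rect z (X1 (X2 a)) (Y1 (Y2 b))
    (absz (X1 (X2 a + W2%:Z) - X1 (X2 a))%R) (absz (Y1 (Y2 b + H2%:Z) - Y1 (Y2 b))%R).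
  by rewrite iterD v7E T1.
exists n', m', (K + 7)%N, (iter (K + 7) img (letter 12)); split=> //.
  exact/iter_imageP.
have bX : X1 (X2 a) <= X1 i' by apply: (incr_le iX1); rewrite /i'; lia.
have bX' : X1 (i' + 2%:Z) <= X1 (X2 a + W2%:Z) by apply: (incr_le iX1); rewrite /i'; lia.
have bY : Y1 (Y2 b) <= Y1 j' by apply: (incr_le iY1); rewrite /j'; lia.
have bY' : Y1 (j' + 2%:Z) <= Y1 (Y2 b + H2%:Z) by apply: (incr_le iY1); rewrite /j'; lia.
have lX : X1 i' < X1 (i' + 2%:Z) by apply: (incr_lt iX1); lia.
have lY : Y1 j' < Y1 (j' + 2%:Z) by apply: (incr_lt iY1); lia.
have sX : X1 (i' + 2%:Z) = X1 i' + W%:Z by rewrite -eW /W1; move: (X1 _) (X1 _) lX => ? ?; lia.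
have sY : Y1 (j' + 2%:Z) = Y1 j' + H%:Z by rewrite -eH /H1; move: (Y1 _) (Y1 _) lY => ? ?; lia.
rewrite sX in bX'; rewrite sY in bY'.
exists (absz (n' - X1 (X2 a))%R), (absz (m' - Y1 (Y2 b))%R).
have nX : 0 <= n' - X1 (X2 a) by rewrite /n'; move: (X1 _) (X1 _) (X i) i1 bX => ? ? ?; lia.
have nY : 0 <= m' - Y1 (Y2 b) by rewrite /m'; move: (Y1 _) (Y1 _) (Y j) j1 bY => ? ? ?; lia.
have wX : n' + w%:Z <= X1 (X2 a + W2%:Z).
  by rewrite /n'; move: (X1 _) (X1 _) (X i) hX bX' => ? ? ?; lia.
have wY : m' + h%:Z <= Y1 (Y2 b + H2%:Z).
  by rewrite /m'; move: (Y1 _) (Y1 _) (Y j) hY bY' => ? ? ?; lia.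
have W_gt0' : (0 < absz (X1 (X2 a + W2%:Z) - X1 (X2 a))%R)%N.
  by move: (X1 _) (X1 (X2 a)) bX bX' => ? ? ; move: (X1 i') => ?; lia.
rewrite vE /width size_rect height_rect //; split=> /=.
- by move: n' nX wX {copy}; move: (X1 _) (X1 (X2 a)) => ? ? n'; lia.
- by move: m' nY wY {copy}; move: (Y1 _) (Y1 (Y2 b)) => ? ? m'; lia.
move=> c d hc hd; rewrite -copy // wletter_rect.
- congr (z (_, _)).
    by move: n' nX {copy wX}; move: (X1 _) => ? n'; lia.
  by move: m' nY {copy wY}; move: (Y1 _) => ? m'; lia.
- by move: n' nX wX {copy}; move: (X1 _) (X1 (X2 a)) => ? ? n'; lia.
by move: m' nY wY {copy}; move: (Y1 _) (Y1 (Y2 b)) => ? ? m'; lia.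
Qed.

Lemma valid_hc v p q : valid v -> (p.+1 < width v)%N -> (q < height v)%N ->
  hc (wletter v p q) (wletter v p.+1 q).
Proof.
move=> hv hp hq; have /and3P[_ _ /(sortedP [::])/(_ p hp)] := hv.
have /and3P[_ _ /allP rv] := valid_rectangular hv.
have sp : size (nth [::] v p) = height v by apply/eqP/rv; apply: mem_nth; apply: ltnW.
rewrite /wletter; move: (nth _ v p) (nth _ v p.+1) sp => s s' sp h.
have := all2_size h; rewrite -sp in hq; elim: s s' q hq h {sp} => [|c s IH] [|d s'] [|q] //=.
  by move=> _ /andP[].
by move=> hq /andP[_ h] [e]; apply: IH.
Qed.

Lemma valid_vc v p q : valid v -> (p < width v)%N -> (q.+1 < height v)%N ->
  vc (wletter v p q) (wletter v p q.+1).
Proof.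
move=> hv hp hq; have /and3P[_ /allP h _] := hv.
have /and3P[_ _ /allP rv] := valid_rectangular hv.
have mp : nth [::] v p \in v by apply: mem_nth.
have /and3P[_ _ /(sortedP 0%N)] := h _ mp; apply.
by rewrite (eqP (rv _ mp)).
Qed.

Lemma OmegaU_substitutive : OmegaU = substitutive_shift omegaU.
Proof.
apply/seteqP; split=> x hx.
  move=> [n m] [w h]; have [_ [_ [k [v [h1 h2 _]]]]] := recurrence n m w h hx hx.
  by exists 12%N, k, v.
apply/OmegaUP => -[i j]; have [a [k [v [hk [p [q [hp hq e]]]]]]] := hx (i, j) (2, 2).
have a19 := iter_image_lt hk; move/iter_imageP: hk => /(_ a19) vE.
have vv : valid v by rewrite vE; apply: valid_iter.
rewrite /= in hp hq e; rewrite add_e1 add_e2.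
have := e 0%N 0%N isT isT; have := e 1%N 0%N isT isT; have := e 0%N 1%N isT isT.
rewrite !addr0 !addn0 => -> -> ->; rewrite !addn1.
by rewrite valid_hc ?valid_vc //; lia.
Qed.

Lemma OmegaU_subset Y : subshift Y -> Y !=set0 -> Y `<=` OmegaU -> OmegaU `<=` Y.
Proof.
move=> [cY sY] [z Yz] YO y hy; apply: (closed_agree cY) => N.
have [n [m [_ [_ [_ _ e]]]]] :=
  recurrence (- N%:Z) (- N%:Z) (N + N).+1 (N + N).+1 hy (YO z Yz).
exists (sigma (n + N%:Z, m + N%:Z) z); first by apply: (sY (n + N%:Z, m + N%:Z)); exists z.
move=> i j hi hj; have := e (absz (i + N%:Z)%R) (absz (j + N%:Z)%R).
have -> : (absz (i + N%:Z)%R)%:Z = i + N%:Z by lia.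
have -> : (absz (j + N%:Z)%R)%:Z = j + N%:Z by lia.
rewrite /sigma -[(i, j) + _]/(i + (n + N%:Z), j + (m + N%:Z)).
have -> : i + (n + N%:Z) = n + (i + N%:Z) by ring.
have -> : j + (m + N%:Z) = m + (j + N%:Z) by ring.
by move=> ->; [congr (y (_, _)); ring|lia|lia].
Qed.

(** * Tiles on the torus *)

Lemma all_letters (P : nat -> bool) a : all P (iota 0 19) -> (a < 19)%N -> P a.
Proof. by move=> /allP h a19; apply: h; rewrite mem_letters. Qed.

Lemma all2_letters (P : nat -> nat -> bool) a b :
  all (fun a => all (P a) (iota 0 19)) (iota 0 19) -> (a < 19)%N -> (b < 19)%N -> P a b.
Proof. by move=> h a19; apply: all_letters; apply: (all_letters (P := fun a => all (P a) _) h). Qed.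

Definition shift_polygon (v : zpt) (V : seq zpt) : seq zpt := map (ptadd v) V.

(* Modulo 1, the translation by [t] is that by [t] or by [- s] in the fundamental domain. *)
Lemma tiles_hseparated : all (fun a => all (fun b => hc a b ||
    disjoint_polygons (nth [::] tiles a) (shift_polygon (zopp zt, z0) (nth [::] tiles b)) &&
    disjoint_polygons (nth [::] tiles a) (shift_polygon (zs, z0) (nth [::] tiles b)))
  (iota 0 19)) (iota 0 19).
Proof. exact: isT. Qed.

Lemma tiles_vseparated : all (fun a => all (fun b => vc a b ||
    disjoint_polygons (nth [::] tiles a) (shift_polygon (z0, zopp zt) (nth [::] tiles b)) &&
    disjoint_polygons (nth [::] tiles a) (shift_polygon (z0, zs) (nth [::] tiles b)))
  (iota 0 19)) (iota 0 19).
Proof. exact: isT. Qed.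

Lemma tiles_columns : all (fun a => all (fun T => if right_col a then tri_side (zs, z1) (zs, z0) T
  else tri_side (zs, z0) (zs, z1) T) (fan (nth [::] tiles a))) (iota 0 19).
Proof. exact: isT. Qed.

Lemma tiles_rows : all (fun a => all (fun T => if top_row a then tri_side (z0, zs) (z1, zs) T
  else tri_side (z1, zs) (z0, zs) T) (fan (nth [::] tiles a))) (iota 0 19).
Proof. exact: isT. Qed.

Section Torus.
Variable R : realType.
Local Notation f := (golden R).
Local Notation s := (f - 1).
Local Notation t := (2 - f).

Lemma in_poly_shift (v : zpt) V (p : R * R) :
  in_poly (map (pev R) (shift_polygon v V)) (p + pev R v) = in_poly (map (pev R) V) p.
Proof.
have e A B : orient (pev R (ptadd v A)) (pev R (ptadd v B)) (p + pev R v) =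
    orient (pev R A) (pev R B) p.
  by rewrite /orient /= !zevD; ring.
case: V => // x l; rewrite /shift_polygon [map _ _]/= !in_poly_path -map_rcons.
by rewrite path_map; apply: eq_path => A B; rewrite /= e.
Qed.

Lemma tile_mem (p : R * R) : generic p -> rectangle 1 1 p ->
  (tile_code p < 19)%N /\ in_poly (map (pev R) (nth [::] tiles (tile_code p))) p.
Proof.
by move=> gp Wp; have [a ha pa] := tile_exists gp Wp; rewrite (tile_codeE gp Wp ha pa).
Qed.

Lemma tile_apart (p q : R * R) (v : zpt) : generic p -> rectangle 1 1 p -> generic q ->
  rectangle 1 1 q -> p = q + pev R v ->
  ~~ disjoint_polygons (nth [::] tiles (tile_code p)) (shift_polygon v (nth [::] tiles (tile_code q))).
Proof.
move=> gp Wp gq Wq e; have [_ hp] := tile_mem gp Wp; have [_ hq] := tile_mem gq Wq.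
apply/negP => dis; apply: (disjoint_polygonsP gp dis hp).
by rewrite e in_poly_shift.
Qed.

Lemma tile_hc (p : R * R) : generic p -> hc (tile_code p) (tile_code (p + (t, 0))).
Proof.
have k1 : inK (1 : R) by exact: inK1.
have k0 : inK (0 : R) by exact: inK0.
have kf : inK f by exact: inKg.
have ks : inK s by apply: inKB.
have kt : inK t by apply: inKB => //; exact: inK_nat.
have bf := golden_bounds R; have [[es et _] _ _ e0 _] := zevE R.
move=> g0; have cp := redr_congr 1 1 p.
rewrite (periodic_tile_code cp) (periodic_tile_code (congr_modD _ cp)).
have gp : generic (redr 1 1 p) by apply: generic_congr cp g0.
have Wp : rectangle 1 1 (redr 1 1 p) := redr_rectangle g0 k1 k1 ltr01 ltr01.
move: (redr 1 1 p) gp Wp => {g0 cp}p gp Wp.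
have [p1 p2] := Wp; have /andP[p10 p11] := p1.
have [p19 _] := tile_mem gp Wp.
have [lt|gt|eq] := ltgtP p.1 s; last by have := generic_neq1 gp ks; rewrite eq eqxx.
- have gq : generic (p + (t, 0)) by apply: genericD.
  have Wq : rectangle 1 1 (p + (t, 0)).
    by split=> /=; rewrite ?addr0 //; apply/andP; split; lra.
  have [q19 _] := tile_mem gq Wq.
  have := all2_letters tiles_hseparated p19 q19.
  case/orP => // /andP[dis _]; have e : p = p + (t, 0) + pev R (zopp zt, z0).
    by rewrite /pev zevN et e0 [LHS]surjective_pairing; congr pair => /=; ring.
  by have := tile_apart gp Wp gq Wq e; rewrite dis.
have gq : generic (p - (s, 0)) by apply: genericD => //; apply: inK2N.
have Wq : rectangle 1 1 (p - (s, 0)).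
  by split=> /=; rewrite ?subr0 //; apply/andP; split; lra.
have -> : tile_code (p + (t, 0)) = tile_code (p - (s, 0)).
  apply: periodic_tile_code; apply/rect_congr; exists (-1), 0 => /=.
  by rewrite rmorphN; split; ring.
have [q19 _] := tile_mem gq Wq.
have := all2_letters tiles_hseparated p19 q19.
case/orP => // /andP[_ dis]; have e : p = p - (s, 0) + pev R (zs, z0) by rewrite /pev es e0 subrK.
by have := tile_apart gp Wp gq Wq e; rewrite dis.
Qed.

Lemma tile_vc (p : R * R) : generic p -> vc (tile_code p) (tile_code (p + (0, t))).
Proof.
have k1 : inK (1 : R) by exact: inK1.
have k0 : inK (0 : R) by exact: inK0.
have kf : inK f by exact: inKg.
have ks : inK s by apply: inKB.
have kt : inK t by apply: inKB => //; exact: inK_nat.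
have bf := golden_bounds R; have [[es et _] _ _ e0 _] := zevE R.
move=> g0; have cp := redr_congr 1 1 p.
rewrite (periodic_tile_code cp) (periodic_tile_code (congr_modD _ cp)).
have gp : generic (redr 1 1 p) by apply: generic_congr cp g0.
have Wp : rectangle 1 1 (redr 1 1 p) := redr_rectangle g0 k1 k1 ltr01 ltr01.
move: (redr 1 1 p) gp Wp => {g0 cp}p gp Wp.
have [p1 p2] := Wp; have /andP[p20 p21] := p2.
have [p19 _] := tile_mem gp Wp.
have [lt|gt|eq] := ltgtP p.2 s; last by have := generic_neq2 gp ks; rewrite eq eqxx.
- have gq : generic (p + (0, t)) by apply: genericD.
  have Wq : rectangle 1 1 (p + (0, t)).
    by split=> /=; rewrite ?addr0 //; apply/andP; split; lra.
  have [q19 _] := tile_mem gq Wq.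
  have := all2_letters tiles_vseparated p19 q19.
  case/orP => // /andP[dis _]; have e : p = p + (0, t) + pev R (z0, zopp zt).
    by rewrite /pev zevN et e0 [LHS]surjective_pairing; congr pair => /=; ring.
  by have := tile_apart gp Wp gq Wq e; rewrite dis.
have gq : generic (p - (0, s)) by apply: genericD => //; apply: inK2N.
have Wq : rectangle 1 1 (p - (0, s)).
  by split=> /=; rewrite ?subr0 //; apply/andP; split; lra.
have -> : tile_code (p + (0, t)) = tile_code (p - (0, s)).
  apply: periodic_tile_code; apply/rect_congr; exists 0, (-1) => /=.
  by rewrite rmorphN; split; ring.
have [q19 _] := tile_mem gq Wq.
have := all2_letters tiles_vseparated p19 q19.
case/orP => // /andP[_ dis]; have e : p = p - (0, s) + pev R (z0, zs) by rewrite /pev es e0 subrK.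
by have := tile_apart gp Wp gq Wq e; rewrite dis.
Qed.

Lemma inK2_t : inK2 (t, 0) /\ inK2 (0, t).
Proof.
have kt : inK t by apply: inKB; [exact: inK_nat|exact: inKg].
by split; split=> //; exact: inK0.
Qed.

Lemma orbit_generic (p : R * R) (i j : int) : generic p -> generic (p + (t, 0) *~ i + (0, t) *~ j).
Proof.
by have [h1 h2] := inK2_t; move=> gp; apply: genericD; [apply: genericD|]; rewrite //; apply: inK2i.
Qed.

Lemma coded_shift_OmegaU : coded_shift (@tile_code R) (t, 0) (0, t) = OmegaU.
Proof.
have [h1 h2] := inK2_t.
have sub : coded_shift (@tile_code R) (t, 0) (0, t) `<=` OmegaU.
  move=> x hx; apply/OmegaUP => -[i j]; rewrite add_e1 add_e2.
  have [p gp hp] := hx (absz i + absz j + 1)%N.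
  rewrite -(hp i j) -?(hp (i + 1) j) -?(hp i (j + 1)); try by lia.
  rewrite !mulrzDr !mulr1z; have gq := @orbit_generic p i j gp.
  apply/andP; split; last by rewrite addrA; apply: tile_vc.
  have -> : p + ((t, 0) *~ i + (t, 0)) + (0, t) *~ j = p + (t, 0) *~ i + (0, t) *~ j + (t, 0).
    by rewrite addrA [LHS]addrAC.
  exact: tile_hc.
apply/seteqP; split=> //; apply: OmegaU_subset => //; first exact: coded_shift_subshift.
have [||p gp _] := @exists_generic R setT; [exact: openT|by exists 0|].
by exists (fun n => tile_code (p + (t, 0) *~ n.1 + (0, t) *~ n.2)) => N; exists p.
Qed.

Lemma right_colE (p : R * R) : generic p -> right_col (tile_code p) = (s < redz 1 p.1).
Proof.
have k1 : inK (1 : R) by exact: inK1.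
have k0 : inK (0 : R) by exact: inK0.
have [[es _ _] e1 _ e0 _] := zevE R.
move=> g0; have cp := redr_congr 1 1 p; rewrite (periodic_tile_code cp) -[redz 1 p.1]/(redr 1 1 p).1.
have gp : generic (redr 1 1 p) by apply: generic_congr cp g0.
have Wp : rectangle 1 1 (redr 1 1 p) := redr_rectangle g0 k1 k1 ltr01 ltr01.
move: (redr 1 1 p) gp Wp => {g0 cp}p gp Wp.
have [p19 pV] := tile_mem gp Wp; have [T hT pT] := fan_cover gp pV.
have := allP (all_letters tiles_columns p19) T hT.
by case: ifP => _ h; have := tri_side_gt0 h pT; rewrite /orient /pev /= es e1 e0; lra.
Qed.

Lemma top_rowE (p : R * R) : generic p -> top_row (tile_code p) = (s < redz 1 p.2).
Proof.
have k1 : inK (1 : R) by exact: inK1.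
have k0 : inK (0 : R) by exact: inK0.
have [[es _ _] e1 _ e0 _] := zevE R.
move=> g0; have cp := redr_congr 1 1 p; rewrite (periodic_tile_code cp) -[redz 1 p.2]/(redr 1 1 p).2.
have gp : generic (redr 1 1 p) by apply: generic_congr cp g0.
have Wp : rectangle 1 1 (redr 1 1 p) := redr_rectangle g0 k1 k1 ltr01 ltr01.
move: (redr 1 1 p) gp Wp => {g0 cp}p gp Wp.
have [p19 pV] := tile_mem gp Wp; have [T hT pT] := fan_cover gp pV.
have := allP (all_letters tiles_rows p19) T hT.
by case: ifP => _ h; have := tri_side_gt0 h pT; rewrite /orient /pev /= es e1 e0; lra.
Qed.

Lemma redz1_lift (x : R) : s < redz 1 x -> s - 1 / 2 <= x -> x <= 1 + 1 / 2 -> s < x < 1.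
Proof.
have bf := golden_bounds R; have /andP[_ lt1] := redz_itv x ltr01.
move: lt1; rewrite /redz !mulr1 !divr1; case: (Num.floor x) => [[|n]|n] lt1 h1 h2 h3.
- by rewrite subr0 in lt1 h1; rewrite h1.
- have : 1 <= n.+1%:~R :> R by rewrite ler1z.
  by move=> h; lra.
have : 1 <= n.+1%:~R :> R by rewrite ler1z.
by move=> h; move: lt1 h1; rewrite NegzE rmorphN /= => lt1 h1; lra.
Qed.

Lemma hit_right (x : R) : (forall i : int, redz 1 (x + t *~ i) != s) -> exists2 i : nat, (i <= 2)%N & s < redz 1 (x + t *~ i).
Proof.
have bf := golden_bounds R; have n1 : 1 != 0 :> R by rewrite oner_eq0.
have /andP[ge0 lt1] := redz_itv x ltr01; move=> ns.
have e (i : nat) : 0 <= redz 1 x + t *~ i < 1 -> redz 1 (x + t *~ i) = redz 1 x + t *~ i.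
  move=> h; rewrite -[in RHS](redz_id h); apply/esym.
  rewrite -(redzD (redz 1 x + t *~ i) (Num.floor x) n1); congr redz.
  by rewrite /redz divr1; ring.
have [h0|h0] := ltP s (redz 1 x); first by exists 0%N; rewrite // mulr0z addr0.
have {}h0 : redz 1 x < s by have := ns 0; rewrite mulr0z addr0 lt_neqAle h0 => ->.
have [h1|h1] := ltP s (redz 1 x + t).
  by exists 1%N; rewrite // e mulr1z //; apply/andP; split; lra.
have {}h1 : redz 1 x + t < s.
  by have := ns 1; rewrite (e 1%N) mulr1z ?lt_neqAle ?h1 ?andbT //; apply/andP; split; lra.
have f53 : f < 5 / 3 by have hf := golden_sqr R; nra.
have t2 : t *~ 2%N = 2 * t by rewrite -[LHS]/(t *+ 2) mulr_natl.
by exists 2%N => //; rewrite e t2; [lra|apply/andP; split; lra].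
Qed.

(* The rotation by [t n] is the rotation by some [d] with [0 < |d| <= 1/2], and a sequence
   of steps of length [|d|] cannot stay in the interval ]s, 1[ nor jump over its
   complement. *)
Lemma no_period (n : int) : n != 0 -> exists N : nat, forall x : R,
  (forall i : int, redz 1 (x + t *~ i) != s) -> ~ (forall i : int, (absz i <= N)%N -> (s < redz 1 (x + t *~ i)) = (s < redz 1 (x + t *~ (i + n)))).
Proof.
have bf := golden_bounds R; have one : 1 != 0 :> R by rewrite oner_eq0.
move=> n0.
have [d [m [dm d0 dl du]]] : exists (d : R) (m : int), [/\ t *~ n = d + m%:~R, d != 0,
    - (1 / 2) <= d & d <= 1 / 2].
  have /andP[ge0 lt1] := redz_itv (t *~ n) ltr01.
  have re : t *~ n = redz 1 (t *~ n) + (Num.floor (t *~ n))%:~R by rewrite /redz divr1 mulr1 subrK.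
  have irr (m : int) : t *~ n != m%:~R.
    apply/eqP => e; have [] := @golden_free R (2 * n - m) (- n).
      rewrite rmorphB rmorphM rmorphN /= -e -[t *~ n]mulrzr.
      by rewrite -[2%:~R]/(2 : R); ring.
    by move=> _ /eqP; rewrite oppr_eq0 (negPf n0).
  have [le|gt] := leP (redz 1 (t *~ n)) (1 / 2).
    exists (redz 1 (t *~ n)), (Num.floor (t *~ n)); split=> //; last by lra.
    by apply/eqP => e; move: re; rewrite e add0r => /eqP; apply/negP/irr.
  exists (redz 1 (t *~ n) - 1), (Num.floor (t *~ n) + 1); split.
  - by rewrite rmorphD /=; lra.
  - by apply/eqP => e; lra.
  - by lra.
  by lra.
pose K := (Num.truncn (`|d|^-1)).+1.
have Kd : 1 < K%:R * `|d|.
  rewrite -ltr_pdivrMr ?normr_gt0 // div1r.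
  have inv0 : 0 <= `|d|^-1 by rewrite invr_ge0.
  by have /andP[_] := truncn_itv inv0.
exists (2 + K * absz n)%N => x nx h.
have [i0 i2 hi] := hit_right nx.
have inv (k : nat) : (k <= K)%N -> exists (a : R) (l : int), [/\
    x + t *~ (i0%:Z + n * k%:Z) = a + l%:~R, s < a < 1 &
    a = redz 1 (x + t *~ i0) + k%:R * d].
  elim: k => [_|k IH kK].
    exists (redz 1 (x + t *~ i0)), (Num.floor (x + t *~ i0)).
    rewrite mulr0 addr0 mul0r addr0 /redz divr1 mulr1 subrK; split=> //.
    have /andP[_ lt1] := redz_itv (x + t *~ i0) ltr01; rewrite /redz divr1 mulr1 in lt1 hi.
    by rewrite hi lt1.
  have [a [l [e a01 ae]]] := IH (ltnW kK).
  have iS : i0%:Z + n * k.+1%:Z = i0%:Z + n * k%:Z + n.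
    by rewrite -addn1 PoszD mulrDr mulr1 addrA.
  have e' : x + t *~ (i0%:Z + n * k.+1%:Z) = a + d + (l + m)%:~R.
    by rewrite iS mulrzDr addrA e dm rmorphD /=; ring.
  have a1 : redz 1 a = a by apply: redz_id; case/andP: a01 => *; apply/andP; split; lra.
  exists (a + d), (l + m); split=> //; last by rewrite ae -natr1; ring.
  apply: redz1_lift; last 2 first.
  - by case/andP: a01 => *; lra.
  - by case/andP: a01 => *; lra.
  have := h (i0%:Z + n * k%:Z); rewrite e.
  rewrite -iS e'; have mE (b : R) (c : int) : redz 1 (b + c%:~R) = redz 1 b.
    by rewrite -[c%:~R]mulr1 redzD.
  rewrite !mE a1; case/andP: a01 => -> _ <- //.
  have kn : (absz (n * k%:Z)%R <= K * absz n)%N by rewrite abszM mulnC leq_mul // ltnW.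
  by lia.
have [a [l [_ /andP[a0 a1] ae]]] := inv K (leqnn _).
have [b [l' [_ /andP[b0 b1] be]]] := inv 0%N isT.
move: be; rewrite mul0r addr0 => be; rewrite -be in ae.
have : 1 < `|a - b| by rewrite ae addrAC subrr add0r normrM ger0_norm ?ler0n.
by rewrite ltNge ler_norml; apply/negP/negPn/andP; split; lra.
Qed.

Lemma orbit_point (p : R * R) (i j : int) :
  p + (t, 0) *~ i + (0, t) *~ j = (p.1 + t *~ i, p.2 + t *~ j).
Proof. by rewrite !mulrz_pair /= !mul0rz [LHS]surjective_pairing /= !addr0. Qed.

Lemma generic_redz (p : R * R) (i : int) : generic p ->
  redz 1 (p.1 + t *~ i) != s /\ redz 1 (p.2 + t *~ i) != s.
Proof.
move=> g0; have k1 : inK (1 : R) by exact: inK1.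
have k0 : inK (0 : R) by exact: inK0.
have ks : inK s by apply: inKB => //; exact: inKg.
have := @orbit_generic p i i g0; rewrite orbit_point => gi.
have gp : generic (redr 1 1 (p.1 + t *~ i, p.2 + t *~ i)).
  exact: generic_congr (redr_congr 1 1 _) gi.
by split; [exact: (generic_neq1 gp ks)|exact: (generic_neq2 gp ks)].
Qed.

Lemma aperiodic_OmegaU : aperiodic OmegaU.
Proof.
have [h1 h2] := inK2_t; rewrite -coded_shift_OmegaU; split; first exact: coded_shift_subshift.
  have [||p gp _] := @exists_generic R setT; [exact: openT|by exists 0|].
  by exists (fun n => tile_code (p + (t, 0) *~ n.1 + (0, t) *~ n.2)) => N; exists p.
move=> x [n1 n2] hx e; have xU : OmegaU x by rewrite -coded_shift_OmegaU.
have per i j : x (i, j) = x (i + n1, j + n2) by rewrite -[LHS](congr1 (fun g => g (i, j)) e).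
apply: contrapT => n0; have [z1|nz1] := eqVneq n1 0; last first.
  have [N hN] := no_period nz1; have [p gp hp] := hx (N + absz n1)%N.
  apply: (hN p.1) => [i|i hi]; first by have [] := generic_redz i gp.
  have col k : (absz k <= N + absz n1)%N -> (s < redz 1 (p.1 + t *~ k)) = right_col (x (k, 0)).
    by move=> hk; rewrite -hp // (right_colE (@orbit_generic p k 0 gp)) orbit_point.
  rewrite !col; try lia.
  by rewrite per right_col_column.
have nz2 : n2 != 0 by apply/eqP => z2; apply: n0; rewrite z1 z2.
have [N hN] := no_period nz2; have [p gp hp] := hx (N + absz n2)%N.
apply: (hN p.2) => [i|j hj]; first by have [] := generic_redz i gp.
have row k : (absz k <= N + absz n2)%N -> (s < redz 1 (p.2 + t *~ k)) = top_row (x (0, k)).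
  by move=> hk; rewrite -hp // (top_rowE (@orbit_generic p 0 k gp)) orbit_point.
rewrite !row; try lia.
by rewrite per top_row_row.
Qed.

End Torus.

Lemma conjugate_eq (X Y : set config) : subshift Y -> X = Y -> conjugate X Y /\ X = Y.
Proof.
move=> sY ->; split=> //; split=> //; exists id, id.
by split=> //; apply: continuous_subspaceT => x.
Qed.

Section Systems.
Variable R : realType.

Lemma symbolic_shifts :
  [/\ symbolic_shift (PU R) (RU R) = OmegaU,
      symbolic_shift (P8 R) (R8 R) = Omega12,
      symbolic_shift (P0 R) (R0 R) = X0 &
      symbolic_shift (P1 R) (R1 R) = jOmega5] /\
  [/\ symbolic_shift (P3 R) (R3 R) = Omega7,
      symbolic_shift (P4 R) (R4 R) = Omega8 &
      symbolic_shift (P5 R) (R5 R) = Omega9] /\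
  (symbolic_shift (P6 R) (R6 R) = Omega10 /\ symbolic_shift (P7 R) (R7 R) = Omega11).
Proof.
have eU := coded_shift_OmegaU R; have S := omega_shiftsP eU; have C := all_codedP R.
have iE := golden_inv R; have i2E := golden_inv2 R; have i3E := golden_inv3 R.
have k1 : inK (1 : R) by exact: inK1.
have k0 : inK (0 : R) by exact: inK0.
have kf : inK (golden R) by exact: inKg.
have ks : inK (golden R)^-1 by rewrite iE; apply: inKB.
have kt : inK (golden R ^- 2) by rewrite i2E; apply: inKB => //; exact: inK_nat.
have ku : inK (- golden R ^- 3).
  by rewrite i3E; apply: inKN; apply: inKB; [apply: inKM => //|]; exact: inK_nat.
have shiftE G P c (v1 v2 : R * R) X : coded P c -> inK2 v1 -> inK2 v2 ->
    coded_shift c v1 v2 = X -> symbolic_shift P (rotation G v1 v2) = X.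
  by move=> cP h1 h2 <-; apply: symbolic_shiftE.
have one1 : inK2 ((1, 0) : R * R) by split.
have one2 : inK2 ((0, 1) : R * R) by split.
have t1 : inK2 (golden R ^- 2, 0) by split.
have t2 : inK2 (0, golden R ^- 2) by split.
have u1 : inK2 (- golden R ^- 3, 0) by split.
have u2 : inK2 (0, - golden R ^- 3) by split.
have st : inK2 ((golden R)^-1, golden R ^- 2) by split.
split; [split|split; [split|split]].
- by apply: (shiftE _ _ _ _ _ _ (codedU R) t1 t2); rewrite i2E.
- apply: (shiftE _ _ _ _ _ _ (coded8 C) u1 t2); rewrite i2E i3E; exact: shift12 S.
- apply: (shiftE _ _ _ _ _ _ (coded0 R) one1 one2); exact: shift0 S.
- apply: (shiftE _ _ _ _ _ _ (coded1 C) one1 st); rewrite iE i2E; exact: shift5 S.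
- apply: (shiftE _ _ _ _ _ _ (coded3 C) t1 t2); rewrite i2E; exact: shift7 S.
- apply: (shiftE _ _ _ _ _ _ (coded4 C) u1 t2); rewrite i2E i3E; exact: shift8 S.
- apply: (shiftE _ _ _ _ _ _ (coded5 C) u1 u2); rewrite i3E; exact: shift9 S.
- apply: (shiftE _ _ _ _ _ _ (coded6 C) u1 t2); rewrite i2E i3E; exact: shift10 S.
apply: (shiftE _ _ _ _ _ _ (coded7 C) u1 u2); rewrite i3E; exact: shift11 S.
Qed.

Lemma all_subshifts :
  [/\ subshift OmegaU, subshift Omega12, subshift X0 & subshift jOmega5] /\
  [/\ subshift Omega7, subshift Omega8 & subshift Omega9] /\
  (subshift Omega10 /\ subshift Omega11).
Proof.
have eU := coded_shift_OmegaU R; have S := omega_shiftsP eU.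
have k1 : inK (1 : R) by exact: inK1.
have k0 : inK (0 : R) by exact: inK0.
have kf : inK (golden R) by exact: inKg.
have ks : inK (golden R - 1) by apply: inKB.
have kt : inK (2 - golden R) by apply: inKB => //; exact: inK_nat.
have ku : inK (- (2 * golden R - 3)).
  by apply: inKN; apply: inKB; [apply: inKM => //|]; exact: inK_nat.
rewrite -eU -(shift12 S) -(shift11 S) -(shift10 S) -(shift9 S) -(shift8 S) -(shift7 S)
  -(shift5 S) -(shift0 S).
by split; [split|split; [split|split]]; apply: coded_shift_subshift; split.
Qed.

End Systems.

Theorem corollary1p5 (R : realType) :
  (conjugate (symbolic_shift (PU R) (RU R)) OmegaU /\
   symbolic_shift (PU R) (RU R) = substitutive_shift omegaU /\
   OmegaU = substitutive_shift omegaU /\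
   expansive omegaU /\
   minimal (substitutive_shift omegaU) /\
   aperiodic (substitutive_shift omegaU)) /\
  conjugate (symbolic_shift (P8 R) (R8 R)) Omega12 /\
  conjugate (symbolic_shift (P0 R) (R0 R)) X0 /\
  (conjugate (symbolic_shift (P1 R) (R1 R)) jOmega5 /\
   symbolic_shift (P1 R) (R1 R) = jOmega5) /\
  (conjugate (symbolic_shift (P3 R) (R3 R)) Omega7 /\
   symbolic_shift (P3 R) (R3 R) = Omega7) /\
  (conjugate (symbolic_shift (P4 R) (R4 R)) Omega8 /\
   symbolic_shift (P4 R) (R4 R) = Omega8) /\
  (conjugate (symbolic_shift (P5 R) (R5 R)) Omega9 /\
   symbolic_shift (P5 R) (R5 R) = Omega9) /\
  (conjugate (symbolic_shift (P6 R) (R6 R)) Omega10 /\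
   symbolic_shift (P6 R) (R6 R) = Omega10) /\
  (conjugate (symbolic_shift (P7 R) (R7 R)) Omega11 /\
   symbolic_shift (P7 R) (R7 R) = Omega11).
Proof.
have [[eU e8 e0 e1] [[e3 e4 e5] [e6 e7]]] := symbolic_shifts R.
have [[sU s8 s0 s1] [[s3 s4 s5] [s6 s7]]] := all_subshifts R.
have sub := OmegaU_substitutive; have aper := aperiodic_OmegaU R.
have minU : minimal (substitutive_shift omegaU).
  rewrite -sub; case: aper => _ ne _; split=> // Y sY Y0 YO.
  by apply/seteqP; split=> //; apply: OmegaU_subset.
rewrite sub in aper.
split.
  have cU := (conjugate_eq sU eU).1.
  exact: (conj cU (conj (etrans eU sub) (conj sub (conj expansive_omegaU (conj minU aper))))).
split; first exact: (conjugate_eq s8 e8).1.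
split; first exact: (conjugate_eq s0 e0).1.
split; first exact: (conjugate_eq s1 e1).
split; first exact: (conjugate_eq s3 e3).
split; first exact: (conjugate_eq s4 e4).
split; first exact: (conjugate_eq s5 e5).
split; first exact: (conjugate_eq s6 e6).
exact: (conjugate_eq s7 e7).
Qed.
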